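(* Let $n,m$ be integers with $m\geq n-1\geq 1$, and for each positive integer $\ell$ let $G$ be the group given by the presentation $$G=\Big\langle a_1,\dots,a_n,c_1,\dots,c_m \ \Big|\ [a_i,a_j]=\prod_{t=1}^m c_t^{\lambda_t^{ij}}\ (1\le i<j\le n),\ [a_i,c_j]=[c_k,c_r]=1 \text{ for all } i,j,k,r\Big\rangle,$$ where the integers $\lambda_t^{ij}$ ($1\le t\le m$, $1\le i<j\le n$) are chosen independently and uniformly at random among the integers with $|\lambda_t^{ij}|\le \ell$. Then, asymptotically almost surely as $\ell\to\infty$, all of the following hold: $Z(G)=\langle c_1,\dots,c_m\rangle$; every $a_k$ ($k=1,\dots,n$) is c-small; $[a_i,a_j]\neq 1$ for all $i<j$. Moreover, asymptotically almost surely: the ring $\mathbb{Z}$ is e-definable in $G$; $\mathcal{D}(\mathbb{Z})$ is reducible to $\mathcal{D}(G)$; $\mathcal{D}(G)$ is undecidable; the maximal ring of scalars of $G$ is $\mathbb{Z}$; and $G$ cannot be decomposed as a direct product of two non-abelian subgroups.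
   Context: Commutators: $[g,h]=g^{-1}h^{-1}gh$. A property holds asymptotically almost surely (a.a.s.) if the probability that the randomly chosen group has it tends to $1$ as $\ell\to\infty$. An element $g$ of a group $G$ is c-small if its centralizer equals $\{g^t z\mid t\in\mathbb{Z},\ z\in Z(G)\}$. A set $X\subseteq M^k$ is e-definable in a structure $\mathcal{M}$ (universe $M$) if there is a finite system of equations $\Sigma(x_1,\dots,x_k,y_1,\dots,y_r)$ over $\mathcal{M}$ (constants allowed) such that $\mathbf{a}\in X$ iff $\Sigma(\mathbf{a},\mathbf{y})$ has a solution $\mathbf{y}$ in $M$; a function or relation is e-definable if its graph is. A structure $\mathcal{A}$ is e-definable in $\mathcal{M}$ if there is an injective map $\phi:A\to M^k$ whose image is e-definable and such that the images under $\phi$ of all functions, relations and constants of $\mathcal{A}$ are e-definable in $\mathcal{M}$. The Diophantine problem $\mathcal{D}(\mathcal{A})$ is the problem of deciding whether a given finite system of equations over $\mathcal{A}$ has a solution; $\mathcal{D}(\mathcal{A})$ is reducible to $\mathcal{D}(\mathcal{M})$ if there is an effective procedure turning each system over $\mathcal{A}$ into a system over $\mathcal{M}$ that has a solution iff the original does. Rings are associative with identity. For a torsion-free finitely generated $2$-step nilpotent group $G$, let $f:G/Z(G)\times G/Z(G)\to G'$, $f(gZ(G),hZ(G))=[g,h]$ (a bilinear map of abelian groups). A commutative ring $R$ is a ring of scalars of $G$ if there are faithful actions of $R$ by endomorphisms on $M=G/Z(G)$ and on $N=G'$ such that $f(rx,y)=f(x,ry)=rf(x,y)$ for all $r\in R$,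 $x,y\in M$; identifying such $R$ with its image in $\mathrm{End}(M)$, the maximal ring of scalars is the ring of scalars containing all others. *)

(* Defs.v *)
From HB Require Import structures.
From mathcomp Require Import all_boot all_order all_algebra.
Set Implicit Arguments. Unset Strict Implicit. Unset Printing Implicit Defensive.
Import Order.TTheory GRing.Theory Num.Theory.

Inductive rf : Type :=
  | RZero | RSucc | RProj (i : nat) | RComp (f : rf) (gs : seq rf)
  | RRec (f g : rf) | RMu (f : rf).

Inductive reval : rf -> seq nat -> nat -> Prop :=
  | ev_zero v : reval RZero v 0
  | ev_succ x v : reval RSucc (x :: v) x.+1
  | ev_proj i v : reval (RProj i) v (nth 0 v i)
  | ev_comp f gs v ws y : revals gs v ws -> reval f ws y -> reval (RComp f gs) v y
  | ev_rec0 f g v y : reval f v y -> reval (RRec f g) (0 :: v) y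
  | ev_recS f g k v r y : reval (RRec f g) (k :: v) r ->
      reval g (k :: r :: v) y -> reval (RRec f g) (k.+1 :: v) y
  | ev_mu f v k : reval f (k :: v) 0 ->
      (forall j, j < k -> exists y, reval f (j :: v) y.+1) -> reval (RMu f) v k
with revals : seq rf -> seq nat -> seq nat -> Prop :=
  | evs_nil v : revals [::] v [::]
  | evs_cons g gs v y ys : reval g v y -> revals gs v ys -> revals (g :: gs) v (y :: ys).

Definition pairn (a b : nat) : nat := ((a + b) * (a + b).+1)./2 + b.
Definition code_int (z : int) : nat :=
  match z with Posz k => k.*2 | Negz k => k.*2.+1 end.
Definition code_list (l : seq nat) : nat := foldr (fun x acc => (pairn x acc).+1) 0 l.

Record grp := Grp { gcar :> Type; gmul : gcar -> gcar -> gcar;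
                    ginv : gcar -> gcar; gone : gcar }.

Section GroupNotions.
Variable G : grp.
Local Notation "x * y" := (gmul x y).

Fixpoint gpown (g : G) (k : nat) : G :=
  match k with 0 => gone G | k.+1 => g * gpown g k end.
Definition gpow (g : G) (t : int) : G :=
  match t with Posz k => gpown g k | Negz k => ginv (gpown g k.+1) end.

Definition comm (g h : G) : G := ginv g * ginv h * g * h.

Definition central (z : G) : Prop := forall g, z * g = g * z.

Definition subgroup (H : G -> Prop) : Prop :=
  [/\ H (gone G), (forall x y, H x -> H y -> H (x * y)) & (forall x, H x -> H (ginv x))].

Definition gen (S : G -> Prop) (x : G) : Prop :=
  forall H, subgroup H -> (forall y, S y -> H y) -> H x.

Definition derived (x : G) : Prop := gen (fun y => exists g h, y = comm g h) x.

Definition c_small (g : G) : Prop :=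
  forall h, h * g = g * h <-> exists (t : int) (z : G), central z /\ h = gpow g t * z.

Definition abelian (H : G -> Prop) : Prop :=
  forall x y, H x -> H y -> x * y = y * x.

Definition nonabelian_direct_decomp : Prop :=
  exists H K : G -> Prop,
    subgroup H /\ subgroup K /\
    (forall h k, H h -> K k -> h * k = k * h) /\
    (forall x, H x -> K x -> x = gone G) /\
    (forall g, exists h k, [/\ H h, K k & g = h * k]) /\
    ~ abelian H /\ ~ abelian K.

Inductive gterm : Type :=
  | GVar (i : nat) | GCst (g : G) | GMul (s t : gterm) | GInv (t : gterm).

Fixpoint geval (e : nat -> G) (t : gterm) : G :=
  match t with
  | GVar i => e i | GCst g => g
  | GMul s t => geval e s * geval e t | GInv t => ginv (geval e t)
  end.

Definition gsat (e : nat -> G) (S : seq (gterm * gterm)) : Prop :=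
  foldr (fun p P => geval e p.1 = geval e p.2 /\ P) True S.

Definition gsolvable (S : seq (gterm * gterm)) : Prop := exists e, gsat e S.

(* X (a set of k-tuples, a tuple being given by its coordinates a 0 .. a (k-1))
   is e-definable: there is a finite system S in variables x_0..x_{k-1} and
   extra variables y such that a in X iff S(a, y) has a solution y. *)
Definition edef (k : nat) (X : (nat -> G) -> Prop) : Prop :=
  exists S : seq (gterm * gterm), forall a : nat -> G,
    X a <-> exists y : nat -> G, gsat (fun i => if i < k then a i else y i) S.

Definition Z_edefinable : Prop :=
  exists (k : nat) (phi : int -> nat -> G),
    (forall x y, (forall i, i < k -> phi x i = phi y i) -> x = y) /\
    [/\ edef k (fun a => exists x, forall i, i < k -> a i = phi x i),
        edef (3 * k) (fun a => exists x y, forall i, i < k ->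
           [/\ a i = phi x i, a (k + i) = phi y i & a (2 * k + i) = phi (x + y)%R i]),
        edef (3 * k) (fun a => exists x y, forall i, i < k ->
           [/\ a i = phi x i, a (k + i) = phi y i & a (2 * k + i) = phi (x * y)%R i]),
        edef k (fun a => forall i, i < k -> a i = phi 0%R i)
      & edef k (fun a => forall i, i < k -> a i = phi 1%R i)].

Fixpoint code_gterm (enc : G -> nat) (t : gterm) : nat :=
  match t with
  | GVar i => pairn 0 i
  | GCst g => pairn 1 (enc g)
  | GMul s t => pairn 2 (pairn (code_gterm enc s) (code_gterm enc t))
  | GInv t => pairn 3 (code_gterm enc t)
  end.
Definition code_gsys (enc : G -> nat) (S : seq (gterm * gterm)) : nat :=
  code_list [seq pairn (code_gterm enc p.1) (code_gterm enc p.2) | p <- S].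

Definition D_decidable (enc : G -> nat) : Prop :=
  exists c : rf, forall S,
    (gsolvable S -> reval c [:: code_gsys enc S] 1) /\
    (~ gsolvable S -> reval c [:: code_gsys enc S] 0).

(* congruence modulo Z(G): elements of M = G/Z(G) are represented by elements of G *)
Definition modZ (x y : G) : Prop := exists z, central z /\ x = y * z.

(* (R, rho, nu) is a ring of scalars: rho gives a faithful action of R by
   endomorphisms of M = G/Z(G) (acting on representatives), nu a faithful
   action by endomorphisms of N = G', and f(rx,y) = f(x,ry) = r f(x,y). *)
Definition ring_of_scalars (R : comNzRingType) (rho nu : R -> G -> G) : Prop :=
  [/\
      (forall r x y, modZ x y -> modZ (rho r x) (rho r y)) /\
      [/\ forall r x y, modZ (rho r (x * y)) (rho r x * rho r y),
          forall r s x, modZ (rho (r + s)%R x) (rho r x * rho s x),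
          forall r s x, modZ (rho (r * s)%R x) (rho r (rho s x)),
          forall x, modZ (rho 1%R x) x
        & forall r s, (forall x, modZ (rho r x) (rho s x)) -> r = s],
      (forall r x, derived x -> derived (nu r x)) /\
      [/\ forall r x y, derived x -> derived y -> nu r (x * y) = nu r x * nu r y,
          forall r s x, derived x -> nu (r + s)%R x = nu r x * nu s x,
          forall r s x, derived x -> nu (r * s)%R x = nu r (nu s x),
          forall x, derived x -> nu 1%R x = x
        & forall r s, (forall x, derived x -> nu r x = nu s x) -> r = s]
    &
      forall r x y, comm (rho r x) y = nu r (comm x y) /\ comm x (rho r y) = nu r (comm x y)].

(* the maximal ring of scalars of G is Z: Z (acting by powers) is a ring of
   scalars, and (identified with its image in End(M)) every ring of scalars is
   contained in the image of Z. *)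
Definition max_ring_of_scalars_is_Z : Prop :=
  ring_of_scalars (fun (k : int) (x : G) => gpow x k) (fun (k : int) (x : G) => gpow x k) /\
  forall (R : comNzRingType) (rho nu : R -> G -> G), ring_of_scalars rho nu ->
    forall r : R, exists k : int, forall x, modZ (rho r x) (gpow x k).

End GroupNotions.

Inductive zterm : Type :=
  | ZVar (i : nat) | ZCst (c : int) | ZAdd (s t : zterm) | ZMul (s t : zterm).

Fixpoint zeval (e : nat -> int) (t : zterm) : int :=
  match t with
  | ZVar i => e i | ZCst c => c
  | ZAdd s t => (zeval e s + zeval e t)%R | ZMul s t => (zeval e s * zeval e t)%R
  end.

Definition zsolvable (S : seq (zterm * zterm)) : Prop :=
  exists e, foldr (fun p P => zeval e p.1 = zeval e p.2 /\ P) True S.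

Fixpoint code_zterm (t : zterm) : nat :=
  match t with
  | ZVar i => pairn 0 i
  | ZCst c => pairn 1 (code_int c)
  | ZAdd s t => pairn 2 (pairn (code_zterm s) (code_zterm t))
  | ZMul s t => pairn 3 (pairn (code_zterm s) (code_zterm t))
  end.
Definition code_zsys (S : seq (zterm * zterm)) : nat :=
  code_list [seq pairn (code_zterm p.1) (code_zterm p.2) | p <- S].

Definition DZ_reducible_to (G : grp) (enc : G -> nat) : Prop :=
  exists c : rf, forall S : seq (zterm * zterm),
    exists S' : seq (gterm G * gterm G),
      reval c [:: code_zsys S] (code_gsys enc S') /\ (zsolvable S <-> gsolvable S').

(* 3. The group G given by the presentation, realised concretely on       *)
(*    Z^n x Z^m with (x,z)(y,w) = (x+y, z+w+beta(x,y)),                    *)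
(*    beta(x,y)_t = sum_{i<j} lambda_t^{ij} x_i y_j.                       *)

Section NilGroup.
Local Open Scope ring_scope.
Variables (n m : nat) (lam : 'I_m -> 'I_n -> 'I_n -> int).

Definition Gel := ('rV[int]_n * 'rV[int]_m)%type.

Definition beta (x y : 'rV[int]_n) : 'rV[int]_m :=
  \row_t \sum_(i < n) \sum_(j < n | (i < j)%N) lam t i j * x 0 i * y 0 j.

Definition Gmul (p q : Gel) : Gel := (p.1 + q.1, p.2 + q.2 + beta p.1 q.1).
Definition Ginv (p : Gel) : Gel := (- p.1, - p.2 + beta p.1 p.1).
Definition Gone : Gel := (0, 0).

Definition NilG : grp := @Grp Gel Gmul Ginv Gone.

Definition gen_a (i : 'I_n) : NilG := (delta_mx 0 i, 0) : Gel.
Definition gen_c (t : 'I_m) : NilG := (0, delta_mx 0 t) : Gel.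

Definition enc_G (p : NilG) : nat :=
  code_list ([seq code_int ((p : Gel).1 0 i) | i <- enum 'I_n] ++
             [seq code_int ((p : Gel).2 0 t) | t <- enum 'I_m]).
End NilGroup.

Definition Idx (n : nat) := {p : 'I_n * 'I_n | (p.1 < p.2)%N}.

(* a sample: for each (t, (i,j)) a value in {0..2l}, lambda = value - l,
   i.e. lambda uniform in {-l..l}, independently *)
Definition Sample (n m l : nat) := {ffun 'I_m * Idx n -> 'I_(2 * l + 1)}.

Definition lamOf (n m l : nat) (s : Sample n m l) : 'I_m -> 'I_n -> 'I_n -> int :=
  fun t i j => if @insub _ _ (Idx n) (i, j) is Some p
               then ((s (t, p) : nat)%:Z - l%:Z)%R else 0%R.

(* P holds a.a.s.: Prob_l(P) -> 1 as l -> oo (under the uniform measure on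
   Sample n m l); stated as: for every eps > 0, for all large l, the set of
   samples satisfying P has proportion > 1 - eps. *)
Definition aas (n m : nat) (P : forall l, Sample n m l -> Prop) : Prop :=
  forall eps : rat, (0 < eps)%R -> exists L : nat, forall l, (L <= l)%N ->
    exists A : {set Sample n m l},
      (forall s, s \in A -> P l s) /\
      ((1 - eps) * (#|[set: Sample n m l]|)%:R < (#|A|)%:R)%R.

(* Main.v *)
Require Import Defs.
From mathcomp Require Import all_boot all_order all_algebra.
From mathcomp Require Import zify ring.

Set Implicit Arguments.
Unset Strict Implicit.
Unset Printing Implicit Defensive.
Import Order.TTheory GRing.Theory Num.Theory.

(** Write [om] for the commutator form induced on [Z^n] by the group [G]. Asymptotically
    almost surely, for each [k] the matrix of [om (e_k, -)] restricted to its first [n - 1]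
    rows and to the columns [e_j], [j <> k], has a nonzero determinant: if it vanishes,
    some leading principal minor vanishes while the previous one does not, which
    determines one random entry from the others. Then [a_k] commutes exactly with its
    powers times central elements, and everything else follows from this.

    The integers are interpreted as the powers of [[a, b]], for two generators [a] and
    [b]: a power is lifted to the centralizer of [a] or to that of [b], and the product is
    [[a^x, b^y] = [a, b]^(x y)]. This reduces equations over [Z] to equations over [G],
    whose undecidability is thus Hilbert's tenth problem. The latter is proved here from
    the Pell equation: exponentiation, binomial coefficients and factorials are
    Diophantine, hence Diophantine sets are closed under bounded quantification, hence
    graphs of recursive functions are Diophantine; natural numbers are sums of four
    squares, and a diagonal argument concludes. *)

(** * The Pell equation *)

(** The condition [m >= n - 1] leaves room for the square matrices: [om (e_k, x)] has [m]
    coordinates, and forcing the [n - 1] unknowns [x_j], [j <> k], to vanish takes [n - 1]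
    independent rows. There are [n (n - 1)] bad events, one for each [k] and each order of a minor,
    and each has probability at most [1 / (2 l + 1)]; a union bound then suffices, although the
    matrices for different [k] share random entries. After that the argument is deterministic.

    Reducibility and undecidability are stated for the functions [rf] acting on numeric codes. The
    reduction therefore has to be an explicit recursive function on codes, and Hilbert's tenth
    problem has to be settled for the same codes.

    The Pell equation serves because its solutions grow exponentially with an index that polynomial
    congruences can recover. Exponentials, binomial coefficients and factorials are then used to
    pack a variable number of witnesses into a fixed number of integers. Bounded quantification is
    what primitive recursion and minimization ask for: every step up to a bound must be correct. *)

Section Pell.
Local Open Scope ring_scope.

(** The pair is [(X, Y)] with [X + Y d = (a + d)^n], where [d^2 = a^2 - 1]; the identities below are
    computations with these powers. The case [a = 1] is included, to compare [Y_n] with [n]. *)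
Fixpoint pell (a : int) (n : nat) : int * int :=
  if n is n'.+1 then
    let: (x, y) := pell a n' in (a * x + (a ^+ 2 - 1) * y, x + a * y)
  else (1, 0).
Definition px a n := (pell a n).1.
Definition py a n := (pell a n).2.

Lemma pxS a n : px a n.+1 = a * px a n + (a ^+ 2 - 1) * py a n.
Proof. by rewrite /px /py /=; case: (pell a n). Qed.

Lemma pyS a n : py a n.+1 = px a n + a * py a n.
Proof. by rewrite /px /py /=; case: (pell a n). Qed.

Lemma pell_eq a n : px a n ^+ 2 - (a ^+ 2 - 1) * py a n ^+ 2 = 1.
Proof.
elim: n => [|n IH]; first by rewrite /px /py /=; ring.
by rewrite pxS pyS -[RHS]IH; ring.
Qed.

Lemma pell_add a m n :
  px a (m + n) = px a m * px a n + (a ^+ 2 - 1) * (py a m * py a n) /\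
  py a (m + n) = px a m * py a n + py a m * px a n.
Proof.
elim: n => [|n [IHx IHy]]; first by rewrite addn0 /px /py /=; split; ring.
by rewrite addnS !pxS !pyS IHx IHy; split; ring.
Qed.

Lemma pell_sub a m n : (n <= m)%N ->
  px a (m - n) = px a m * px a n - (a ^+ 2 - 1) * (py a m * py a n) /\
  py a (m - n) = py a m * px a n - px a m * py a n.
Proof.
move=> le_nm; have [Ex Ey] := pell_add a (m - n) n; rewrite subnK // in Ex Ey.
rewrite Ex Ey; split.
  transitivity (px a (m - n) * (px a n ^+ 2 - (a ^+ 2 - 1) * py a n ^+ 2)); last ring.
  by rewrite pell_eq mulr1.
transitivity (py a (m - n) * (px a n ^+ 2 - (a ^+ 2 - 1) * py a n ^+ 2)); last ring.
by rewrite pell_eq mulr1.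
Qed.

Lemma px_double a n : px a n.*2 = 2 * px a n ^+ 2 - 1.
Proof.
rewrite -addnn (pell_add a n n).1.
transitivity (2 * px a n ^+ 2 - (px a n ^+ 2 - (a ^+ 2 - 1) * py a n ^+ 2)); first ring.
by rewrite pell_eq.
Qed.

Lemma py_double a n : py a n.*2 = 2 * px a n * py a n.
Proof. by rewrite -addnn (pell_add a n n).2; ring. Qed.

Section Growth.
Variable a : int.
Hypothesis a_gt1 : 1 < a.

Lemma pell_pos n : 0 < px a n /\ 0 <= py a n.
Proof.
elim: n => [|n [IHx IHy]]; first by rewrite /px /py /=; lia.
by rewrite pxS pyS; split; nia.
Qed.

Lemma px_gt0 n : 0 < px a n. Proof. by case: (pell_pos n). Qed.
Lemma py_ge0 n : 0 <= py a n. Proof. by case: (pell_pos n). Qed.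

Lemma py_ltS n : py a n < py a n.+1.
Proof. by have [? ?] := pell_pos n; rewrite pyS; nia. Qed.

Lemma px_ltS n : px a n < px a n.+1.
Proof. by have [? ?] := pell_pos n; rewrite pxS; nia. Qed.

Lemma py_lt m n : (m < n)%N -> py a m < py a n.
Proof.
elim: n => // n IH; rewrite ltnS leq_eqVlt => /predU1P[->|/IH lt_mn].
  exact: py_ltS.
exact: lt_trans lt_mn (py_ltS n).
Qed.

Lemma px_lt m n : (m < n)%N -> px a m < px a n.
Proof.
elim: n => // n IH; rewrite ltnS leq_eqVlt => /predU1P[->|/IH lt_mn].
  exact: px_ltS.
exact: lt_trans lt_mn (px_ltS n).
Qed.

Lemma px_inj : injective (px a).
Proof.
by move=> m n Emn; case: (ltngtP m n) => // /px_lt; rewrite Emn ltxx.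
Qed.

Lemma py_gt0 n : (0 < n)%N -> 0 < py a n.
Proof. exact: (@py_lt 0). Qed.

Lemma py_ge n : n%:Z <= py a n.
Proof. by elim: n => // n IH; have := py_ltS n; lia. Qed.

Lemma px_ge_exp n : a ^+ n <= px a n.
Proof.
elim: n => // n IH; rewrite pxS exprS; have := py_ge0 n.
by have := px_gt0 n; move: IH; set u := a ^+ n; nia.
Qed.

(** Descent: multiplying [x + y d] by [a - d], the inverse of the fundamental solution, gives a
    solution with a smaller [y]. *)
Lemma pell_solve x y : 0 <= x -> 0 <= y ->
  x ^+ 2 - (a ^+ 2 - 1) * y ^+ 2 = 1 -> exists n, x = px a n /\ y = py a n.
Proof.
move=> x0 y0; move: {2}`|y|%N (leqnn `|y|%N) => k.
elim: k x y x0 y0 => [|k IH] x y x0 y0 lek E.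
  have y_0 : y = 0 by lia.
  by exists 0%N; rewrite /px /py /= y_0; split=> //; move: E; rewrite y_0; nia.
have [y_0|y_gt0] : y = 0 \/ 0 < y by lia.
  by exists 0%N; rewrite /px /py /= y_0; split=> //; move: E; rewrite y_0; nia.
have sq_lt (u v : int) : 0 <= v -> u ^+ 2 < v ^+ 2 -> u < v.
  by move=> v0; apply: contraTT; rewrite -!leNgt; move: v0; nia.
have y2 : 1 <= y ^+ 2 by nia.
(* [lt1] and [lt2] give [0 <= a y - x < y], and [lt3] the positivity of the new [x]; each is
   obtained by comparing squares. *)
have lt1 : x < a * y + 1.
  apply: sq_lt; first nia.
  have -> : x ^+ 2 = a ^+ 2 * y ^+ 2 - y ^+ 2 + 1 by lia.
  nia.
have lt2 : (a - 1) * y < x.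
  apply: sq_lt; first nia.
  have -> : x ^+ 2 = (a ^+ 2 - 1) * y ^+ 2 + 1 by lia.
  have -> : ((a - 1) * y) ^+ 2 = (a - 1) ^+ 2 * y ^+ 2 by ring.
  nia.
have lt3 : 0 < a * x - (a ^+ 2 - 1) * y.
  rewrite subr_gt0; apply: sq_lt; first nia.
  have -> : (a * x) ^+ 2 = a ^+ 2 * ((a ^+ 2 - 1) * y ^+ 2 + 1) by rewrite exprMn; congr (_ * _); lia.
  have -> : ((a ^+ 2 - 1) * y) ^+ 2 = (a ^+ 2 - 1) ^+ 2 * y ^+ 2 by ring.
  rewrite -subr_gt0.
  have -> : a ^+ 2 * ((a ^+ 2 - 1) * y ^+ 2 + 1) - (a ^+ 2 - 1) ^+ 2 * y ^+ 2 =
     (a ^+ 2 - 1) * y ^+ 2 + a ^+ 2 by ring.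
  nia.
have [n [En1 En2]] := IH (a * x - (a ^+ 2 - 1) * y) (a * y - x)
  (ltW lt3) ltac:(lia) ltac:(lia) ltac:(rewrite -[RHS]E; ring).
by exists n.+1; rewrite pxS pyS -En1 -En2; split; ring.
Qed.

End Growth.

Lemma pell_coprime a n : coprimez (px a n) (py a n).
Proof.
apply/coprimezP; exists (px a n, - ((a ^+ 2 - 1) * py a n)) => /=.
by rewrite -[RHS](pell_eq a n); ring.
Qed.

Lemma py_dvd_mul a m q : (py a m %| py a (m * q))%Z.
Proof.
elim: q => [|q IH]; first by rewrite muln0 dvdz0.
rewrite mulnS (pell_add a m _).2; apply: rpredD; first exact: dvdz_mull.
exact: dvdz_mulr.
Qed.

(** Divide: [n = q m + r]. Since [Y_m] divides [Y_(q m)] and is coprime to [X_(q m)], it divides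
    [Y_r], which is smaller than [Y_m]. *)
Lemma dvdn_of_py a m n : 1 < a -> (0 < m)%N -> (py a m %| py a n)%Z -> (m %| n)%N.
Proof.
move=> a1 m0; rewrite (divn_eq n m) (pell_add a _ _).2 => dv.
have dq : (py a m %| py a (n %/ m * m))%Z by rewrite mulnC py_dvd_mul.
have cop : coprimez (py a m) (px a (n %/ m * m)).
  have := pell_coprime a (n %/ m * m); rewrite coprimez_sym => /coprimez_dvdl.
  by apply.
have dq' := dvdz_mulr (px a (n %% m)) dq.
rewrite rpredDr // Gauss_dvdzr // in dv.
have lt := py_lt a1 (ltn_pmod n m0).
have : py a (n %% m) = 0.
  apply/eqP; apply: contraTT dv => nz; apply/negP => /dvdzP[k Ek].
  move: nz lt Ek (py_ge0 a1 (n %% m)) (py_gt0 a1 m0).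
  move: (py a (n %% m)) (py a m) => u v nz lt Ek u0 v0.
  have [?|[?|?]] : k < 0 \/ k = 0 \/ 0 < k by lia.
  - by nia.
  - by subst k; lia.
  - by nia.
move=> E; rewrite dvdn_addr ?dvdn_mull // /dvdn modn_mod.
by case: posnP => // /(py_gt0 a1); rewrite E.
Qed.

(** Expansion of [(X_n + Y_n d)^k] modulo [Y_n^2]. The second congruence is multiplied by [X_n] so
    that the exponent [k - 1] does not occur. *)
Lemma pell_mul_mod a n k :
  (py a n ^+ 2 %| px a (n * k) - px a n ^+ k)%Z /\
  (py a n ^+ 2 %| px a n * py a (n * k) - k%:Z * px a n ^+ k * py a n)%Z.
Proof.
elim: k => [|k [/dvdzP[u Eu] /dvdzP[v Ev]]].
  by rewrite muln0 /px /py /=; split; apply/dvdzP; exists 0; ring.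
have [Ex Ey] := pell_add a n (n * k); have /dvdzP[w Ew] := py_dvd_mul a n k.
rewrite mulnS Ex Ey; split; apply/dvdzP.
  exists (px a n * u + (a ^+ 2 - 1) * w).
  have -> : px a (n * k) = u * py a n ^+ 2 + px a n ^+ k by rewrite -Eu; ring.
  by rewrite Ew (exprS _ k); ring.
exists (px a n * v + px a n * py a n * u).
have -> : px a (n * k) = u * py a n ^+ 2 + px a n ^+ k by rewrite -Eu; ring.
have E : px a n * py a (n * k) = v * py a n ^+ 2 + k%:Z * px a n ^+ k * py a n
  by rewrite -Ev; ring.
transitivity (px a n * (px a n * py a (n * k))
   + px a n * (py a n * (u * py a n ^+ 2 + px a n ^+ k))
   - k.+1%:Z * px a n ^+ k.+1 * py a n); first by ring.
by rewrite E (exprS _ k) intS; ring.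
Qed.

Lemma py_sq_dvd a n k : 1 < a -> (0 < n)%N ->
  (py a n ^+ 2 %| py a (n * k))%Z = (py a n %| k%:Z)%Z.
Proof.
move=> a1 n0; have cop := pell_coprime a n; rewrite coprimez_sym in cop.
have cop2 : coprimez (py a n ^+ 2) (px a n) by rewrite coprimezXl.
rewrite -(Gauss_dvdzr _ cop2).
have [_ dv] := pell_mul_mod a n k.
have copk : coprimez (py a n) (px a n ^+ k) by rewrite coprimezXr.
have y0 : py a n != 0 by have := py_gt0 a1 n0; lia.
have : (py a n * py a n %| k%:Z * px a n ^+ k * py a n)%Z = (py a n %| k%:Z * px a n ^+ k)%Z.
  exact: dvdz_mul2r.
rewrite -expr2 [k%:Z * _]mulrC (Gauss_dvdzr _ copk) => <-.
rewrite -[X in (_ %| X)%Z = _](subrK (k%:Z * px a n ^+ k * py a n)) rpredDl //.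
by rewrite [k%:Z * _]mulrC.
Qed.

Lemma dvdn_of_py_sq a n t : 1 < a -> (0 < n)%N ->
  (py a n ^+ 2 %| py a t)%Z -> (py a n %| t%:Z)%Z.
Proof.
move=> a1 n0 dv; have /(dvdn_of_py a1 n0)/dvdnP[k Ek] : (py a n %| py a t)%Z.
  by apply: dvdz_trans dv; rewrite expr2 dvdz_mulr.
by move: dv; rewrite Ek mulnC py_sq_dvd // PoszM => dv; rewrite dvdz_mull.
Qed.

End Pell.

(** * Recovering the index of a Pell solution from congruences *)

Section PellCongruences.
Local Open Scope ring_scope.

Lemma dvdz_small (d m : int) : (d %| m)%Z -> `|m| < d -> m = 0.
Proof.
move=> /dvdzP[k ->] lt; have [?|[k0|?]] : k < 0 \/ k = 0 \/ 0 < k by lia.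
- by nia.
- by rewrite k0 mul0r.
- by nia.
Qed.

Lemma dvdz_le (d m : int) : 0 < m -> (d %| m)%Z -> d <= m.
Proof.
by move=> m0 dv; rewrite leNgt; apply/negP => lt; have := dvdz_small dv; lia.
Qed.

(** With [u = a + d] one has [u^(2 n) = 2 X_n u^n - 1], so a shift of the index by [2 n] changes the
    sign modulo [X_n]. This yields the period [4 n] and the reflections below. *)
Lemma px_shift2 a n j : (px a n %| px a (n.*2 + j) + px a j)%Z.
Proof.
apply/dvdzP; exists (2 * px a n * px a j + 2 * (a ^+ 2 - 1) * py a n * py a j).
by rewrite (pell_add a _ _).1 px_double py_double; ring.
Qed.

Lemma px_shift4 a n j : (px a n %| px a (4 * n + j) - px a j)%Z.
Proof.
have -> : (4 * n + j = n.*2 + (n.*2 + j))%N by lia.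
have := rpredB (px_shift2 a n (n.*2 + j)) (px_shift2 a n j).
by rewrite addrKA.
Qed.

Lemma px_shift4q a n q j : (px a n %| px a (4 * n * q + j) - px a j)%Z.
Proof.
elim: q => [|q IH]; first by rewrite muln0 subrr dvdz0.
have -> : (4 * n * q.+1 + j = 4 * n + (4 * n * q + j))%N by lia.
have := rpredD (px_shift4 a n (4 * n * q + j)) IH.
by rewrite addrA subrK.
Qed.

Lemma px_refl2 a n j : (j <= n.*2)%N -> (px a n %| px a (n.*2 - j) + px a j)%Z.
Proof.
move=> lej; apply/dvdzP.
exists (2 * px a n * px a j - 2 * (a ^+ 2 - 1) * py a n * py a j).
by rewrite (pell_sub a lej).1 px_double py_double; ring.
Qed.

Lemma px_refl4 a n j : (j <= n.*2)%N -> (px a n %| px a (4 * n - j) - px a j)%Z.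
Proof.
move=> lej; have -> : (4 * n - j = n.*2 + (n.*2 - j))%N by lia.
have := rpredB (px_shift2 a n (n.*2 - j)) (px_refl2 a lej).
by rewrite addrKA.
Qed.

(** For [j <= n] the difference is too small to be a nonzero multiple of [X_n]. For [j > n],
    reflection replaces [X_j] by [- X_h] with [h = 2 n - j < n], and [X_h + X_i] would equal [X_n]:
    absurd for [i = n], and for [i < n] because [X_n > 2 X_(n - 1)]. *)
Lemma px_mod_half a i j n : 1 < a -> (0 < i <= n)%N -> (j <= n.*2)%N ->
  (px a n %| px a j - px a i)%Z -> j = i.
Proof.
move=> a1 /andP[i0 lein] lej /dvdzP[k Ek].
have [pi pn pj] : [/\ 0 < px a i, 0 < px a n & 0 < px a j].
  by split; apply: px_gt0.
have le_px (s t : nat) : (s <= t)%N -> px a s <= px a t.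
  by rewrite leq_eqVlt => /predU1P[->|/(px_lt a1)/ltW].
have [lejn|ltnj] := leqP j n.
  have := le_px _ _ lein; have := le_px _ _ lejn => h1 h2.
  apply: (px_inj a1); have : k = 0 by nia.
  by move=> k0; move: Ek; rewrite k0; lia.
have /dvdzP[l El] := px_refl2 a lej; set h := (n.*2 - j)%N in El.
have lthn : (h < n)%N by lia.
have ph := px_gt0 a1 h.
have lth := px_lt a1 lthn.
have lei := le_px _ _ lein.
have E : px a h + px a i = (l - k) * px a n by rewrite mulrBl -El -Ek; ring.
have E1 : px a h + px a i = px a n.
  by have : l - k = 1 by [nia]; move=> E2; rewrite E E2 mul1r.
move: lein; rewrite leq_eqVlt => /predU1P[Ein|ltin]; first by subst i; lia.
have n1 : (0 < n.-1)%N by lia.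
have Sn : n = n.-1.+1 by lia.
have := le_px i n.-1 ltac:(lia); have := le_px h n.-1 ltac:(lia).
move: E1; rewrite {1}Sn pxS; have := py_gt0 a1 n1; have := px_gt0 a1 n.-1.
have : 0 < a ^+ 2 - 1 by nia.
by nia.
Qed.

Lemma px_mod_inj a i j n : 1 < a -> (0 < i <= n)%N ->
  (px a n %| px a j - px a i)%Z ->
  ((4 * n)%N%:Z %| j%:Z - i%:Z)%Z \/ ((4 * n)%N%:Z %| j%:Z + i%:Z)%Z.
Proof.
move=> a1 hi dv; have n0 : (0 < n)%N by lia.
have Ej : j = (4 * n * (j %/ (4 * n)) + j %% (4 * n))%N by rewrite mulnC -divn_eq.
have lt : (j %% (4 * n) < 4 * n)%N by rewrite ltn_pmod //; lia.
move: Ej lt dv; move: (j %/ _)%N (j %% _)%N => q r -> lt dv.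
have {}dv : (px a n %| px a r - px a i)%Z.
  have := rpredB dv (px_shift4q a n q r).
  by rewrite opprB addrC addrA subrK.
have [ler|ltr] := leqP r n.*2.
  left; rewrite (px_mod_half a1 hi ler dv).
  by apply/dvdzP; exists q%:Z; lia.
right; have le' : (4 * n - r <= n.*2)%N by lia.
have dv' : (px a n %| px a (4 * n - r) - px a i)%Z.
  have := rpredB dv (px_refl4 a le').
  have -> : (4 * n - (4 * n - r) = r)%N by lia.
  by rewrite opprB addrC addrA subrK.
have := px_mod_half a1 hi le' dv' => Ei.
by apply/dvdzP; exists (q%:Z + 1); lia.
Qed.

Lemma pell_congr a b c n : (c %| b - a)%Z ->
  (c %| px b n - px a n)%Z /\ (c %| py b n - py a n)%Z.
Proof.
move=> /dvdzP[k Ek]; have Eb : b = a + k * c by rewrite -Ek; ring.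
elim: n => [|n [/dvdzP[u Eu] /dvdzP[v Ev]]].
  by rewrite /px /py /= !subrr dvdz0.
have Ex : px b n = px a n + u * c by rewrite -Eu; ring.
have Ey : py b n = py a n + v * c by rewrite -Ev; ring.
rewrite !pxS !pyS Ex Ey Eb; split; apply/dvdzP.
  exists (a * u + k * px a n + k * c * u + (a ^+ 2 - 1) * v +
          (2 * a * k + k ^+ 2 * c) * (py a n + v * c)).
  by ring.
by exists (u + a * v + k * (py a n + v * c)); ring.
Qed.

(** At [a = 1] the recursion gives [X_n = 1] and [Y_n = n], and the solutions for [a] agree with
    these modulo [a - 1]. *)
Lemma py_mod_index a n : (a - 1 %| py a n - n%:Z)%Z.
Proof.
have -> : n%:Z = py 1 n.
  have [] : px 1 n = 1 /\ py 1 n = n%:Z; last by [].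
  by elim: n => [|n [IHx IHy]] //; rewrite pxS pyS IHx IHy; split; lia.
by case: (@pell_congr 1 a (a - 1) n (dvdzz _)).
Qed.

(** The number [a + d] is a root of [t^2 - 2 a t + 1], and so is [k] modulo [2 a k - k^2 - 1].
    Sending [d] to [k - a] therefore turns [(a + d)^n] into [k^n]. *)
Lemma pell_pow a k n :
  (2 * a * k - k ^+ 2 - 1 %| px a n - py a n * (a - k) - k ^+ n)%Z.
Proof.
elim: n => [|n /dvdzP[u Eu]]; apply/dvdzP.
  by exists 0; rewrite /px /py /=; ring.
exists (k * u + py a n).
have E : px a n = u * (2 * a * k - k ^+ 2 - 1) + py a n * (a - k) + k ^+ n.
  by rewrite -Eu; ring.
by rewrite pxS pyS E (exprS _ n); ring.
Qed.

(* Matiyasevich and Robinson: writing [x = X_i(a)], [u = X_n(a)] and [s = X_j(b)],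
   the congruence modulo [u] gives [j = i] or [j = - i] modulo [4 n], hence modulo
   [4 y] because [y ^ 2] divides [v = Y_n(a)]; and [t = j] modulo [4 y] since
   [b = 1] modulo [4 y]. So [k = i] or [k = - i] modulo [4 y], with [i, k <= y]. *)
Lemma pell_char a k x y : 1 < a -> 0 <= x -> 0 <= y -> (0 < k)%N ->
  (x = px a k /\ y = py a k) <->
  exists u v s t b : int,
    [/\ [/\ 0 <= u, 0 < v, 0 <= s, 0 <= t & 1 < b],
        [/\ x ^+ 2 - (a ^+ 2 - 1) * y ^+ 2 = 1,
            u ^+ 2 - (a ^+ 2 - 1) * v ^+ 2 = 1,
            s ^+ 2 - (b ^+ 2 - 1) * t ^+ 2 = 1 & k%:Z <= y],
        [/\ (y ^+ 2 %| v)%Z, (4 * y %| b - 1)%Z & (u %| b - a)%Z]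
      & (u %| s - x)%Z /\ (4 * y %| t - k%:Z)%Z].
Proof.
move=> a1 x0 y0 k0; split=> [[-> ->]|]; last first.
  case=> [u [v [s [t [b [[u0 v0 s0 t0 b1]]]]]]].
  case=> E1 E2 E3 ley [d1 d2 d3] [d4 d5].
  have [i [Ex Ey]] := pell_solve a1 x0 y0 E1.
  have [n [Eu Ev]] := pell_solve a1 u0 (ltW v0) E2.
  have [j [Es Et]] := pell_solve b1 s0 t0 E3.
  have i0 : (0 < i)%N by case: (i) Ey => // Ey; move: ley; rewrite Ey /py /=; lia.
  have lein : (i <= n)%N.
    rewrite leqNgt; apply/negP => /(py_lt a1); rewrite -Ey -Ev.
    have := dvdz_le v0 d1; have : 1 <= y by clear -ley k0; lia.
    by clear; move=> y1 le lt; have : y <= y ^+ 2 by [nia]; lia.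
  have dx : (px a n %| px a j - px a i)%Z.
    rewrite -Eu -Ex; have [h _] := pell_congr j d3.
    have -> : px a j - x = (s - x) - (px b j - px a j) by rewrite -Es; ring.
    exact: rpredB.
  have d6 : (4 * y %| (4 * n)%N%:Z)%Z.
    rewrite PoszM; apply: dvdz_mul => //.
    by rewrite Ey; apply: dvdn_of_py_sq => //; rewrite -Ey -Ev.
  have d7 : (4 * y %| j%:Z - k%:Z)%Z.
    have h1 := py_mod_index b j; have h2 := dvdz_trans d2 h1.
    have -> : j%:Z - k%:Z = (t - k%:Z) - (py b j - j%:Z) by rewrite -Et; ring.
    exact: rpredB.
  have ik : i = k.
    have ley' : i%:Z <= y by rewrite Ey py_ge.
    have [/(dvdz_trans d6) h|/(dvdz_trans d6) h] := px_mod_inj a1 (introT andP (conj i0 lein)) dx.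
      have := dvdz_small (rpredB h d7).
      by clear -ley ley' k0 i0; lia.
    have := dvdz_small (rpredB h d7).
    by clear -ley ley' k0 i0; lia.
  by rewrite -ik.
(* A multiple of [k Y_k], so that [Y_k^2] divides [Y_n], and even, so that [Y_n] is even. Then [X_n]
   is coprime to [4 Y_k], and [b] exists by Chinese remainders. *)
set n := (k * `|py a k|).*2.
have pk := py_gt0 a1 k0.
have n0 : (0 < n)%N by rewrite /n; lia.
have Ey : `|py a k|%N%:Z = py a k by lia.
have dv : (py a k ^+ 2 %| py a n)%Z.
  by rewrite /n -muln2 -mulnA py_sq_dvd // PoszM Ey; apply: dvdz_mulr.
have ev : exists w, py a n = 2 * w.
  by exists (px a (k * `|py a k|) * py a (k * `|py a k|)); rewrite py_double mulrA.
have [w Ew] := ev.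
have cop : coprimez (4 * py a k) (px a n).
  have c1 := pell_coprime a n.
  have c2 : coprimez (py a k) (px a n).
    rewrite coprimez_sym in c1; apply: coprimez_dvdl c1.
    by apply: dvdz_trans dv; rewrite expr2; apply: dvdz_mulr.
  have c3 : coprimez 2 (px a n).
    rewrite coprimez_sym in c1; have d2 : (2 %| py a n)%Z by rewrite Ew; apply: dvdz_mulr.
    exact: coprimez_dvdl d2 c1.
  have -> : 4 * py a k = 2 * (2 * py a k) by ring.
  by rewrite !coprimezMl c2 c3.
have [b [b1 hb1 hb2]] : exists b, [/\ 1 < b, (4 * py a k %| b - 1)%Z & (px a n %| b - a)%Z].
  have [[p q] /= E] := coprimezP _ _ cop.
  set P := 4 * py a k in cop E *; set Q := px a n in cop E *.
  have Q0 : 0 < Q by apply: px_gt0.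
  have P0 : 0 < P by rewrite /P; lia.
  pose b0 := a * (p * P) + q * Q.
  pose N := `|b0| + 2.
  exists (b0 + N * (P * Q)); split.
  - have : 1 <= P * Q by nia.
    by rewrite /N; nia.
  - apply/dvdzP; exists ((a - 1) * p + N * Q).
    transitivity (b0 + N * (P * Q) - (p * P + q * Q)); first by rewrite E.
    by rewrite /b0; ring.
  - apply/dvdzP; exists ((1 - a) * q + N * P).
    transitivity (b0 + N * (P * Q) - a * (p * P + q * Q)); first by rewrite E mulr1.
    by rewrite /b0; ring.
exists (px a n), (py a n), (px b k), (py b k), b; split; split=> //.
- by apply/ltW/px_gt0.
- exact: py_gt0.
- by apply/ltW/px_gt0.
- exact: py_ge0.
- exact: pell_eq.
- exact: pell_eq.
- exact: pell_eq.
- exact: py_ge.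
- by case: (pell_congr k hb2).
- exact: dvdz_trans hb1 (py_mod_index b k).
Qed.

End PellCongruences.

(** * Diophantine sets of natural number environments *)

Inductive nterm : Type :=
  | NVar (i : nat) | NCst (c : nat) | NAdd (s t : nterm) | NMul (s t : nterm).

Fixpoint neval (e : nat -> nat) (t : nterm) : nat :=
  match t with
  | NVar i => e i | NCst c => c
  | NAdd s t => neval e s + neval e t | NMul s t => neval e s * neval e t
  end.

Inductive dform : Type :=
  | DEq (s t : nterm) | DAnd (F G : dform) | DOr (F G : dform) | DEx (F : dform).

Definition scons (x : nat) (e : nat -> nat) (i : nat) : nat :=
  if i is j.+1 then e j else x.

Fixpoint dsat (e : nat -> nat) (F : dform) : Prop :=
  match F with
  | DEq s t => neval e s = neval e t
  | DAnd F G => dsat e F /\ dsat e G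
  | DOr F G => dsat e F \/ dsat e G
  | DEx F => exists x, dsat (scons x e) F
  end.

Lemma neval_ext e e' t : e =1 e' -> neval e t = neval e' t.
Proof. by move=> E; elim: t => [i|c|s IHs t IHt|s IHs t IHt] //=; rewrite IHs IHt. Qed.

Lemma dsat_ext e e' F : e =1 e' -> dsat e F <-> dsat e' F.
Proof.
elim: F e e' => [s t|F IHF G IHG|F IHF G IHG|F IH] e e' E /=.
- by rewrite !(neval_ext _ E).
- by rewrite (IHF _ _ E) (IHG _ _ E).
- by rewrite (IHF _ _ E) (IHG _ _ E).
have E' x : scons x e =1 scons x e' by case.
by split=> -[x]; exists x; apply/(IH _ _ (E' x)).
Qed.

Definition dio (X : (nat -> nat) -> Prop) : Prop :=
  exists F, forall e, X e <-> dsat e F.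

(* [f] is a Diophantine function when its graph, with the value of [f] placed
   in front of the argument environment, is a Diophantine set. *)
Definition dfun (f : (nat -> nat) -> nat) : Prop :=
  dio (fun e => e 0 = f (fun i => e i.+1)).

Lemma dio_iff (X Y : (nat -> nat) -> Prop) :
  (forall e, X e <-> Y e) -> dio Y -> dio X.
Proof. by move=> XY [F FP]; exists F => e; rewrite XY. Qed.

Lemma dio_ext (X : (nat -> nat) -> Prop) e e' : dio X -> e =1 e' -> X e <-> X e'.
Proof. by move=> [F FP] E; rewrite !FP; apply: dsat_ext. Qed.

Lemma dio_and X Y : dio X -> dio Y -> dio (fun e => X e /\ Y e).
Proof. by move=> [F FP] [G GP]; exists (DAnd F G) => e /=; rewrite FP GP. Qed.

Lemma dio_or X Y : dio X -> dio Y -> dio (fun e => X e \/ Y e).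
Proof. by move=> [F FP] [G GP]; exists (DOr F G) => e /=; rewrite FP GP. Qed.

Lemma dio_ex (P : nat -> (nat -> nat) -> Prop) :
  dio (fun e => P (e 0) (fun i => e i.+1)) -> dio (fun e => exists x, P x e).
Proof.
move=> [F FP]; exists (DEx F) => e /=.
by split=> -[x Px]; exists x; [apply/(FP (scons x e)) | move: Px => /(FP (scons x e))].
Qed.

Fixpoint nren (r : nat -> nat) (t : nterm) : nterm :=
  match t with
  | NVar i => NVar (r i) | NCst c => NCst c
  | NAdd s t => NAdd (nren r s) (nren r t) | NMul s t => NMul (nren r s) (nren r t)
  end.

Lemma neval_ren e r t : neval e (nren r t) = neval (fun i => e (r i)) t.
Proof. by elim: t => [i|c|s IHs t IHt|s IHs t IHt] //=; rewrite IHs IHt. Qed.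

Lemma dio_ren (r : nat -> nat) X : dio X -> dio (fun e => X (fun i => e (r i))).
Proof.
move=> [F FP]; apply: (dio_iff (Y := fun e => dsat (fun i => e (r i)) F)).
  by move=> e; apply: FP.
elim: F r {X FP} => [s t|F IHF G IHG|F IHF G IHG|F IH] r /=.
- by exists (DEq (nren r s) (nren r t)) => e /=; rewrite !neval_ren.
- exact: dio_and (IHF r) (IHG r).
- exact: dio_or (IHF r) (IHG r).
apply: dio_ex; have := IH (fun i => if i is j.+1 then (r j).+1 else 0).
by apply: dio_iff => e; apply: dsat_ext => -[|i].
Qed.

Lemma dfun_shift f : dfun f -> dfun (fun e => f (fun i => e i.+1)).
Proof. exact: (@dio_ren (fun i => if i is j.+1 then j.+2 else 0)). Qed.

Lemma dfun_var i : dfun (fun e => e i).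
Proof. by exists (DEq (NVar 0) (NVar i.+1)). Qed.

Lemma dfun_cst c : dfun (fun _ => c).
Proof. by exists (DEq (NVar 0) (NCst c)). Qed.

Lemma dio_fun_eq f g : dfun f -> dfun g -> dio (fun e => f e = g e).
Proof.
move=> df dg; apply: (dio_iff (Y := fun e => exists x, x = f e /\ x = g e)).
  by move=> e; split=> [E|[x [<- <-]]] //; exists (f e).
by apply: dio_ex; apply: dio_and.
Qed.

Lemma dfun_op (op : nat -> nat -> nat) f g :
  dio (fun e => e 0 = op (e 1) (e 2)) -> dfun f -> dfun g ->
  dfun (fun e => op (f e) (g e)).
Proof.
move=> dop df dg.
apply: (dio_iff (Y := fun e => exists x y, (x = f (fun i => e i.+1) /\
  y = g (fun i => e i.+1)) /\ e 0 = op x y)) => [e|].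
  by split=> [->|[x [y [[-> ->] ->]]]] //; exists (f (fun i => e i.+1)), (g (fun i => e i.+1)).
apply: dio_ex; apply: dio_ex; apply: dio_and; first apply: dio_and.
- by have := @dio_ren (fun i => if i is j.+1 then j.+3 else 1) _ df; apply: dio_iff.
- by have := @dio_ren (fun i => if i is j.+1 then j.+3 else 0) _ dg; apply: dio_iff.
by have := @dio_ren (fun i => nth 0 [:: 2; 1; 0] i) _ dop; apply: dio_iff.
Qed.

Lemma dfun_add f g : dfun f -> dfun g -> dfun (fun e => f e + g e).
Proof. by apply: dfun_op; exists (DEq (NVar 0) (NAdd (NVar 1) (NVar 2))). Qed.

Lemma dfun_mul f g : dfun f -> dfun g -> dfun (fun e => f e * g e).
Proof. by apply: dfun_op; exists (DEq (NVar 0) (NMul (NVar 1) (NVar 2))). Qed.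

Lemma dfun_neval fs t : (forall i, dfun (fs i)) -> dfun (fun e => neval (fun i => fs i e) t).
Proof.
move=> dfs; elim: t => [i|c|s IHs t IHt|s IHs t IHt] /=.
- exact: dfs.
- exact: dfun_cst.
- exact: dfun_add.
exact: dfun_mul.
Qed.

(** Terms of the formula language contain only sums and products; this closure property is what
    allows Diophantine functions to be nested. *)
Lemma dio_subst fs X : dio X -> (forall i, dfun (fs i)) ->
  dio (fun e => X (fun i => fs i e)).
Proof.
move=> [F FP] dfs; apply: (dio_iff (Y := fun e => dsat (fun i => fs i e) F)).
  by move=> e; apply: FP.
elim: F fs dfs {X FP} => [s t|F IHF G IHG|F IHF G IHG|F IH] fs dfs /=.
- by apply: dio_fun_eq; apply: dfun_neval.
- by apply: dio_and; [apply: IHF | apply: IHG].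
- by apply: dio_or; [apply: IHF | apply: IHG].
apply: dio_ex.
have /IH : forall i, dfun (if i is j.+1 then fun e => fs j (fun k => e k.+1) else fun e => e 0).
  by case=> [|i]; [apply: dfun_var | apply: dfun_shift].
by apply: dio_iff => e; apply: dsat_ext => -[|i].
Qed.

Lemma dfun_subst fs f : dfun f -> (forall i, dfun (fs i)) -> dfun (fun e => f (fun i => fs i e)).
Proof.
move=> df dfs.
have := @dio_subst (fun i => if i is j.+1 then fun e => fs j (fun k => e k.+1) else fun e => e 0) _ df.
by apply; case=> [|i]; [apply: dfun_var | apply: dfun_shift].
Qed.

Definition dargs (fs : seq ((nat -> nat) -> nat)) (i : nat) := nth (fun _ => 0) fs i.

Lemma dfun_args fs : (forall i, i < size fs -> dfun (dargs fs i)) -> forall i, dfun (dargs fs i).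
Proof.
move=> dfs i; have [/dfs//|le] := ltnP i (size fs).
by rewrite /dargs nth_default //; apply: dfun_cst.
Qed.

Lemma dio2 (R : nat -> nat -> Prop) f g :
  dio (fun e => R (e 0) (e 1)) -> dfun f -> dfun g -> dio (fun e => R (f e) (g e)).
Proof.
by move=> dR df dg; apply: (@dio_subst (dargs [:: f; g]) _ dR); apply: dfun_args => -[|[|[]]].
Qed.

Lemma dio4 (R : nat -> nat -> nat -> nat -> Prop) f g h k :
  dio (fun e => R (e 0) (e 1) (e 2) (e 3)) -> dfun f -> dfun g -> dfun h -> dfun k ->
  dio (fun e => R (f e) (g e) (h e) (k e)).
Proof.
move=> dR df dg dh dk; apply: (@dio_subst (dargs [:: f; g; h; k]) _ dR).
by apply: dfun_args => -[|[|[|[|[]]]]].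
Qed.

Lemma dfun1 (F : nat -> nat) f : dfun (fun e => F (e 0)) -> dfun f -> dfun (fun e => F (f e)).
Proof.
by move=> dF df; apply: (@dfun_subst (dargs [:: f]) _ dF); apply: dfun_args => -[|[]].
Qed.

Lemma dfun2 (F : nat -> nat -> nat) f g :
  dfun (fun e => F (e 0) (e 1)) -> dfun f -> dfun g -> dfun (fun e => F (f e) (g e)).
Proof.
by move=> dF df dg; apply: (@dfun_subst (dargs [:: f; g]) _ dF); apply: dfun_args => -[|[|[]]].
Qed.

Lemma dfun_S f : dfun f -> dfun (fun e => (f e).+1).
Proof.
move=> df; have := dfun_add df (dfun_cst 1); apply: dio_iff => e.
by rewrite addn1.
Qed.

Lemma dio_le f g : dfun f -> dfun g -> dio (fun e => f e <= g e).
Proof.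
move=> df dg; apply: (@dio2 (fun x y => x <= y)) => //.
apply: (dio_iff (Y := fun e => exists z, e 0 + z = e 1)).
  by move=> e; split=> [le|[z <-]]; [exists (e 1 - e 0); rewrite subnKC | rewrite leq_addr].
by apply: dio_ex; apply: dio_fun_eq; [apply: dfun_add |]; apply: dfun_var.
Qed.

Lemma dio_lt f g : dfun f -> dfun g -> dio (fun e => f e < g e).
Proof. by move=> df dg; apply: dio_le => //; apply: dfun_S. Qed.

Lemma dio_true : dio (fun _ => True).
Proof. by exists (DEq (NCst 0) (NCst 0)). Qed.

Lemma dio_false : dio (fun _ => False).
Proof. by exists (DEq (NCst 0) (NCst 1)). Qed.

Create HintDb dio.
#[global] Hint Resolve dfun_var dfun_cst dfun_add dfun_mul dfun_S : dio.
#[global] Hint Resolve dio_and dio_or dio_fun_eq dio_le dio_lt dio_true dio_false : dio.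
#[global] Hint Extern 3 (dio (fun e => exists x, @?P e x)) => apply dio_ex; cbv beta : dio.
Ltac diot := auto 30 with dio nocore.

(** The first disjunct accounts for the convention [x %% 0 = x]; in [dfun_div] it accounts for
    [x %/ 0 = 0]. *)
Lemma dfun_mod f g : dfun f -> dfun g -> dfun (fun e => f e %% g e).
Proof.
apply: dfun2; apply: (dio_iff (Y := fun e =>
  (e 2 = 0 /\ e 0 = e 1) \/ (e 0 < e 2 /\ exists q, e 1 = q * e 2 + e 0))) => [e|]; last diot.
have [->|gt0] := posnP (e 2); first by rewrite modn0; split=> [|[[]|[]]]; auto.
split=> [->|[[E]|[lt [q ->]]]].
- right; split; first by rewrite ltn_pmod.
  by exists (e 1 %/ e 2); rewrite -divn_eq.
- by rewrite E in gt0.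
- by rewrite modnMDl modn_small.
Qed.

Lemma dfun_div f g : dfun f -> dfun g -> dfun (fun e => f e %/ g e).
Proof.
apply: dfun2; apply: (dio_iff (Y := fun e =>
  (e 2 = 0 /\ e 0 = 0) \/ (exists r, r < e 2 /\ e 1 = e 0 * e 2 + r))) => [e|]; last diot.
have [->|gt0] := posnP (e 2); first by rewrite divn0; split=> [|[[]|[r []]]]; auto.
split=> [->|[[E]|[r [lt ->]]]].
- right; exists (e 1 %% e 2); split; first by rewrite ltn_pmod.
  by rewrite -divn_eq.
- by rewrite E in gt0.
- by rewrite divnMDl // divn_small // addn0.
Qed.

Lemma dfun_sub f g : dfun f -> dfun g -> dfun (fun e => f e - g e).
Proof.
apply: dfun2; apply: (dio_iff (Y := fun e =>
  (e 1 < e 2 /\ e 0 = 0) \/ e 0 + e 2 = e 1)) => [e|]; last diot.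
by split; lia.
Qed.

Lemma dio_dvd f g : dfun f -> dfun g -> dio (fun e => f e %| g e).
Proof.
move=> df dg; apply: (@dio2 (fun x y => x %| y)) => //.
apply: (dio_iff (Y := fun e => exists k, e 1 = k * e 0)); last diot.
by move=> e; split=> /dvdnP.
Qed.

#[global] Hint Resolve dfun_mod dfun_div dfun_sub dio_dvd : dio.

(** * The Pell relation over the natural numbers, and exponentiation *)

Definition pellR (a k x y : nat) : Prop :=
  [/\ 1 < a, Posz x = px a k & Posz y = py a k].

Lemma dvdz_nat_sub (m x y : nat) : (m %| (Posz x - Posz y)%R)%Z = (x == y %[mod m]).
Proof. by rewrite -eqz_mod_dvd !modz_nat. Qed.

Lemma pell_eq_nat (a x y : nat) :
  ((Posz x ^+ 2 - (Posz a ^+ 2 - 1) * Posz y ^+ 2)%R = 1%R) <-> x * x + y * y = a * a * (y * y) + 1.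
Proof. by split; lia. Qed.

(** This is [pell_char] rewritten without subtraction; the index [0], excluded there, is treated
    apart. *)
Lemma pellR_char a k x y : pellR a k x y <->
  1 < a /\ ((k = 0 /\ (x = 1 /\ y = 0)) \/ (0 < k /\
  exists u v s t b, (0 < v /\ 1 < b) /\
   ((x * x + y * y = a * a * (y * y) + 1 /\
     u * u + v * v = a * a * (v * v) + 1) /\
    (s * s + t * t = b * b * (t * t) + 1 /\ k <= y)) /\
   ((y * y %| v /\ b = 1 %[mod 4 * y]) /\
    (b = a %[mod u] /\ (s = x %[mod u] /\ t = k %[mod 4 * y]))))).
Proof.
have [->|k0] := posnP k.
  split=> [[a1]|[a1 [[_ [-> ->]]|[]]]] //.
  by rewrite /px /py /= => -[->] [->]; split=> //; left.
have a1Z : 1 < a -> (1 < Posz a)%R by rewrite ltz_nat.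
split=> [[a1 Ex Ey]|[a1 [[E]|[_]]]].
- split=> //; right; split=> //.
  have [] := (pell_char (x := x) (y := y) (a1Z a1) isT isT k0).1 (conj Ex Ey).
  move=> u [v [s [t [b []]]]].
  case: u => // u; case: v => // v; case: s => // s; case: t => // t; case: b => // b; try by case.
  case=> _ v0 _ _ b1 [/pell_eq_nat E1 /pell_eq_nat E2 /pell_eq_nat E3 ley] [d1 d2 d3] [d4 d5].
  exists u, v, s, t, b.
  rewrite -PoszM /= -[1%R]/(Posz 1)%R !dvdz_nat_sub in d2 d3 d4 d5.
  by split=> //; split=> //; split; [split=> //; exact/eqP | split; [exact/eqP | split; exact/eqP]].
- by rewrite E in k0.
move=> [u [v [s [t [b [[v0 b1] [[[E1 E2] [E3 ley]] [[d1 d2] [d3 [d4 d5]]]]]]]]]].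
have [] := (pell_char (x := x) (y := y) (a1Z a1) isT isT k0).2; last by [].
exists u, v, s, t, b; split=> //; split=> //; try exact/pell_eq_nat.
- by rewrite -[1%R]/(Posz 1)%R -PoszM dvdz_nat_sub; apply/eqP.
- by rewrite dvdz_nat_sub; apply/eqP.
- by rewrite dvdz_nat_sub; apply/eqP.
by rewrite -PoszM dvdz_nat_sub; apply/eqP.
Qed.

Lemma dio_pellR f g h k : dfun f -> dfun g -> dfun h -> dfun k ->
  dio (fun e => pellR (f e) (g e) (h e) (k e)).
Proof.
apply: dio4; apply: (dio_iff (fun e => pellR_char (e 0) (e 1) (e 2) (e 3))).
by diot.
Qed.
#[global] Hint Resolve dio_pellR : dio.

Lemma pellR_ex a k : 1 < a -> exists x y, pellR a k x y.
Proof.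
move=> a1; have a1Z : (1 < Posz a)%R by rewrite ltz_nat.
by exists `|px a k|, `|py a k|; split=> //; have := px_gt0 a1Z k; have := py_ge0 a1Z k; lia.
Qed.

Lemma eq_small_mod u v d : u = v %[mod d] -> u < d -> v < d -> u = v.
Proof. by move=> E ud vd; rewrite -(modn_small ud) -(modn_small vd). Qed.

Lemma pellR_pow_mod a k n x y : pellR a k x y -> 0 < n -> n < a ->
  x = y * (a - n) + n ^ k %[mod 2 * a * n - n * n - 1].
Proof.
move=> [a1 Ex Ey] n0 lna; apply/eqP; rewrite -dvdz_nat_sub.
have := pell_pow a n k; rewrite -Ex -Ey.
have -> : (2 * Posz a * Posz n - Posz n ^+ 2 - 1)%R = Posz (2 * a * n - n * n - 1) by nia.
have -> : (Posz x - Posz (y * (a - n) + n ^ k) =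
  Posz x - Posz y * (Posz a - Posz n) - Posz n ^+ k)%R; last by [].
rewrite PoszD PoszM -(subzn (ltnW lna)) opprD addrA; congr (_ - _)%R.
by rewrite -!natz natrX.
Qed.

(* [n ^ k] is the residue of [X_k(a) - (a - n) Y_k(a)] modulo [2 a n - n ^ 2 - 1]; the
   choice [a = X_(k+1)(n+2)] makes the modulus larger than [n ^ k]. *)
Lemma exp_pellR n k m : n ^ k = m <->
  (k = 0 /\ m = 1) \/ ((0 < k /\ (n = 0 /\ m = 0)) \/
  (0 < n /\ exists a z x y, (pellR n.+2 k.+1 a z /\ pellR a k x y) /\
     (x = y * (a - n) + m %[mod 2 * a * n - n * n - 1] /\ m < 2 * a * n - n * n - 1))).
Proof.
(* Exponentiation is what is being defined, so a bound above [n^k] has to come from the Pell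
   sequence itself: [X_(k+1)(n+2) >= (n+2)^(k+1)]. *)
have bound a z : 0 < n -> pellR n.+2 k.+1 a z -> n.+1 < a /\ n ^ k < 2 * a * n - n * n - 1.
  move=> n0 [n1 Ea _]; have := @px_ge_exp n.+2 n1 k.+1.
  rewrite -Ea -!natz -natrX ler_nat expnS => le.
  have le2 : n ^ k <= n.+2 ^ k by case: (k) => // j; rewrite leq_exp2r //; lia.
  have p0 : 0 < n.+2 ^ k by rewrite expn_gt0.
  move: le le2 p0; move: (n.+2 ^ k) (n ^ k) => P Q le le2 p0; split; first nia.
  have : n.+2 <= a by nia.
  have : Q * n.+2 <= a by nia.
  by nia.
split=> [<-|].
  have [->|k0] := posnP k; first by left.
  have [->|n0] := posnP n; first by right; left; rewrite exp0n.
  right; right; split=> //; have [a [z az]] := @pellR_ex n.+2 k.+1 isT.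
  have [lna ltm] := bound _ _ n0 az.
  have [x [y xy]] := @pellR_ex a k (leq_trans (isT : 1 < n.+2) lna).
  exists a, z, x, y; split=> //; split=> //.
  exact: (pellR_pow_mod xy n0 (ltnW lna)).
case=> [[-> ->]|[[k0 [-> ->]]|[n0 [a [z [x [y [[az xy] [E ltm]]]]]]]]] //.
  by rewrite exp0n.
have [lna lt2] := bound _ _ n0 az.
have := pellR_pow_mod xy n0 (ltnW lna); rewrite {}E => /eqP.
by rewrite eqn_modDl => /eqP E; apply/esym/(eq_small_mod E).
Qed.

Lemma dfun_exp f g : dfun f -> dfun g -> dfun (fun e => f e ^ g e).
Proof.
apply: dfun2; apply: (dio_iff (Y := fun e => e 1 ^ e 2 = e 0)); first by move=> e; split.
apply: (dio_iff (fun e => exp_pellR (e 1) (e 2) (e 0))); diot.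
Qed.
#[global] Hint Resolve dfun_exp : dio.

(** * Binomial coefficients and factorials *)

Lemma digit_sum (u m k : nat) (f : nat -> nat) : (forall i, f i < u) -> k < m ->
  (\sum_(i < m) f i * u ^ i) %/ u ^ k %% u = f k.
Proof.
move=> lt; have u0 : 0 < u by apply: leq_ltn_trans (lt 0).
elim: m k f lt => // m IH k f lt ltkm.
have -> : \sum_(i < m.+1) f i * u ^ i = (\sum_(i < m) f i.+1 * u ^ i) * u + f 0.
  rewrite big_ord_recl muln1 addnC big_distrl; congr (_ + _); apply: eq_bigr => i _.
  by rewrite /= /bump /= add1n expnSr mulnA.
case: k ltkm => [|k] ltkm; first by rewrite divn1 modnMDl modn_small.
by rewrite expnS divnMA divnMDl // (divn_small (lt 0)) addn0 (IH k (fun i => f i.+1)).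
Qed.

Lemma bin_lt_exp n k : 'C(n, k) < (2 ^ n).+1.
Proof.
rewrite ltnS -[2]/(1 + 1) expnDn; have [le|lt] := leqP k n; last by rewrite bin_small.
rewrite (bigD1 (Ordinal (n := n.+1) (m := k) le)) //= !exp1n !muln1.
exact: leq_addr.
Qed.

(** The coefficients [C(n, i)] are the digits of [(u + 1)^n] in base [u = 2^n + 1], as they do not
    exceed [2^n]. *)
Lemma bin_exp n k : 'C(n, k) = ((2 ^ n).+2 ^ n %/ (2 ^ n).+1 ^ k) %% (2 ^ n).+1.
Proof.
set u := (2 ^ n).+1.
rewrite -[RHS]/((u.+1 ^ n %/ u ^ k) %% u).
(* The sum is extended by zero terms up to [n + k], so that it has a digit of rank [k] even when
   [k > n]. *)
have -> : u.+1 ^ n = \sum_(i < (n + k).+1) 'C(n, i) * u ^ i.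
  rewrite -add1n expnDn (big_ord_widen (n + k).+1 (fun i => 'C(n, i) * (1 ^ (n - i) * u ^ i))).
    rewrite big_mkcond; apply: eq_bigr => i _; rewrite exp1n mul1n.
    by case: ltnP => // lt; rewrite bin_small.
  by rewrite ltnS leq_addr.
rewrite digit_sum //; first by move=> i; apply: bin_lt_exp.
by rewrite ltnS leq_addl.
Qed.

Lemma dfun_bin f g : dfun f -> dfun g -> dfun (fun e => 'C(f e, g e)).
Proof.
move=> df dg; apply: (dfun2 (F := binomial)) => //.
by apply: (dio_iff (Y := fun e => e 0 = ((2 ^ e 1).+2 ^ e 1 %/ (2 ^ e 1).+1 ^ e 2) %%
  (2 ^ e 1).+1)) => [e|]; [rewrite -bin_exp | diot].
Qed.
#[global] Hint Resolve dfun_bin : dio.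

Lemma ffact_le_exp r j : r ^_ j <= r ^ j.
Proof.
elim: j => // j IH; rewrite ffactnSr expnSr leq_mul //; exact: leq_subr.
Qed.

Lemma exp_le_ffact r j : r ^ j * r <= r ^_ j * r + j * j * r ^ j.
Proof.
elim: j => [|j IH]; first by rewrite ffactn0; lia.
have [ltrj|lejr] := ltnP r j.+1.
  apply: leq_trans (leq_addl _ _); rewrite mulnC leq_mul2r; apply/orP; right.
  by nia.
rewrite ffactnSr expnSr; have := ffact_le_exp r j.
move: IH; move: (r ^_ j) (r ^ j) => F P IH le.
have -> : F * (r - j) * r = F * r * r - F * j * r by rewrite mulnBr mulnBl.
have : P * r * r <= F * r * r + j * j * P * r by rewrite -mulnDl leq_mul2r IH orbT.
have : F * j * r <= P * j * r by rewrite !leq_mul2r le !orbT.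
by nia.
Qed.

(** The quotient [r^n / C(r, n)] tends to [n!] from above as [r] grows. By [exp_le_ffact] the error
    is below [1] once [r > (n! + 1) n^2]; replacing [n!] by its bound [n^n] keeps the choice of [r]
    free of factorials. *)
Lemma fact_exp n : n`! = ((n ^ n).+1 * (n * n)).+1 ^ n %/ 'C(((n ^ n).+1 * (n * n)).+1, n).
Proof.
set r := _.+1.
have le_nr : n <= r by rewrite /r; nia.
have C0 : 0 < 'C(r, n) by rewrite bin_gt0.
have f0 := fact_gt0 n; have EC := bin_ffact r n.
have lef : n`! <= n ^ n by rewrite -ffactnn ffact_le_exp.
have h1 := ffact_le_exp r n; have h2 := exp_le_ffact r n.
have P0 : 0 < r ^ n by rewrite expn_gt0.
have rbig : n`!.+1 * (n * n) < r by rewrite /r ltnS leq_mul2r ltnS lef orbT.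
apply/eqP; rewrite eqn_leq leq_divRL // mulnC EC h1 /= -ltnS ltn_divLR //.
rewrite -(ltn_pmul2r f0) -mulnA EC -(ltn_pmul2r (isT : 0 < r)).
move: h2 rbig P0; move: (r ^ n) (r ^_ n) (n`!) => P F N h2 rbig P0.
rewrite -mulnA; have : N.+1 * (P * r) <= N.+1 * (F * r + n * n * P) by rewrite leq_mul2l h2 orbT.
have : P * (N.+1 * (n * n)) < P * r by rewrite ltn_pmul2l.
rewrite mulnDr !mulSn; nia.
Qed.

Lemma dfun_fact f : dfun f -> dfun (fun e => (f e)`!).
Proof.
move=> df; apply: (dfun1 (F := factorial)) => //.
by apply: (dio_iff (Y := fun e => e 0 = ((e 1 ^ e 1).+1 * (e 1 * e 1)).+1 ^ e 1 %/
  'C(((e 1 ^ e 1).+1 * (e 1 * e 1)).+1, e 1))) => [e|]; [rewrite -fact_exp | diot].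
Qed.
#[global] Hint Resolve dfun_fact : dio.

(** * Bounded universal quantification *)

Definition ecat (r : nat) (w e : nat -> nat) (i : nat) : nat :=
  if i < r then w i else e (i - r).

Lemma sum_sqr_diff_eq0 (a b c d : nat) :
  a * a + b * b + (c * c + d * d) = 2 * (a * b + c * d) -> a = b /\ c = d.
Proof.
move=> E; have : ((Posz a - Posz b) ^+ 2 + (Posz c - Posz d) ^+ 2 == 0)%R by lia.
by rewrite paddr_eq0 ?sqr_ge0 // !sqrf_eq0 !subr_eq0 => /andP[/eqP[->] /eqP[->]].
Qed.

(** Witnesses are gathered in front of the environment. A conjunction becomes a vanishing sum of two
    squares and a disjunction a vanishing product, both expanded so that no subtraction occurs. *)
Lemma dsat_normal_form F : exists r p q, forall e,
  dsat e F <-> exists w, neval (ecat r w e) p = neval (ecat r w e) q.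
Proof.
pose ren1 (r1 r2 i : nat) := if i < r1 then i else i + r2.
pose ren2 (r1 r2 i : nat) := i + r1.
have ren1P r1 r2 w e t : neval (ecat (r1 + r2) w e) (nren (ren1 r1 r2) t) = neval (ecat r1 w e) t.
  rewrite neval_ren; apply: neval_ext => i; rewrite /ecat /ren1.
  case: (ltnP i r1) => h; first by rewrite ltn_addr.
  by rewrite ltn_add2r ltnNge h /= subnDr.
have ren2P r1 r2 w e t : neval (ecat (r1 + r2) w e) (nren (ren2 r1 r2) t) =
    neval (ecat r2 (fun i => w (i + r1)) e) t.
  rewrite neval_ren; apply: neval_ext => i; rewrite /ecat /ren2 addnC ltn_add2l.
  by case: ifP => // _; rewrite subnDl.
have join r1 r2 (w1 w2 : nat -> nat) : exists w : nat -> nat,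
    (forall e t, neval (ecat (r1 + r2) w e) (nren (ren1 r1 r2) t) = neval (ecat r1 w1 e) t) /\
    (forall e t, neval (ecat (r1 + r2) w e) (nren (ren2 r1 r2) t) = neval (ecat r2 w2 e) t).
  exists (fun i => if i < r1 then w1 i else w2 (i - r1)).
  split=> e t; first by rewrite ren1P; apply: neval_ext => i; rewrite /ecat; case: (i < r1).
  rewrite ren2P; apply: neval_ext => i; rewrite /ecat.
  by have -> : (i + r1 < r1) = false by [lia]; rewrite addnK.
elim: F => [s t|F [r1 [p1 [q1 H1]]] G [r2 [p2 [q2 H2]]]|
  F [r1 [p1 [q1 H1]]] G [r2 [p2 [q2 H2]]]|F [r [p [q H]]]].
- exists 0, s, t => e /=; have E w : ecat 0 w e =1 e by move=> i; rewrite /ecat subn0.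
  split=> [Est|[w]]; last by rewrite !(neval_ext _ (E w)).
  by exists e; rewrite !(neval_ext _ (E e)).
- pose P1 := nren (ren1 r1 r2) p1; pose Q1 := nren (ren1 r1 r2) q1.
  pose P2 := nren (ren2 r1 r2) p2; pose Q2 := nren (ren2 r1 r2) q2.
  exists (r1 + r2), (NAdd (NAdd (NMul P1 P1) (NMul Q1 Q1)) (NAdd (NMul P2 P2) (NMul Q2 Q2))).
  exists (NMul (NCst 2) (NAdd (NMul P1 Q1) (NMul P2 Q2))) => e /=; rewrite H1 H2.
  split=> [[[w1 E1] [w2 E2]]|[w]].
    have [w [W1 W2]] := join r1 r2 w1 w2; exists w.
    by rewrite !W1 !W2 E1 E2; lia.
  rewrite !ren1P !ren2P => /sum_sqr_diff_eq0[E1 E2].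
  by split; [exists w | exists (fun i => w (i + r1))].
- pose P1 := nren (ren1 r1 r2) p1; pose Q1 := nren (ren1 r1 r2) q1.
  pose P2 := nren (ren2 r1 r2) p2; pose Q2 := nren (ren2 r1 r2) q2.
  exists (r1 + r2), (NAdd (NMul P1 P2) (NMul Q1 Q2)), (NAdd (NMul P1 Q2) (NMul Q1 P2)).
  move=> e /=; rewrite H1 H2.
  split=> [[[w1 E1]|[w2 E2]]|[w]].
  + have [w [W1 W2]] := join r1 r2 w1 w1; exists w.
    by rewrite !W1 !W2 E1; lia.
  + have [w [W1 W2]] := join r1 r2 w2 w2; exists w.
    by rewrite !W1 !W2 E2; lia.
  rewrite !ren1P !ren2P; set a := neval _ p1; set b := neval _ q1.
  set c := neval _ p2; set d := neval _ q2 => E.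
  have [ab|nab] := eqVneq a b; first by left; exists w.
  right; exists (fun i => w (i + r1)); rewrite -/c -/d.
  by clearbody a b c d; case: (ltngtP a b) nab => // lt _; nia.
exists r.+1, p, q => e /=; split=> [[x /H[w E]]|[w E]].
  exists (fun i => if i < r then w i else x).
  suff S : ecat r.+1 (fun i => if i < r then w i else x) e =1 ecat r w (scons x e).
    by rewrite !(neval_ext _ S).
  move=> i; rewrite /ecat; case: (ltngtP i r) => h.
  - by rewrite ltnS (ltnW h).
  - by rewrite ltnNge h /=; have -> : i - r = (i - r.+1).+1 by lia.
  by rewrite h ltnSn subnn.
exists (w r); apply/H; exists w.
suff S : ecat r w (scons (w r) e) =1 ecat r.+1 w e by rewrite !(neval_ext _ S).
move=> i; rewrite /ecat; case: (ltngtP i r) => h.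
- by rewrite ltnS (ltnW h).
- by rewrite ltnNge h /=; have -> : i - r = (i - r.+1).+1 by lia.
by rewrite h ltnSn subnn.
Qed.

Lemma dio_exs r X : dio X -> dio (fun e => exists w, X (ecat r w e)).
Proof.
move=> dX; elim: r => [|r IH].
  apply: dio_iff (dX) => e; have E w : ecat 0 w e =1 e by move=> i; rewrite /ecat subn0.
  by split=> [[w]|]; [|exists e]; rewrite (dio_ext dX (E _)).
have E w e : ecat r.+1 w e =1 ecat r w (scons (w r) e).
  move=> i; rewrite /ecat; case: (ltngtP i r) => h.
  - by rewrite ltnS (ltnW h).
  - by rewrite ltnNge h /=; have -> : i - r = (i - r.+1).+1 by lia.
  by rewrite h ltnSn subnn.
apply: (dio_iff (Y := fun e => exists x w, X (ecat r w (scons x e)))).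
  move=> e; split=> [[w /(dio_ext dX (E w e)) Xw]|[x [w Xw]]].
    by exists (w r), w.
  exists (fun i => if i < r then w i else x); apply/(dio_ext dX (E _ e)).
  rewrite ltnn; apply/(dio_ext dX (e' := ecat r w (scons x e))) => // i.
  by rewrite /ecat; case: (i < r).
apply: (dio_ex (P := fun x e => exists w, X (ecat r w (scons x e)))).
apply: dio_iff IH => e.
have S w : ecat r w (scons (e 0) (fun i => e i.+1)) =1 ecat r w e.
  by move=> i; rewrite /ecat; case: ifP => // _; case: (i - r).
by split=> -[w Xw]; exists w; apply/(dio_ext dX (S w)).
Qed.

Lemma dio_all_fin r (X : nat -> (nat -> nat) -> Prop) :
  (forall i, i < r -> dio (X i)) -> dio (fun e => forall i, i < r -> X i e).
Proof.
elim: r => [|r IH] dX; first by apply: dio_iff dio_true => e; split.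
have := dio_and (IH (fun i lt => dX i (ltnW lt))) (dX r (ltnSn r)).
apply: dio_iff => e; split=> [H|[H1 H2] i].
  by split=> [i lt|]; apply: H => //; apply: ltnW.
by rewrite ltnS leq_eqVlt => /predU1P[->|/H1].
Qed.

Lemma neval_mod m e e' t : (forall i, e i = e' i %[mod m]) -> neval e t = neval e' t %[mod m].
Proof.
move=> E; elim: t => [i|c|s IHs t IHt|s IHs t IHt] //=.
  by rewrite -modnDm IHs IHt modnDm.
by rewrite -modnMm IHs IHt modnMm.
Qed.

Lemma neval_mono e e' t : (forall i, e i <= e' i) -> neval e t <= neval e' t.
Proof.
move=> le; elim: t => [i|c|s IHs t IHt|s IHs t IHt] //=.
  exact: leq_add.
exact: leq_mul.
Qed.

Section CoprimeFamilies.
Variables (m : nat -> nat) (y : nat).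
Hypothesis cop : forall i j, i < j < y -> coprime (m i) (m j).

Lemma coprime_prefix z : z < y -> coprime (\prod_(i < z) m i) (m z).
Proof.
move=> lt; have: forall k, k <= z -> coprime (\prod_(i < k) m i) (m z); last by apply.
elim=> [|k IH] lek; first by rewrite big_ord0 coprime1n.
by rewrite big_ord_recr /= coprimeMl IH ?cop ?lek // ltnW.
Qed.

Lemma prod_dvd_of_coprime x : (forall i, i < y -> m i %| x) -> \prod_(i < y) m i %| x.
Proof.
move=> dv; have: forall k, k <= y -> \prod_(i < k) m i %| x; last by apply.
elim=> [|k IH] lek; first by rewrite big_ord0 dvd1n.
by rewrite big_ord_recr /= Gauss_dvd ?coprime_prefix // IH ?dv // ltnW.
Qed.

Lemma chinese_family (r : nat -> nat) : exists a, forall i, i < y -> a = r i %[mod m i].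
Proof.
have: forall k, k <= y -> exists a, forall i, i < k -> a = r i %[mod m i]; last by apply.
elim=> [|k IH] lek; first by exists 0.
have [a Ha] := IH (ltnW lek); have cp := coprime_prefix lek.
exists (chinese (\prod_(i < k) m i) (m k) a (r k)) => i.
rewrite ltnS leq_eqVlt => /predU1P[->|lt]; first exact: chinese_modr.
rewrite -Ha //; have dv : m i %| \prod_(j < k) m j by rewrite (bigD1 (Ordinal lt)) // dvdn_mulr.
by rewrite -(modn_dvdm _ dv) chinese_modl // modn_dvdm.
Qed.

End CoprimeFamilies.

Lemma prime_dvd_coprime (a b : nat) : 0 < a ->
  (forall p, prime p -> p %| a -> p %| b -> False) -> coprime a b.
Proof.
move=> a0 H; rewrite /coprime; apply/eqP.
have [//|g1] := eqVneq (gcdn a b) 1.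
have g2 : 1 < gcdn a b by rewrite ltn_neqAle eq_sym g1 gcdn_gt0 a0.
have /pdiv_prime pr := g2; have dv := pdiv_dvd (gcdn a b).
by case: (H _ pr (dvdn_trans dv (dvdn_gcdl a b)) (dvdn_trans dv (dvdn_gcdr a b))).
Qed.

(* The moduli [1 + T / (k + 1)] with [T = Q! ^ 2] are pairwise coprime for
   [k < Q], have no prime factor up to [Q], divide [T + k + 1], and their product
   over [k < y] is the binomial coefficient [C(T + y, y)]. *)
Section Moduli.
Variable Q : nat.
Let T := Q`! * Q`!.
Definition bqmod (k : nat) := (T %/ k.+1).+1.

Lemma dvd_fact_sq k : k < Q -> k.+1 %| T.
Proof. by move=> lt; rewrite /T dvdn_mull // dvdn_fact. Qed.

Lemma bqmod_mul k : k < Q -> k.+1 * bqmod k = T + k.+1.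
Proof. by move=> lt; rewrite /bqmod mulnS mulnC divnK ?dvd_fact_sq // addnC. Qed.

Lemma bqmod_prime k p : k < Q -> prime p -> p %| bqmod k -> Q < p.
Proof.
move=> lt pr dv; rewrite ltnNge; apply/negP => le.
have pf : p %| Q`! by rewrite dvdn_fact // prime_gt0.
have : p %| T %/ k.+1.
  by rewrite /T -muln_divA ?dvdn_fact // dvdn_mulr.
move=> dv2; move: dv; rewrite /bqmod -addn1 dvdn_addr // dvdn1 => /eqP E.
by rewrite E in pr.
Qed.

Lemma bqmod_coprime i j y : y <= Q -> i < j < y -> coprime (bqmod i) (bqmod j).
Proof.
move=> leQ /andP[ij jy]; have ltj : j < Q by apply: leq_trans leQ.
have lti : i < Q by apply: ltn_trans ltj.
apply: prime_dvd_coprime => // p pr di dj.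
have := bqmod_prime lti pr di; rewrite ltnNge => /negP; apply.
have hi : p %| T + i.+1 by rewrite -bqmod_mul // dvdn_mull.
have hj : p %| T + j.+1 by rewrite -bqmod_mul // dvdn_mull.
have := dvdn_sub hj hi; rewrite subnDl subSS => /dvdn_leq; rewrite subn_gt0 => /(_ ij) le.
by apply: leq_trans le _; apply: leq_trans (leq_subr _ _) (ltnW ltj).
Qed.

Lemma bqmod_prod y : y <= Q -> \prod_(k < y) bqmod k = 'C(T + y, y).
Proof.
elim: y => [|y IH] leQ; first by rewrite big_ord0 bin0.
rewrite big_ord_recr /= IH 1?ltnW //; apply/eqP.
rewrite -(eqn_pmul2l (isT : 0 < y.+1)) addnS -mul_bin_diag /= mulnCA bqmod_mul // addnS.
by rewrite mulnC.
Qed.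

(** Prime factors of the modulus exceed [Q >= u + 1]. This is used to cancel [(u + 1)!] between a
    falling factorial and a binomial coefficient. *)
Lemma bqmod_coprime_fact k u : k < Q -> u < Q -> coprime (bqmod k) u.+1`!.
Proof.
move=> lt ltu; apply: prime_dvd_coprime => // p pr /(bqmod_prime lt pr) ltp.
have : u.+1 < p by apply: leq_ltn_trans ltp.
elim: u.+1 => [|v IH] ltv; first by rewrite dvdn1 => /eqP E; rewrite E in pr.
rewrite factS Euclid_dvdM // => /orP[/dvdn_leq|]; last by apply: IH; apply: ltnW.
by move=> /(_ isT); rewrite leqNgt ltv.
Qed.

End Moduli.

(** If [a > u], the prime [p] divides one of the factors [a, a - 1, ..., a - u], so [a] is congruent
    to a number at most [u]. *)
Lemma prime_dvd_ffact p a u : prime p -> p %| a ^_ u.+1 -> u < p -> a %% p <= u.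
Proof.
move=> pr; have [leau _ _|ltua] := leqP a u; first exact: leq_trans (leq_mod _ _) leau.
have: forall j, j <= u.+1 -> p %| a ^_ j -> u < p -> a %% p <= u; last by apply.
elim=> [|j IH] lej; first by rewrite ffactn0 dvdn1 => /eqP E; rewrite E in pr.
rewrite ffactnSr Euclid_dvdM // => /orP[/IH|dv ltp]; first by apply; apply: ltnW.
have Ea : a = a - j + j by rewrite subnK // ltnW // (leq_trans lej).
by rewrite Ea -modnDml (eqP dv) add0n modn_small // (leq_trans _ ltp).
Qed.

Lemma dvd_ffact_of_mod m a u w : a = w %[mod m] -> w <= u -> m %| a ^_ u.+1.
Proof.
move=> E lew; have [leau|ltua] := leqP a u; first by rewrite ffact_small.
have: forall j, w < j <= u.+1 -> m %| a ^_ j; last by apply; rewrite ltnS lew /=.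
elim=> // j IH /andP[]; rewrite ltnS leq_eqVlt ffactnSr => /predU1P[<-|ltwj] lej.
  by apply: dvdn_mull; rewrite -eqn_mod_dvd; [apply/eqP | apply: leq_trans lew (ltnW ltua)].
by apply: dvdn_mulr; apply: IH; rewrite ltwj ltnW.
Qed.

(** Choice over a finite range goes by induction and needs no axiom; it turns families of
    existential witnesses into functions. *)
Lemma fin_choice (A : Type) (a0 : A) (P : nat -> A -> Prop) y :
  (forall k, k < y -> exists a, P k a) -> exists f, forall k, k < y -> P k (f k).
Proof.
elim: y => [|y IH] H; first by exists (fun _ => a0).
have [f Hf] := IH (fun k lt => H k (ltnW lt)).
have [a Ha] := H y (ltnSn y).
exists (fun k => if k < y then f k else a) => k.
by rewrite ltnS leq_eqVlt => /predU1P[->|lt]; [rewrite ltnn | rewrite lt; apply: Hf].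
Qed.

Section BoundedForall.
Variables (r : nat) (p q : nterm).

(* Davis: [u] bounds all the witnesses, [c] is congruent to [k] modulo the [k]-th
   modulus, and [a i] codes by Chinese remainders the [i]-th witnesses for all [k].
   A residue of [a i] modulo a prime [p > u] dividing [C(a i, u + 1)] is at most [u]. *)
Definition bq_bound (u y : nat) (e : nat -> nat) : nat :=
  neval (ecat r (fun _ => u) (scons y e)) p + neval (ecat r (fun _ => u) (scons y e)) q
  + u + y + 1.

Definition bq_prod (u y : nat) (e : nat -> nat) : nat :=
  'C((bq_bound u y e)`! * (bq_bound u y e)`! + y, y).

Definition bq_matrix (u c y : nat) (e a : nat -> nat) : Prop :=
  bq_prod u y e %| c + ((bq_bound u y e)`! * (bq_bound u y e)`! + 1) /\
  ((forall i, i < r -> bq_prod u y e %| 'C(a i, u + 1)) /\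
   neval (ecat r a (scons c e)) p = neval (ecat r a (scons c e)) q %[mod bq_prod u y e]).

Lemma bounded_forall_elim y e :
  (forall k, k < y -> exists w, neval (ecat r w (scons k e)) p = neval (ecat r w (scons k e)) q)
  <-> exists u c a, bq_matrix u c y e a.
Proof.
split=> [H|[u [c [a [dvc [dva E]]]]] k ltk]; last first.
  set Q := bq_bound u y e in dvc dva E; rewrite /bq_prod -/Q in dvc dva E.
  have leyQ : y <= Q by rewrite /Q /bq_bound; lia.
  have leuQ : u < Q by rewrite /Q /bq_bound; lia.
  have lepQ : neval (ecat r (fun _ => u) (scons y e)) p <= Q by rewrite /Q /bq_bound; lia.
  have leqQ : neval (ecat r (fun _ => u) (scons y e)) q <= Q by rewrite /Q /bq_bound; lia.
  have ltkQ : k < Q by apply: leq_trans leyQ.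
  (* One prime factor of the [k]-th modulus is enough: it exceeds [Q], hence both sides of the
     equation at the reduced witnesses, so congruence modulo this prime is equality. *)
  have pr : prime (pdiv (bqmod Q k)).
    by rewrite pdiv_prime // /bqmod ltnS divn_gt0 // dvdn_leq ?dvd_fact_sq // muln_gt0 fact_gt0.
  have := pdiv_dvd (bqmod Q k); move: (pdiv _) pr => pi pr dvpi.
  have ltpi := bqmod_prime ltkQ pr dvpi.
  have dvM : pi %| 'C(Q`! * Q`! + y, y).
    by apply: dvdn_trans dvpi _; rewrite -bqmod_prod // (bigD1 (Ordinal ltk)) // dvdn_mulr.
  exists (fun i => if i < r then a i %% pi else 0).
  have lew i : i < r -> a i %% pi <= u.
    move=> lti; apply: prime_dvd_ffact => //; last by apply: ltn_trans ltpi.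
    by rewrite -bin_ffact dvdn_mulr // -addn1; apply: dvdn_trans dvM (dva i lti).
  (* With [T = Q! ^ 2], both [c + T + 1] and [k + T + 1] vanish modulo [pi], the latter being
     [k + 1] times the [k]-th modulus. *)
  have ck : c = k %[mod pi].
    have h1 : pi %| c + (Q`! * Q`! + 1) by apply: dvdn_trans dvc.
    have h2 : pi %| k + (Q`! * Q`! + 1).
      by rewrite addnC -addnA add1n -bqmod_mul // dvdn_mull.
    by apply/eqP; rewrite -(eqn_modDr (Q`! * Q`! + 1)); rewrite (eqP h1) (eqP h2).
  have cong t : neval (ecat r (fun i => if i < r then a i %% pi else 0) (scons k e)) t =
      neval (ecat r a (scons c e)) t %[mod pi].
    apply: neval_mod => i; rewrite /ecat; case: (i < r) => /=; first by rewrite modn_mod.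
    by case: (i - r).
  have small t : neval (ecat r (fun i => if i < r then a i %% pi else 0) (scons k e)) t <=
      neval (ecat r (fun _ => u) (scons y e)) t.
    apply: neval_mono => i; rewrite /ecat; have := lew i; case: (i < r) => [->//|_].
    by case: (i - r) => //=; apply: ltnW.
  apply: (@eq_small_mod _ _ pi).
  - by rewrite !cong -[LHS](modn_dvdm _ dvM) E modn_dvdm.
  - exact: leq_ltn_trans (leq_trans (small p) lepQ) ltpi.
  - exact: leq_ltn_trans (leq_trans (small q) leqQ) ltpi.
have [W HW] := fin_choice (fun _ => 0) H.
pose u := \max_(k < y) \max_(i < r) W k i.
have leu k i : k < y -> i < r -> W k i <= u.
  move=> lk li; apply: leq_trans (leq_bigmax (Ordinal lk)).
  exact: (leq_bigmax (Ordinal li)).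
set Q := bq_bound u y e.
have leyQ : y <= Q by rewrite /Q /bq_bound; lia.
have leuQ : u < Q by rewrite /Q /bq_bound; lia.
have cop i j : i < j < y -> coprime (bqmod Q i) (bqmod Q j) by apply: bqmod_coprime.
have [a Ha] := @fin_choice _ 0 (fun i a => forall k, k < y -> a = W k i %[mod bqmod Q k]) r
  (fun i _ => chinese_family cop (fun k => W k i)).
pose T1 := Q`! * Q`! + 1; pose M := 'C(Q`! * Q`! + y, y).
have M0 : 0 < M by rewrite /M bin_gt0 leq_addl.
have EM : M = \prod_(k < y) bqmod Q k by rewrite bqmod_prod.
have dvM k : k < y -> bqmod Q k %| M.
  by move=> lt; rewrite EM (bigD1 (Ordinal lt)) // dvdn_mulr.
have Mdv x : (forall k, k < y -> bqmod Q k %| x) -> M %| x.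
  by move=> dv; rewrite EM; apply: prod_dvd_of_coprime.
(* A natural number congruent to [- (T + 1)] modulo [M], hence to [k] modulo the [k]-th modulus. *)
pose c := M * T1 - T1.
have Ec : c + T1 = M * T1 by rewrite subnK // leq_pmull.
have ck k : k < y -> c = k %[mod bqmod Q k].
  move=> lt; apply/eqP; rewrite -(eqn_modDr T1) Ec.
  have h1 : bqmod Q k %| M * T1 by rewrite dvdn_mulr ?dvM.
  have h2 : bqmod Q k %| k + T1.
    rewrite /T1 addnC -addnA add1n -bqmod_mul ?dvdn_mull //.
    exact: leq_trans leyQ.
  by rewrite (eqP h1) (eqP h2).
exists u, c, a; rewrite /bq_matrix /bq_prod -/Q -/M -/T1 Ec; split; first exact: dvdn_mulr.
split=> [i lti|].
  apply: Mdv => k ltk; have cf : coprime (bqmod Q k) u.+1`!.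
    by apply: bqmod_coprime_fact => //; apply: leq_trans leyQ.
  rewrite -(Gauss_dvdl _ cf) addn1 bin_ffact.
  by apply: dvd_ffact_of_mod (Ha i lti k ltk) (leu k i ltk lti).
have modM x z : (forall k, k < y -> x = z %[mod bqmod Q k]) -> x = z %[mod M].
  wlog le : x z / z <= x => [IH Hxz|Hxz].
    have [/IH|/ltnW/IH h] := leqP z x; first exact.
    by apply/esym/h => k /Hxz.
  apply/eqP; rewrite eqn_mod_dvd //; apply: Mdv => k ltk.
  by rewrite -eqn_mod_dvd //; apply/eqP; apply: Hxz.
apply: modM => k ltk.
have cong t : neval (ecat r a (scons c e)) t = neval (ecat r (W k) (scons k e)) t %[mod bqmod Q k].
  apply: neval_mod => i; rewrite /ecat; case: ifP => [lti|_]; first exact: Ha.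
  by case: (i - r) => //=; apply: ck.
by rewrite !cong HW.
Qed.

Lemma bq_matrix_ext u c y e e' a a' : e =1 e' -> (forall i, i < r -> a i = a' i) ->
  bq_matrix u c y e a -> bq_matrix u c y e' a'.
Proof.
move=> Ee Ea; have S1 z w t : neval (ecat r w (scons z e)) t = neval (ecat r w (scons z e')) t.
  by apply: neval_ext => i; rewrite /ecat; case: (i < r); [|case: (i - r) => //=].
have S2 t : neval (ecat r a (scons c e')) t = neval (ecat r a' (scons c e')) t.
  by apply: neval_ext => i; rewrite /ecat; case: ifP => // /Ea.
rewrite /bq_matrix /bq_prod /bq_bound !S1 !S2 => -[h1 [h2 h3]].
by split=> //; split=> // i lti; rewrite -Ea //; apply: h2.
Qed.

End BoundedForall.

Lemma dio_forall_lt f (P : nat -> (nat -> nat) -> Prop) : dfun f ->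
  dio (fun e => P (e 0) (fun i => e i.+1)) -> dio (fun e => forall k, k < f e -> P k e).
Proof.
move=> df [F FP]; have [r [p [q FE]]] := dsat_normal_form F.
have PE k e : P k e <-> exists w, neval (ecat r w (scons k e)) p = neval (ecat r w (scons k e)) q.
  by rewrite -FE -(FP (scons k e)).
suff H : dio (fun e => forall k, k < e 0 -> P k (fun i => e i.+1)).
  have := @dio_subst (fun i => if i is j.+1 then fun e => e j else f) _ H.
  by apply; case=> [|i] //; apply: dfun_var.
apply: (dio_iff (Y := fun e => exists u c a, bq_matrix r p q u c (e 0) (fun i => e i.+1) a)).
  move=> e; rewrite -bounded_forall_elim.
  by split=> H k /H /PE.
apply: dio_ex; apply: dio_ex.
(* Layout of the environment: the [r] numbers [a i] come first, then [c], [u], the bound [y], and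
   finally the original environment. *)
pose X (e : nat -> nat) := bq_matrix r p q (e r.+1) (e r) (e r.+2) (fun i => e (r.+3 + i)) e.
have dneval (h g : nat -> nat) b t : dfun (fun e => neval (ecat r (fun i => e (h i)) (scons (e b) (fun i => e (g i)))) t).
  apply: (@dfun_neval (fun i e => ecat r (fun i => e (h i)) (scons (e b) (fun i => e (g i))) i)) => i.
  by rewrite /ecat; case: (i < r); [|case: (i - r) => [|j]]; apply: dfun_var.
have dX : dio X.
  have dB : dfun (fun e => bq_bound r p q (e r.+1) (e r.+2) (fun i => e (r.+3 + i))).
    by rewrite /bq_bound; have := dneval (fun _ => r.+1); diot.
  have dM : dfun (fun e => bq_prod r p q (e r.+1) (e r.+2) (fun i => e (r.+3 + i))).
    by rewrite /bq_prod; diot.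
  rewrite /X /bq_matrix; apply: dio_and; first by diot.
  apply: dio_and; first by apply: dio_all_fin => i _; diot.
  apply: dio_fun_eq; apply: dfun_mod => //; exact: (dneval id).
apply: (dio_iff (Y := fun e => exists w, X (ecat r w e))) (dio_exs r dX).
have E i w e : ecat r w e (r + i) = e i by rewrite /ecat ltnNge leq_addr /= addKn.
have E' w e : X (ecat r w e) = bq_matrix r p q (e 1) (e 0) (e 2)
    (fun i => ecat r w e (r.+3 + i)) (ecat r w e).
  by rewrite /X -(E 0 w e) -(E 1 w e) -(E 2 w e) addn0 addn1 addn2.
move=> e; split=> -[w H]; exists w.
  rewrite E'; apply: bq_matrix_ext H => [i|i lti]; last by rewrite /ecat lti.
  by rewrite -[r.+3]addn3 -addnA E.
move: H; rewrite E'; apply: bq_matrix_ext => [i|i lti]; last by rewrite /ecat lti.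
by rewrite -[r.+3]addn3 -addnA E.
Qed.

(** * Graphs of recursive functions are Diophantine *)

Lemma mkseqS (T : Type) (f : nat -> T) k : mkseq f k.+1 = f 0 :: mkseq (fun i => f i.+1) k.
Proof. by rewrite /mkseq /= -[1]addn0 iotaDl -map_comp. Qed.

Lemma eq_in_mkseq (T : Type) (f g : nat -> T) k :
  (forall i, i < k -> f i = g i) -> mkseq f k = mkseq g k.
Proof. by move=> E; apply/eq_in_map => i; rewrite mem_iota => /andP[_ /E]. Qed.

Fixpoint rf_all (P : rf -> Prop) (gs : seq rf) : Prop :=
  if gs is g :: gs' then P g /\ rf_all P gs' else True.

(** The generated induction principle gives no hypothesis on the list inside [RComp]; this one
    provides it through [rf_all]. *)
Fixpoint rf_nested_ind (P : rf -> Prop) (Pzero : P RZero) (Psucc : P RSucc)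
    (Pproj : forall i, P (RProj i))
    (Pcomp : forall f gs, P f -> rf_all P gs -> P (RComp f gs))
    (Prec : forall f g, P f -> P g -> P (RRec f g))
    (Pmu : forall f, P f -> P (RMu f)) (c : rf) : P c :=
  let ind := rf_nested_ind Pzero Psucc Pproj Pcomp Prec Pmu in
  match c with
  | RZero => Pzero
  | RSucc => Psucc
  | RProj i => Pproj i
  | RComp f gs => Pcomp f gs (ind f)
      ((fix ind_all (gs : seq rf) : rf_all P gs :=
          match gs with
          | [::] => I
          | g :: gs' => conj (ind g) (ind_all gs')
          end) gs)
  | RRec f g => Prec f g (ind f) (ind g)
  | RMu f => Pmu f (ind f)
  end.

Lemma rf_all_nth P gs i : rf_all P gs -> i < size gs -> P (nth RZero gs i).
Proof. by elim: gs i => // g gs IH [|i] /= [Pg Pgs] // lt; apply: IH. Qed.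

Lemma revals_nth gs v ws : revals gs v ws <->
  size ws = size gs /\ forall i, i < size gs -> reval (nth RZero gs i) v (nth 0 ws i).
Proof.
elim: gs ws => [|g gs IH] ws /=.
  split=> [H|[/size0nil->]]; first by inversion H.
  by move=> _; constructor.
split=> [H|].
  inversion_clear H as [|? ? ? y ys Hg Hgs]; have [Es Hi] := (IH _).1 Hgs.
  by split=> /= [|[|i]] //=; [rewrite Es | apply: Hi].
case: ws => [|w ws] [] //= [Es] H; constructor; first exact: (H 0).
by apply/IH; split=> // i; apply: (H i.+1).
Qed.

Lemma reval_comp f gs v y : reval (RComp f gs) v y <-> exists w : nat -> nat,
  (forall i, i < size gs -> reval (nth RZero gs i) v (w i)) /\ reval f (mkseq w (size gs)) y.
Proof.
split=> [H|[w [H1 H2]]].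
  inversion_clear H as [| | |? ? ? ws ? Hgs Hf| | |].
  have [Es Hi] := (revals_nth _ _ _).1 Hgs.
  by exists (nth 0 ws); split=> //; rewrite -Es mkseq_nth.
apply: (ev_comp _ H2); apply/revals_nth; rewrite size_mkseq; split=> // i lt.
by rewrite nth_mkseq //; apply: H1.
Qed.

Lemma reval_rec f g x v y : reval (RRec f g) (x :: v) y <-> exists s : nat -> nat,
  [/\ reval f v (s 0), forall j, j < x -> reval g (j :: s j :: v) (s j.+1) & s x = y].
Proof.
split=> [|[s [H0 HS <-]]]; last first.
  elim: x HS => [|x IH] HS; first by constructor.
  by apply: (ev_recS (IH _) (HS x _)) => // j lt; apply: HS; apply: ltnW.
elim: x y => [|x IH] y H; inversion_clear H as [| | | |? ? ? ? Hf|? ? ? ? r ? Hr Hg|].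
  by exists (fun _ => y).
have [s [H0 HS Es]] := IH _ Hr.
exists (fun j => if j <= x then s j else y); split=> // [j|]; last by rewrite ltnn.
rewrite ltnS => lejx; rewrite lejx; case: ltngtP lejx => // [lt|->] _; first exact: HS.
by rewrite Es.
Qed.

(** Argument lists have a length and environments have none, hence one Diophantine set for each
    arity [k]. *)
Definition dreval c := forall k, dio (fun e => reval c (mkseq (fun i => e i.+1) k) (e 0)).

Lemma dio_reval c k f fs : dreval c -> dfun f -> (forall i, dfun (fs i)) ->
  dio (fun e => reval c (mkseq (fun i => fs i e) k) (f e)).
Proof.
move=> dc df dfs; have := @dio_subst (fun i => if i is j.+1 then fs j else f) _ (dc k).
by apply; case.
Qed.

Lemma dio_reval1 c k f g fs : dreval c -> dfun f -> dfun g -> (forall i, dfun (fs i)) ->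
  dio (fun e => reval c (g e :: mkseq (fun i => fs i e) k) (f e)).
Proof.
move=> dc df dg dfs.
have := @dio_reval c k.+1 f (fun i => if i is j.+1 then fs j else g) dc df.
move=> /(_ ltac:(by case)); apply: dio_iff => e.
by rewrite mkseqS.
Qed.

Lemma dio_reval2 c k f g h fs : dreval c -> dfun f -> dfun g -> dfun h -> (forall i, dfun (fs i)) ->
  dio (fun e => reval c (g e :: h e :: mkseq (fun i => fs i e) k) (f e)).
Proof.
move=> dc df dg dh dfs.
have := @dio_reval1 c k.+1 f g (fun i => if i is j.+1 then fs j else h) dc df dg.
move=> /(_ ltac:(by case)); apply: dio_iff => e.
by rewrite mkseqS.
Qed.

Lemma dreval_comp f gs : dreval f -> rf_all dreval gs -> dreval (RComp f gs).
Proof.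
move=> df dgs k; set r := size gs.
pose X (e : nat -> nat) :=
  (forall i, i < r -> reval (nth RZero gs i) (mkseq (fun i => e (r + i.+1)) k) (e i)) /\
  reval f (mkseq e r) (e (r + 0)).
have dX : dio X.
  apply: dio_and; last by apply: dio_reval => // [|i]; apply: dfun_var.
  apply: dio_all_fin => i lt; apply: dio_reval => [||j]; try exact: dfun_var.
  exact: rf_all_nth.
apply: dio_iff (dio_exs r dX) => e; rewrite reval_comp -/r.
have E i w : ecat r w e (r + i) = e i by rewrite /ecat ltnNge leq_addr /= addKn.
have Es w : mkseq (ecat r w e) r = mkseq w r.
  by apply: eq_in_mkseq => i lt; rewrite /ecat lt.
have Ev w : mkseq (fun i => ecat r w e (r + i.+1)) k = mkseq (fun i => e i.+1) k.
  by apply: eq_in_mkseq => i _; rewrite E.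
have Ec w : X (ecat r w e) <-> (forall i, i < r ->
    reval (nth RZero gs i) (mkseq (fun i => e i.+1) k) (w i)) /\ reval f (mkseq w r) (e 0).
  rewrite /X Es E Ev; split=> -[H1 H2]; split=> // i lt; have := H1 i lt; by rewrite /ecat lt.
by split=> -[w /Ec Hw]; exists w.
Qed.

Definition digit (b c j : nat) : nat := c %/ b ^ j %% b.

Lemma dfun_digit f g h : dfun f -> dfun g -> dfun h -> dfun (fun e => digit (f e) (g e) (h e)).
Proof. by move=> df dg dh; rewrite /digit; diot. Qed.
#[global] Hint Resolve dfun_digit : dio.

Lemma digit_code (s : nat -> nat) x : exists b c, forall j, j <= x -> digit b c j = s j.
Proof.
pose b := (\max_(j < x.+1) s j).+1; pose s' j := if j <= x then s j else 0.
exists b, (\sum_(i < x.+1) s' i * b ^ i) => j lej.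
rewrite /digit digit_sum //; first by rewrite /s' lej.
move=> i; rewrite /s'; case: ifP => // lei; rewrite ltnS.
exact: (leq_bigmax (Ordinal (n := x.+1) (m := i) lei)).
Qed.

(** The intermediate values are the digits of one number [c] in some base [b], and their correctness
    is a bounded universal statement about these digits. *)
Lemma dreval_rec f g : dreval f -> dreval g -> dreval (RRec f g).
Proof.
move=> df dg [|k].
  by apply: dio_iff dio_false => e; split=> // H; inversion H.
apply: (dio_iff (Y := fun e => exists b c,
  reval f (mkseq (fun i => e i.+2) k) (digit b c 0) /\
  ((forall j, j < e 1 -> reval g (j :: digit b c j :: mkseq (fun i => e i.+2) k) (digit b c j.+1)) /\
   digit b c (e 1) = e 0))) => [e|].
  rewrite mkseqS reval_rec; split=> [[s [H0 HS Es]]|[b [c [H0 [HS E]]]]]; last first.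
    by exists (digit b c).
  have [b [c Hbc]] := digit_code s (e 1); exists b, c.
  split; first by rewrite (Hbc 0 (leq0n _)).
  split; last by rewrite (Hbc _ (leqnn _)).
  by move=> j lt; rewrite (Hbc _ lt) (Hbc _ (ltnW lt)); apply: HS.
apply: dio_ex; apply: dio_ex; apply: dio_and.
  by apply: dio_reval => //; diot.
apply: dio_and; last by diot.
apply: (dio_forall_lt (P := fun j e => reval g (j :: digit (e 1) (e 0) j ::
   mkseq (fun i => e i.+4) k) (digit (e 1) (e 0) j.+1))); first by diot.
by apply: dio_reval2 => //; diot.
Qed.

Lemma dreval_mu f : dreval f -> dreval (RMu f).
Proof.
move=> df k; apply: (dio_iff (Y := fun e => reval f (e 0 :: mkseq (fun i => e i.+1) k) 0 /\
  forall j, j < e 0 -> exists y, reval f (j :: mkseq (fun i => e i.+1) k) y.+1)) => [e|].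
  by split=> [H|[H0 HS]]; [inversion_clear H | constructor].
apply: dio_and; first by apply: dio_reval1 => //; diot.
apply: (dio_forall_lt (P := fun j e => exists y, reval f (j :: mkseq (fun i => e i.+1) k) y.+1)).
  exact: dfun_var.
by apply: dio_ex; apply: dio_reval1 => //; diot.
Qed.

Theorem reval_dio c : dreval c.
Proof.
elim/rf_nested_ind: c => [||i|f gs df dgs|f g df dg|f df].
- move=> k; apply: (dio_iff (Y := fun e => e 0 = 0)); last by diot.
  by move=> e; split=> [H|->]; [inversion_clear H | constructor].
- case=> [|k]; first by apply: dio_iff dio_false => e; split=> // H; inversion H.
  apply: (dio_iff (Y := fun e => e 0 = (e 1).+1)); last by diot.
  by move=> e; rewrite mkseqS; split=> [H|->]; [inversion_clear H | constructor].
- move=> k; apply: (dio_iff (Y := fun e => e 0 = if i < k then e i.+1 else 0)).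
    move=> e; have E : nth 0 (mkseq (fun i => e i.+1) k) i = if i < k then e i.+1 else 0.
      by case: ltnP => h; [rewrite nth_mkseq | rewrite nth_default // size_mkseq].
    split=> [H|->]; first by rewrite -E; inversion_clear H.
    by rewrite -E; constructor.
  by case: (i < k); diot.
- exact: dreval_comp.
- exact: dreval_rec.
exact: dreval_mu.
Qed.

(** * Lagrange's four-square theorem *)

Section FourSquares.
Local Open Scope ring_scope.

Definition four_squares (n : int) :=
  exists a b c d : int, n = a ^+ 2 + b ^+ 2 + c ^+ 2 + d ^+ 2.

Lemma four_squares_mul m n : four_squares m -> four_squares n -> four_squares (m * n).
Proof.
move=> [a [b [c [d ->]]]] [x [y [z [t ->]]]].
exists (a * x + b * y + c * z + d * t), (a * y - b * x - c * t + d * z).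
exists (a * z + b * t - c * x - d * y), (a * t - b * z + c * y - d * x).
by ring.
Qed.

(** Pigeonhole with [h = (p - 1) / 2]: the [h + 1] squares are distinct modulo [p], so are the
    [h + 1] values [- 1 - j^2], and [p + 1] values cannot all be distinct. The term [p * p] keeps
    the latter values natural. *)
Lemma two_squares_add1_mod (p : nat) : prime p -> odd p ->
  exists m i j : nat, [/\ (0 < m)%N, (m < p)%N & (m * p = i * i + j * j + 1)%N].
Proof.
move=> pr op; have p1 := prime_gt1 pr; pose h := p./2.
have Ep : p = (h.*2).+1 by rewrite -[LHS]odd_double_half op.
have p0 : (0 < p)%N by lia.
pose f (u : bool * 'I_h.+1) : 'I_p := Ordinal (ltn_pmod
   (if u.1 then (p * p - (u.2 * u.2 + 1)) else (u.2 * u.2))%N p0).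
have sq_inj (i j : 'I_h.+1) : (i * i = j * j %[mod p])%N -> i = j.
  wlog le : i j / (j <= i)%N => [IH E|].
    by have [/IH->//|/ltnW/IH h2] := leqP j i; apply/esym/h2.
  move/eqP; rewrite eqn_mod_dvd ?leq_mul // => dv.
  have E : (i * i - j * j = (i - j) * (i + j))%N by nia.
  rewrite E Euclid_dvdM // in dv; apply/val_inj => /=.
  have li := ltn_ord i; have lj := ltn_ord j.
  have [//|nij] := eqVneq (i : nat) j.
  by case/orP: dv => /dvdn_leq; lia.
have ninj : ~ injective f.
  move=> /leq_card; rewrite card_prod card_bool !card_ord.
  lia.
have small (i : 'I_h.+1) : (i * i + 1 <= p * p)%N by have := ltn_ord i; nia.
have [i [j E]] : exists i j : 'I_h.+1, (i * i = p * p - (j * j + 1) %[mod p])%N.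
  have /injectivePn : ~~ injectiveb f by apply/injectiveP.
  move=> [[b i] [[b' j] ne /(congr1 val)]] /=.
  case: b b' ne => -[] ne E; last 1 first.
  - by case/eqP: ne; rewrite (sq_inj _ _ E).
  - case/eqP: ne; rewrite (sq_inj i j) //; apply/eqP.
    rewrite -(eqn_modDr 1) -(eqn_modDl (p * p - (i * i + 1))) subnK // -(modnDml (p * p - _)) E.
    by rewrite modnDml subnK.
  - by exists j, i.
  by exists i, j.
have dv : (p %| i * i + j * j + 1)%N.
  by rewrite /dvdn -addnA -modnDml E modnDml subnK // modnMl.
have /dvdnP[m Em] := dv; exists m, i, j; split=> //.
  by case: m Em => //; lia.
have hi : (i * i <= h * h)%N by rewrite leq_mul // -ltnS.
have hj : (j * j <= h * h)%N by rewrite leq_mul // -ltnS.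
have : (i * i + j * j + 1 < p * p)%N by have h1 : (0 < h)%N by [lia]; rewrite Ep; clear -hi hj h1; nia.
by rewrite Em ltn_pmul2r.
Qed.

Lemma balanced_residue (a m : int) : 0 < m -> exists b q, [/\ a = b + m * q, - m < 2 * b & 2 * b <= m].
Proof.
move=> m0; have := modz_ge0 a (lt0r_neq0 m0); have := ltz_pmod a m0.
have := divz_eq a m; move: (a %% m)%Z (a %/ m)%Z => r q E lt ge.
have [le|gt] := leP (2 * r) m; first by exists r, q; split; lia.
by exists (r - m), (q + 1); split; lia.
Qed.

Lemma sqr_half_le (g m : int) : - m < 2 * g -> 2 * g <= m -> 4 * g ^+ 2 <= m ^+ 2.
Proof. by nia. Qed.

Lemma sqr_half_eq (g m : int) : - m < 2 * g -> 4 * g ^+ 2 = m ^+ 2 -> 2 * g = m.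
Proof.
move=> gt E; have /eqP : (2 * g - m) * (2 * g + m) = 0 by lia.
rewrite mulf_eq0 => /orP[]; lia.
Qed.

Lemma sqr_eq0_int (g : int) : 4 * g ^+ 2 = 0 -> g = 0.
Proof. by move=> E; apply/eqP; rewrite -sqrf_eq0; lia. Qed.

(* Balanced residues modulo [m] of the four roots have a sum of squares [m r] with
   [r <= m]; Euler's identity then represents [r p], and [r = 0] and [r = m] would
   both force [m] to divide [p]. *)
Lemma four_squares_descent (p m : nat) : prime p -> (0 < m < p)%N ->
  four_squares (Posz m * Posz p) -> four_squares p.
Proof.
move=> pr; elim/ltn_ind: m => m IH /andP[m0 ltmp].
have [->|m1] := eqVneq m 1%N; first by rewrite mul1r.
have ndv k : (Posz p != Posz m * k).
  apply/eqP => E; have : (m %| p)%N by have := dvdz_mulr k (dvdzz m); rewrite -E.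
  have /primeP[_ dvp] := pr; move=> /dvp /pred2P; clear -m1 ltmp; lia.
move=> [a [b [c [d E]]]].
have m0' : 0 < Posz m by lia.
have [x [s [Ea xl xu]]] := balanced_residue a m0'.
have [y [t [Eb yl yu]]] := balanced_residue b m0'.
have [z [u [Ec zl zu]]] := balanced_residue c m0'.
have [w [v [Ed wl wu]]] := balanced_residue d m0'.
have Sx := sqr_half_le xl xu; have Sy := sqr_half_le yl yu.
have Sz := sqr_half_le zl zu; have Sw := sqr_half_le wl wu.
have [Px Py Pz Pw] : [/\ 0 <= x ^+ 2, 0 <= y ^+ 2, 0 <= z ^+ 2 & 0 <= w ^+ 2].
  by split; apply: sqr_ge0.
pose r := Posz p - 2 * (x * s + y * t + z * u + w * v) - Posz m * (s ^+ 2 + t ^+ 2 + u ^+ 2 + v ^+ 2).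
have Er : Posz m * r = x ^+ 2 + y ^+ 2 + z ^+ 2 + w ^+ 2.
  by rewrite /r !mulrBr E Ea Eb Ec Ed; ring.
have r0 : 0 <= r by rewrite -(pmulr_rge0 _ m0') Er; clear -Px Py Pz Pw; lia.
have rm : r <= Posz m.
  by rewrite -(ler_pM2l m0') Er -expr2; clear -Sx Sy Sz Sw; lia.
have [r_0|rn0] := eqVneq r 0.
  rewrite r_0 mulr0 in Er.
  have [x0 [y0 [z0 w0]]] : x = 0 /\ y = 0 /\ z = 0 /\ w = 0 by do !split; apply: sqr_eq0_int; clear -Er Px Py Pz Pw; lia.
  move: (ndv (s ^+ 2 + t ^+ 2 + u ^+ 2 + v ^+ 2)).
  by move: r_0; rewrite /r x0 y0 z0 w0; clear; lia.
have [r_m|rnm] := eqVneq r m.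
  rewrite r_m in Er.
  have [x0 [y0 [z0 w0]]] : 2 * x = Posz m /\ 2 * y = Posz m /\ 2 * z = Posz m /\ 2 * w = Posz m.
    by do !split; apply: sqr_half_eq => //; clear -Er Sx Sy Sz Sw; lia.
  move: (ndv (s ^+ 2 + t ^+ 2 + u ^+ 2 + v ^+ 2 + s + t + u + v + 1)).
  move: r_m; rewrite /r.
  have -> : 2 * (x * s + y * t + z * u + w * v) = Posz m * (s + t + u + v).
    by rewrite !mulrDr !mulrA x0 y0 z0 w0.
  by clear; lia.
apply: (IH `|r|%N); [by clear -rm r0 rnm; lia | by clear -rm r0 rn0 ltmp; lia |].
exists (r + x * s + y * t + z * u + w * v), (s * y - t * x - u * w + v * z).
exists (s * z + t * w - u * x - v * y), (s * w - t * z + u * y - v * x).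
have -> : Posz `|r|%N = r by clear -r0; lia.
have m2 : Posz m ^+ 2 != 0 by rewrite sqrf_eq0; clear -m0; lia.
apply: (mulfI m2).
transitivity ((a ^+ 2 + b ^+ 2 + c ^+ 2 + d ^+ 2) * (x ^+ 2 + y ^+ 2 + z ^+ 2 + w ^+ 2)).
  by rewrite -E -Er; ring.
transitivity ((Posz m * r + Posz m * (x * s + y * t + z * u + w * v)) ^+ 2
  + Posz m ^+ 2 * (s * y - t * x - u * w + v * z) ^+ 2
  + Posz m ^+ 2 * (s * z + t * w - u * x - v * y) ^+ 2
  + Posz m ^+ 2 * (s * w - t * z + u * y - v * x) ^+ 2); last by ring.
by rewrite Er Ea Eb Ec Ed; ring.
Qed.

Lemma four_squares_prime (p : nat) : prime p -> four_squares p.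
Proof.
move=> pr; have [->|op] := even_prime pr; first by exists 1, 1, 0, 0.
have [m [i [j [m0 ltm E]]]] := two_squares_add1_mod pr op.
apply: (@four_squares_descent p m) => //; first by rewrite m0.
by exists i, j, 1, 0; rewrite -PoszM E; lia.
Qed.

Lemma four_squares_nat (n : nat) : four_squares n.
Proof.
elim/ltn_ind: n => n IH.
have [lt|n2] := ltnP n 2.
  by case: n lt {IH} => [|[|]] // _; [exists 0, 0, 0, 0 | exists 1, 0, 0, 0].
have pr := pdiv_prime n2; have /dvdnP[k Ek] := pdiv_dvd n.
rewrite {1}Ek PoszM; apply: four_squares_mul; last exact: four_squares_prime.
apply: IH; rewrite [X in (_ < X)%N]Ek ltn_Pmulr ?prime_gt1 //.
by case: k Ek => // Ek; rewrite Ek in n2.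
Qed.

End FourSquares.

(** * Programming with recursive functions *)

Lemma reval_fun c v y y' : reval c v y -> reval c v y' -> y = y'.
Proof.
elim/rf_nested_ind: c v y y' => [||i|f gs IHf IHgs|f g IHf IHg|f IHf] v y y'.
- by move=> H1 H2; inversion H1; inversion H2.
- by move=> H1 H2; inversion H1; subst v; inversion H2.
- by move=> H1 H2; inversion H1; inversion H2.
- rewrite !reval_comp => -[w [H1 H2]] [w' [H1' H2']].
  apply: IHf H2 _; rewrite (_ : mkseq w _ = mkseq w' (size gs)) //.
  by apply: eq_in_mkseq => i lt; apply: (rf_all_nth IHgs lt) (H1 i lt) (H1' i lt).
- case: v => [|x v]; first by move=> H; inversion H.
  rewrite !reval_rec => -[s [H0 HS <-]] [s' [H0' HS' <-]].
  have: forall j, j <= x -> s j = s' j; last by apply.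
  elim=> [_|j IH lt]; first exact: IHf H0 H0'.
  by apply: IHg (HS j lt) _; rewrite (IH (ltnW lt)); apply: HS'.
move=> H H'; inversion_clear H as [| | | | | |? ? ? H0 HS].
inversion_clear H' as [| | | | | |? ? ? H0' HS'].
case: (ltngtP y y') => // lt.
  by have [z Hz] := HS' _ lt; have := IHf _ _ _ H0 Hz.
by have [z Hz] := HS _ lt; have := IHf _ _ _ H0' Hz.
Qed.

(* [f] is recursive as a function of the first [k] entries of its environment. *)
Definition cf (k : nat) (f : (nat -> nat) -> nat) : Prop :=
  exists c, forall e, reval c (mkseq e k) (f e).

Lemma cf_ext k f g : f =1 g -> cf k g -> cf k f.
Proof. by move=> E [c H]; exists c => e; rewrite E. Qed.

Lemma cf_var k i : i < k -> cf k (fun e => e i).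
Proof. by exists (RProj i) => e; have := ev_proj i (mkseq e k); rewrite nth_mkseq. Qed.

Lemma cf_comp j k g fs : cf j g -> (forall i, i < j -> cf k (fs i)) ->
  cf k (fun e => g (fun i => fs i e)).
Proof.
move=> [c Hc] Hfs; have [w Hw] := fin_choice RZero Hfs.
exists (RComp c (mkseq w j)) => e; apply/reval_comp.
exists (fun i => fs i e); rewrite size_mkseq; split=> [i lt|]; last exact: Hc.
by rewrite nth_mkseq //; apply: Hw.
Qed.

Lemma cf1 (g : nat -> nat) k f : cf 1 (fun e => g (e 0)) -> cf k f -> cf k (fun e => g (f e)).
Proof. by move=> Hg Hf; apply: (@cf_comp 1 k _ (fun _ => f) Hg). Qed.

Lemma cf2 (g : nat -> nat -> nat) k f1 f2 : cf 2 (fun e => g (e 0) (e 1)) ->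
  cf k f1 -> cf k f2 -> cf k (fun e => g (f1 e) (f2 e)).
Proof.
by move=> Hg H1 H2; apply: (@cf_comp 2 k _ (fun i => if i is 0 then f1 else f2) Hg) => -[|[]].
Qed.

Lemma cf_S k f : cf k f -> cf k (fun e => (f e).+1).
Proof. by apply: (@cf1 succn); exists RSucc => e; constructor. Qed.

Lemma cf_cst k c : cf k (fun _ => c).
Proof.
elim: c => [|c IH]; last exact: (@cf_S k (fun _ => c)).
by exists RZero => v; constructor.
Qed.

Lemma cf_iteri k f (g : nat -> nat -> (nat -> nat) -> nat) h :
  cf k f -> cf k.+2 (fun e => g (e 0) (e 1) (fun i => e i.+2)) -> cf k h ->
  cf k (fun e => iteri (h e) (fun j r => g j r e) (f e)).
Proof.
move=> [cf Hf] [cg Hg] [ch Hh].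
exists (RComp (RRec cf cg) (ch :: mkseq RProj k)) => e.
apply: (@ev_comp _ _ _ (h e :: mkseq e k)).
  constructor; first exact: Hh.
  apply/revals_nth; rewrite !size_mkseq; split=> // i lt.
  by rewrite nth_mkseq //; constructor.
apply/reval_rec; exists (fun n => iteri n (fun j r => g j r e) (f e)); split=> //=.
move=> j _; have := Hg (scons j (scons (iteri j (fun j r => g j r e) (f e)) e)).
by rewrite !mkseqS.
Qed.

Create HintDb cf.
#[global] Hint Resolve cf_S cf_cst : cf.
#[global] Hint Extern 1 (cf _ (fun e => e _)) => apply cf_var; reflexivity : cf.
Ltac cft := auto 40 with cf nocore.

Lemma cf_add k f g : cf k f -> cf k g -> cf k (fun e => f e + g e).
Proof.
apply: cf2; apply: (cf_ext (g := fun e => iteri (e 1) (fun _ r => r.+1) (e 0))).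
  by move=> e; elim: (e 1) => [|n IH] /=; rewrite ?addn0 // addnS IH.
by apply: (cf_iteri (g := fun _ r _ => r.+1)); cft.
Qed.
#[global] Hint Resolve cf_add : cf.

Lemma cf_mul k f g : cf k f -> cf k g -> cf k (fun e => f e * g e).
Proof.
apply: cf2; apply: (cf_ext (g := fun e => iteri (e 1) (fun _ r => r + e 0) 0)).
  by move=> e; elim: (e 1) => [|n IH] /=; rewrite ?muln0 // mulnS -IH addnC.
by apply: (cf_iteri (g := fun _ r e => r + e 0)); cft.
Qed.

Lemma cf_pred k f : cf k f -> cf k (fun e => (f e).-1).
Proof.
apply: cf1; apply: (cf_ext (g := fun e => iteri (e 0) (fun j _ => j) 0)).
  by move=> e; case: (e 0).
by apply: (cf_iteri (g := fun j _ _ => j)); cft.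
Qed.
#[global] Hint Resolve cf_mul cf_pred : cf.

Lemma cf_sub k f g : cf k f -> cf k g -> cf k (fun e => f e - g e).
Proof.
apply: cf2; apply: (cf_ext (g := fun e => iteri (e 1) (fun _ r => r.-1) (e 0))).
  by move=> e; elim: (e 1) => [|n IH] /=; rewrite ?subn0 // subnS IH.
by apply: (cf_iteri (g := fun _ r _ => r.-1)); cft.
Qed.
#[global] Hint Resolve cf_sub : cf.

(** Halving is an iteration because [(n + 1)./2 = n - n./2]. *)
Lemma cf_half k f : cf k f -> cf k (fun e => (f e)./2).
Proof.
apply: cf1; apply: (cf_ext (g := fun e => iteri (e 0) (fun j r => j - r) 0)).
  by move=> e; elim: (e 0) => [|n IH] //=; rewrite -IH uphalf_half; lia.
by apply: (cf_iteri (g := fun j r _ => j - r)); cft.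
Qed.
#[global] Hint Resolve cf_half : cf.

(** The conditional is an iteration with a constant step: [|f - g|] rounds return [a] when there is
    no round and [b] otherwise. *)
Lemma cf_ifeq k f g a b : cf k f -> cf k g -> cf k a -> cf k b ->
  cf k (fun e => if f e == g e then a e else b e).
Proof.
move=> Hf Hg Ha Hb.
have H : cf 3 (fun e => iteri (e 0) (fun _ _ => e 2) (e 1)).
  by apply: (cf_iteri (g := fun _ _ e => e 2)); cft.
have := @cf_comp 3 k _ (fun i => if i is j.+1 then if j is 0 then a else b
  else fun e => (f e - g e) + (g e - f e)) H.
move=> /(_ ltac:(move=> [|[|[|]]] //= _; cft)); apply: cf_ext => e /=.
case: eqP => [->|ne]; first by rewrite subnn.
by case E: (_ + _) => //=; lia.
Qed.
#[global] Hint Resolve cf_ifeq : cf.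

Lemma cf_pairn k f g : cf k f -> cf k g -> cf k (fun e => pairn (f e) (g e)).
Proof. by move=> Hf Hg; rewrite /pairn; cft. Qed.
#[global] Hint Resolve cf_pairn : cf.

Lemma pairn_inj a b a' b' : pairn a b = pairn a' b' -> a = a' /\ b = b'.
Proof.
have tri s : ((s * s.+1)./2).*2 = s * s.+1.
  by rewrite -[RHS]odd_double_half oddM /= andbN.
have step s t : s < t -> (s * s.+1)./2 + s < (t * t.+1)./2.
  by move=> lt; have := tri s; have := tri t; nia.
rewrite /pairn => E; case: (ltngtP (a + b) (a' + b')) => [/step|/step|Es]; [lia|lia|].
by move: E; rewrite Es => /addnI Eb; split=> //; lia.
Qed.

Lemma pairn_ge a b : a <= pairn a b /\ b <= pairn a b.
Proof.
have := odd_double_half ((a + b) * (a + b).+1); rewrite oddM /= andbN add0n.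
by rewrite /pairn; move: (_./2) => h; nia.
Qed.

Lemma pairn_gt a b : 0 < a -> b < pairn a b.
Proof.
have := odd_double_half ((a + b) * (a + b).+1); rewrite oddM /= andbN add0n.
by rewrite /pairn; move: (_./2) => h; nia.
Qed.

(** Exhaustive search up to [z], which needs only iteration and equality tests, and suffices because
    components never exceed the code of their pair. *)
Definition unpair_with (F : nat -> nat -> nat) (z : nat) : nat :=
  iteri z.+1 (fun a r => iteri z.+1 (fun b r' => if pairn a b == z then F a b else r') r) 0.
Definition unp1 := unpair_with (fun a _ => a).
Definition unp2 := unpair_with (fun _ b => b).

Lemma iteri_find (P : pred nat) (F : nat -> nat) n r0 :
  iteri n (fun j r => if P j then F j else r) r0 = r0 /\ (forall j, j < n -> ~~ P j) \/
  exists j, [/\ j < n, P j & iteri n (fun j r => if P j then F j else r) r0 = F j].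
Proof.
elim: n => [|n [[E H]|[j [lt Pj E]]]] /=; first by left.
  case: ifP => Pn; first by right; exists n.
  by left; split=> // j; rewrite ltnS leq_eqVlt => /predU1P[->|/H//]; rewrite Pn.
right; case: ifP => Pn; first by exists n.
by exists j; rewrite E ltnW.
Qed.

Lemma eq_iteri (T : Type) (g g' : nat -> T -> T) n x :
  (forall j r, g j r = g' j r) -> iteri n g x = iteri n g' x.
Proof. by move=> E; elim: n => //= n ->; rewrite E. Qed.

Lemma unpair_pairn F a b : unpair_with F (pairn a b) = F a b.
Proof.
have [leaz lebz] := pairn_ge a b; rewrite -ltnS in leaz; rewrite -ltnS in lebz.
rewrite /unpair_with (@eq_iteri _ _ (fun a' r => if a' == a then F a b else r)) => [|a' r].
  have [[_ H]|[j [_ _ ->]]] // := iteri_find (eq_op^~ a) (fun _ => F a b) (pairn a b).+1 0.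
  by have := H a leaz; rewrite eqxx.
have [[-> H]|[j [_ /eqP E ->]]] :=
  iteri_find (fun b' => pairn a' b' == pairn a b) (F a') (pairn a b).+1 r.
  by case: eqP => // E; have := H b lebz; rewrite E eqxx.
by have [-> ->] := pairn_inj E; rewrite eqxx.
Qed.

Lemma unp1K a b : unp1 (pairn a b) = a. Proof. exact: unpair_pairn. Qed.
Lemma unp2K a b : unp2 (pairn a b) = b. Proof. exact: unpair_pairn. Qed.

(** By surjectivity every number can be read as a tagged pair, also a number that codes no term. The
    induction walks along the diagonals. *)
Lemma pairn_surj z : z = pairn (unp1 z) (unp2 z).
Proof.
have [a [b ->]] : exists a b, z = pairn a b; last by rewrite unp1K unp2K.
elim: z => [|z [a [b ->]]]; first by exists 0, 0.
case: a => [|a].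
  exists b.+1, 0; rewrite /pairn !addn0 add0n.
  have := odd_double_half (b * b.+1); rewrite oddM /= andbN add0n.
  have := odd_double_half (b.+1 * b.+2); rewrite oddM /= negbK andNb add0n.
  by move: (_./2) (_./2) => h h'; nia.
by exists a, b.+1; rewrite /pairn addSnnS [RHS]addnS.
Qed.

Lemma cf_unpair F k f : cf 3 (fun e => F (e 1) (e 0)) -> cf k f ->
  cf k (fun e => unpair_with F (f e)).
Proof.
move=> HF Hf; apply: (cf1 (g := fun z => unpair_with F z)) Hf; rewrite /unpair_with.
apply: (cf_iteri (g := fun a r e => iteri (e 0).+1
  (fun b r' => if pairn a b == e 0 then F a b else r') r)); [by cft | | by cft].
apply: (cf_iteri (g := fun b r' e => if pairn (e 0) b == e 2 then F (e 0) b else r'));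
  [by cft | | by cft].
apply: cf_ifeq; [by cft | by cft | | by cft].
apply: (@cf_comp 3 5 _ (fun i => if i is j.+1 then if j is 0 then fun e => e 2 else fun e => 0
  else fun e => e 0) HF) => -[|[|i]] _; by cft.
Qed.

Lemma cf_unp1 k f : cf k f -> cf k (fun e => unp1 (f e)).
Proof. by apply: cf_unpair; cft. Qed.

Lemma cf_unp2 k f : cf k f -> cf k (fun e => unp2 (f e)).
Proof. by apply: cf_unpair; cft. Qed.
#[global] Hint Resolve cf_unp1 cf_unp2 : cf.

(** * Undecidability of Diophantine equations over the integers *)

Fixpoint ztrans (var : nat -> zterm) (t : nterm) : zterm :=
  match t with
  | NVar i => var i | NCst c => ZCst (Posz c)
  | NAdd s t => ZAdd (ztrans var s) (ztrans var t)
  | NMul s t => ZMul (ztrans var s) (ztrans var t)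
  end.

Lemma zeval_trans e e' var t : (forall i, zeval e (var i) = Posz (e' i)) ->
  zeval e (ztrans var t) = Posz (neval e' t).
Proof.
move=> E; elim: t => [i|c|s IHs t IHt|s IHs t IHt] //=.
  by rewrite IHs IHt PoszD.
by rewrite IHs IHt PoszM.
Qed.

Definition zsq (j : nat) : zterm := ZMul (ZVar j) (ZVar j).

(* The value of the natural number variable [i < r] is a sum of four squares of
   integer variables, which is no restriction by Lagrange's theorem. *)
Definition zvar4 (r i : nat) : zterm :=
  if i < r then ZAdd (ZAdd (ZAdd (zsq (4 * i + 1)) (zsq (4 * i + 2)))
                          (zsq (4 * i + 3))) (zsq (4 * i + 4))
  else if i == r then ZVar 0 else ZCst 0.

(** The parameter is confined to a first equation, so that the code of the system is an easily
    computed function of [c], as the diagonal argument requires. *)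
Lemma dio_zsystem (X : nat -> Prop) : dio (fun e => X (e 0)) ->
  exists p : zterm * zterm, forall c, X c <-> zsolvable [:: (ZVar 0, ZCst (Posz c)); p].
Proof.
move=> [F FP]; have [r [p [q FE]]] := dsat_normal_form F.
exists (ztrans (zvar4 r) p, ztrans (zvar4 r) q) => c.
have -> : X c <-> exists w, neval (ecat r w (scons c (fun _ => 0))) p =
    neval (ecat r w (scons c (fun _ => 0))) q by rewrite -FE -(FP (scons c _)).
have rest w e i : r <= i -> e 0 = Posz c ->
    zeval e (zvar4 r i) = Posz (ecat r w (scons c (fun _ => 0)) i).
  rewrite leq_eqVlt => /predU1P[<-|lt] E0; rewrite /zvar4 /ecat.
    by rewrite ltnn eqxx subnn.
  by rewrite ltnNge ltnW //= eqn_leq leqNgt lt -(subnSK lt).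
split=> [[w E]|[e [/= E0 [E _]]]].
  have [f Hf] : exists f : nat -> int * int * int * int, forall i, i < r -> Posz (w i) =
      ((f i).1.1.1 ^+ 2 + (f i).1.1.2 ^+ 2 + (f i).1.2 ^+ 2 + (f i).2 ^+ 2)%R.
    apply: (fin_choice (P := fun i (t : int * int * int * int) => Posz (w i) =
      (t.1.1.1 ^+ 2 + t.1.1.2 ^+ 2 + t.1.2 ^+ 2 + t.2 ^+ 2)%R) (0, 0, 0, 0)%R) => i _.
    have [a [b [d [g Ei]]]] := four_squares_nat (w i).
    by exists (a, b, d, g).
  (* Variable [0] holds the parameter, and variables [4 i + 1] to [4 i + 4] hold the four roots for
     the witness [i]. *)
  pose e j := if j is j'.+1 then nth 0%R [:: (f (j' %/ 4)).1.1.1; (f (j' %/ 4)).1.1.2;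
     (f (j' %/ 4)).1.2; (f (j' %/ 4)).2] (j' %% 4) else Posz c.
  have He i : zeval e (zvar4 r i) = Posz (ecat r w (scons c (fun _ => 0)) i).
    have [lt|le] := ltnP i r; last exact: rest.
    have e4 t : t < 4 -> e (4 * i + t.+1) =
        nth 0%R [:: (f i).1.1.1; (f i).1.1.2; (f i).1.2; (f i).2] t.
      move=> lt4; rewrite addnS /e mulnC divnMDl // modnMDl divn_small //.
      by rewrite modn_small // addn0.
    rewrite /zvar4 /ecat lt (Hf i lt) !expr2.
    have <- : e (4 * i + 1) = (f i).1.1.1 := e4 0 isT.
    have <- : e (4 * i + 2) = (f i).1.1.2 := e4 1 isT.
    have <- : e (4 * i + 3) = (f i).1.2 := e4 2 isT.
    have <- : e (4 * i + 4) = (f i).2 := e4 3 isT.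
    by [].
  by exists e; rewrite /= !(zeval_trans _ He) E.
exists (fun i => `|zeval e (zvar4 r i)|%N).
have He i : zeval e (zvar4 r i) = Posz (ecat r (fun i => `|zeval e (zvar4 r i)|%N) (scons c (fun _ => 0)) i).
  have [lt|le] := ltnP i r; last exact: rest.
  rewrite /ecat lt gez0_abs // /zvar4 lt /=.
  by rewrite !addr_ge0 // -expr2 sqr_ge0.
by move: E; rewrite !(zeval_trans _ He) => -[].
Qed.

(* If [p] is an equation expressing that the decider [d] answers [0] on the system
   [x_0 = c, S], where [c] is the code of [S], then [d] errs on [x_0 = c, p], where
   [c] is the code of [p]. *)
Theorem H10_undecidable : ~ exists d : rf, forall S : seq (zterm * zterm),
  (zsolvable S -> reval d [:: code_zsys S] 1) /\ (~ zsolvable S -> reval d [:: code_zsys S] 0).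
Proof.
move=> [d Hd].
(* If [c] codes a system [S], then [delta c] codes the system with [x_0 = c] put in front of [S]:
   [pairn 0 0] is the variable, [c.*2] codes the integer [c], and the tail is [c] itself. *)
pose delta c := (pairn (pairn (pairn 0 0) (pairn 1 c.*2)) c).+1.
have [cd Hcd] : cf 1 (fun e => delta (e 0)).
  by rewrite /delta; apply: cf_S; apply: cf_pairn; [apply: cf_pairn; [|apply: cf_pairn; [|
    apply: (cf_ext (g := fun e => e 0 + e 0)) => [e|]; first by rewrite addnn]] | ]; cft.
have dX : dio (fun e => reval (RComp d [:: cd]) [:: e 0] 0).
  exact: (@dio_reval1 _ 0 _ _ (fun _ _ => 0) (reval_dio (RComp d [:: cd]))
    (dfun_cst 0) (dfun_var 0) (fun=> dfun_cst 0)).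
have [p Hp] := dio_zsystem (X := fun c => reval (RComp d [:: cd]) [:: c] 0) dX.
pose c := code_zsys [:: p]; have := Hp c; set S' := [:: _; p] => HS.
have ES : code_zsys S' = delta c by [].
have cmp y : reval d [:: delta c] y <-> reval (RComp d [:: cd]) [:: c] y.
  have Hc := Hcd (fun _ => c); rewrite reval_comp; split=> [H|[w [Hw]]].
    by exists (fun _ => delta c); split=> // -[|].
  by have <- : w 0 = delta c := reval_fun (Hw 0 isT) Hc.
have ns : ~ zsolvable S'.
  move=> sS; have [H1 _] := Hd S'; have := H1 sS; rewrite ES => h1.
  by have := reval_fun h1 ((cmp 0).2 (HS.2 sS)).
by apply: (ns); apply/HS/cmp; rewrite -ES; have [_] := Hd S'; apply.
Qed.

(** * The group [NilG] *)

Section NilGroupTheory.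
Local Open Scope ring_scope.
Variables (n m : nat) (lam : 'I_m -> 'I_n -> 'I_n -> int).
Local Notation G := (NilG lam).
Local Notation fst g := ((g : Gel n m).1).
Local Notation snd g := ((g : Gel n m).2).

Lemma betaDl x y z : beta lam (x + y) z = beta lam x z + beta lam y z.
Proof.
apply/rowP => t; rewrite !mxE -big_split; apply: eq_bigr => i _.
by rewrite -big_split; apply: eq_bigr => j _; rewrite mxE mulrDr mulrDl.
Qed.

Lemma betaDr x y z : beta lam x (y + z) = beta lam x y + beta lam x z.
Proof.
apply/rowP => t; rewrite !mxE -big_split; apply: eq_bigr => i _.
by rewrite -big_split; apply: eq_bigr => j _; rewrite mxE mulrDr.
Qed.

Lemma betaZl k x y : beta lam (k *: x) y = k *: beta lam x y.
Proof.
apply/rowP => t; rewrite !mxE big_distrr; apply: eq_bigr => i _.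
by rewrite big_distrr; apply: eq_bigr => j _; rewrite mxE /=; ring.
Qed.

Lemma betaZr k x y : beta lam x (k *: y) = k *: beta lam x y.
Proof.
apply/rowP => t; rewrite !mxE big_distrr; apply: eq_bigr => i _.
by rewrite big_distrr; apply: eq_bigr => j _; rewrite mxE /=; ring.
Qed.

Lemma betaNl x y : beta lam (- x) y = - beta lam x y.
Proof. by rewrite -scaleN1r betaZl scaleN1r. Qed.

Lemma betaNr x y : beta lam x (- y) = - beta lam x y.
Proof. by rewrite -scaleN1r betaZr scaleN1r. Qed.

Lemma beta0l x : beta lam 0 x = 0.
Proof. by rewrite -[0](scale0r 0) betaZl !scale0r. Qed.

Lemma beta_delta (i j : 'I_n) t :
  beta lam (delta_mx 0 i) (delta_mx 0 j) 0 t = if (i < j)%N then lam t i j else 0.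
Proof.
rewrite mxE (bigD1 i) //= [X in _ + X]big1 ?addr0 => [|i' ne]; last first.
  by rewrite big1 // => j' _; rewrite !mxE eqxx /= (negbTE ne) mulr0 mul0r.
rewrite big_mkcond (bigD1 j) //= [X in _ + X]big1 ?addr0 => [|j' ne].
  by rewrite !mxE !eqxx !mulr1.
by case: ifP => // _; rewrite !mxE eqxx /= (negbTE ne) mulr0.
Qed.

Lemma beta_delta_same (i : 'I_n) : beta lam (delta_mx 0 i) (delta_mx 0 i) = 0.
Proof. by apply/rowP => t; rewrite beta_delta ltnn mxE. Qed.

Definition om (x y : 'rV[int]_n) : 'rV[int]_m := beta lam x y - beta lam y x.

Lemma omC x y : om x y = - om y x. Proof. by rewrite /om opprB. Qed.
Lemma omxx x : om x x = 0. Proof. exact: subrr. Qed.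

Lemma omDl x y z : om (x + y) z = om x z + om y z.
Proof. by rewrite /om betaDl betaDr opprD addrACA. Qed.

Lemma omDr x y z : om x (y + z) = om x y + om x z.
Proof. by rewrite omC omDl opprD -!omC. Qed.

Lemma omZl k x y : om (k *: x) y = k *: om x y.
Proof. by rewrite /om betaZl betaZr scalerBr. Qed.

Lemma omZr k x y : om x (k *: y) = k *: om x y.
Proof. by rewrite omC omZl -scalerN -omC. Qed.

Lemma om0l x : om 0 x = 0. Proof. by rewrite -[0](scale0r 0) omZl !scale0r. Qed.
Lemma om0r x : om x 0 = 0. Proof. by rewrite omC om0l oppr0. Qed.

Lemma gel_eq (g h : G) : fst g = fst h -> snd g = snd h -> g = h.
Proof. by case: g h => [x z] [y w] /= -> ->. Qed.

Lemma fstM (g h : G) : fst (gmul g h) = fst g + fst h. Proof. by []. Qed.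

Lemma commE (g h : G) : comm g h = (0, om (fst g) (fst h)) :> Gel n m.
Proof.
case: g h => [x z] [y w]; apply: gel_eq; rewrite /comm /= /Gmul /Ginv /=.
  by rewrite -opprD -addrA addNr.
rewrite /om !(betaDl, betaDr, betaNl, betaNr) !opprK.
by apply/rowP => t; rewrite !mxE; ring.
Qed.

Lemma commuteE (g h : G) : gmul g h = gmul h g <-> om (fst g) (fst h) = 0.
Proof.
case: g h => [x z] [y w]; rewrite /= /Gmul /= /om; split=> [[_ E]|E].
  by apply/eqP; rewrite subr_eq0; apply/eqP; move: E; rewrite (addrC w z) => /addrI.
by congr (_, _); [exact: addrC | rewrite (addrC w z); congr (_ + _); apply/eqP; rewrite -subr_eq0 E].
Qed.

Lemma gpown_fst (g : G) k : fst (gpown g k) = k%:Z *: fst g.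
Proof.
elim: k => [|k IH] /=; first by rewrite scale0r.
by rewrite IH intS scalerDl scale1r.
Qed.

Lemma gpow_fst (g : G) t : fst (gpow g t) = t *: fst g.
Proof.
case: t => k; first exact: gpown_fst.
by rewrite /gpow; have := gpown_fst g k.+1; rewrite NegzE scaleNr => <-.
Qed.

Lemma gpow_ctr (z : 'rV[int]_m) t : gpow ((0, z) : G) t = (0, t *: z) :> Gel n m.
Proof.
have H k : gpown ((0, z) : G) k = (0, k%:Z *: z) :> Gel n m.
  elim: k => [|k IH] /=; first by rewrite scale0r.
  by rewrite IH /Gmul /= beta0l !addr0 intS scalerDl scale1r.
case: t => k; first exact: H.
by rewrite /gpow H /= /Ginv /= beta0l addr0 oppr0 NegzE scaleNr.
Qed.

Lemma subgroup_gpow (H : G -> Prop) g t : subgroup H -> H g -> H (gpow g t).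
Proof.
move=> [H1 HM HV] Hg; have Hn k : H (gpown g k) by elim: k => [|k IH] //=; apply: HM.
by case: t => k; [apply: Hn | apply: HV; apply: Hn].
Qed.

Lemma gen_cP (g : G) : gen (fun y => exists t, y = gen_c lam t) g <-> fst g = 0.
Proof.
split=> [Hg|g0].
  apply: (Hg (fun g : G => fst g = 0)); last by move=> y [t ->].
  by split=> // [x y x0 y0|x x0]; rewrite /= ?x0 ?y0 ?addr0 ?oppr0.
move=> H sH Hc; have [H1 HM _] := sH.
have -> : g = (0, \sum_t (snd g) 0 t *: delta_mx 0 t) :> Gel n m.
  apply: gel_eq => //=; exact: row_sum_delta.
elim/big_ind: _ => [//|z w Hz Hw|t _].
  by have := HM _ _ Hz Hw; rewrite /= /Gmul /= beta0l !addr0.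
by rewrite -gpow_ctr; apply: subgroup_gpow => //; apply: Hc; exists t.
Qed.

(* All generators [a_k] have the smallest possible centralizer, expressed in the
   quotient [Z^n] of [G] by the subgroup generated by the [c_t]. *)
Definition small_centralizers : Prop := forall (k : 'I_n) (x : 'rV[int]_n),
  om (delta_mx 0 k) x = 0 -> exists t : int, x = t *: delta_mx 0 k.

Hypothesis sc : small_centralizers.

Lemma scale_delta_inj (k : 'I_n) (s t : int) :
  s *: delta_mx 0 k = t *: delta_mx 0 k :> 'rV[int]_n -> s = t.
Proof. by move=> /rowP/(_ k); rewrite !mxE !eqxx !mulr1. Qed.

Lemma scalev_inj (w : 'rV[int]_m) (s t : int) : w != 0 -> s *: w = t *: w -> s = t.
Proof.
case/rV0Pn => i wi /rowP/(_ i); rewrite !mxE => E.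
exact: (mulIf wi).
Qed.

Lemma om_delta_neq0 (i j : 'I_n) : i != j -> om (delta_mx 0 i) (delta_mx 0 j) != 0.
Proof.
move=> ne; apply/eqP => /sc[t] /rowP/(_ j); rewrite !mxE !eqxx /=.
by rewrite eq_sym (negbTE ne) mulr0.
Qed.

Variables (a b : 'I_n).
Hypothesis ab : a != b.
Local Notation w := (om (delta_mx 0 a) (delta_mx 0 b)).

(** A central element commutes with both [a] and [b], so its image in [Z^n] is a multiple of two
    distinct basis vectors. *)
Lemma centralE (g : G) : central g <-> fst g = 0.
Proof.
split=> [cg|g0 h]; last by apply/commuteE; rewrite g0 om0l.
have [s Es] : exists s, fst g = s *: delta_mx 0 a.
  by apply: sc; rewrite omC; apply/eqP; rewrite oppr_eq0; apply/eqP/(commuteE g (gen_a lam a)).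
have [t Et] : exists t, fst g = t *: delta_mx 0 b.
  by apply: sc; rewrite omC; apply/eqP; rewrite oppr_eq0; apply/eqP/(commuteE g (gen_a lam b)).
rewrite Es; move: Es; rewrite Et => /rowP/(_ a); rewrite !mxE !eqxx /= (negbTE ab).
by rewrite mulr0 mulr1 => <-; rewrite scale0r.
Qed.

Lemma c_small_gen (k : 'I_n) : c_small (gen_a lam k).
Proof.
move=> h; rewrite commuteE; split=> [|[t [z [cz ->]]]].
  rewrite omC => /eqP; rewrite oppr_eq0 => /eqP/sc[t Et].
  exists t, (gmul (ginv (gpow (gen_a lam k) t)) h); split.
    by apply/centralE; rewrite /= gpow_fst /= Et addNr.
  case: h {Et} => x z; case: (gpow _ t) => y u.
  apply: gel_eq => /=; first by rewrite addrA subrr add0r.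
  by rewrite !(betaDr, betaNl, betaNr); apply/rowP => i; rewrite !mxE; ring.
by move/centralE: cz => z0; rewrite /= gpow_fst z0 addr0 omZl omxx scaler0.
Qed.

End NilGroupTheory.

(** * Definability of the integers, indecomposability and scalars under small centralizers *)

Section NilGroupProperties.
Local Open Scope ring_scope.
Variables (n m : nat) (lam : 'I_m -> 'I_n -> 'I_n -> int).
Local Notation G := (NilG lam).
Local Notation fst g := ((g : Gel n m).1).
Local Notation snd g := ((g : Gel n m).2).
Local Notation om := (om lam).
Hypothesis sc : small_centralizers lam.
Variables (a b : 'I_n).
Hypothesis ab : a != b.
Let w := om (delta_mx 0 a) (delta_mx 0 b).

Definition tcomm (s t : gterm G) : gterm G := GMul (GMul (GMul (GInv s) (GInv t)) s) t.

Let w_neq0 : w != 0. Proof. exact: om_delta_neq0. Qed.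

Lemma comm_gen_gone (g : G) (k : 'I_n) : comm g (gen_a lam k) = gone G ->
  exists t, fst g = t *: delta_mx 0 k.
Proof.
rewrite commE => -[]; rewrite omC => /eqP; rewrite oppr_eq0 => /eqP; exact: sc.
Qed.

Lemma comm_pow (g h : G) s t : fst g = s *: delta_mx 0 a -> fst h = t *: delta_mx 0 b ->
  comm g h = (0, (s * t) *: w) :> Gel n m.
Proof. by move=> Eg Eh; rewrite commE Eg Eh omZl omZr scalerA. Qed.

Lemma comm_pow_gen (g : G) s : fst g = s *: delta_mx 0 a ->
  comm g (gen_a lam b) = (0, s *: w) :> Gel n m.
Proof. by move=> Eg; rewrite (@comm_pow _ _ s 1) ?mulr1 ?scale1r. Qed.

Lemma comm_gen_pow (g : G) s : fst g = s *: delta_mx 0 b ->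
  comm (gen_a lam a) g = (0, s *: w) :> Gel n m.
Proof. by move=> Eg; rewrite (@comm_pow _ _ 1 s) ?mul1r ?scale1r. Qed.

Lemma comm_self (g : G) (k : 'I_n) s : fst g = s *: delta_mx 0 k ->
  comm g (gen_a lam k) = gone G.
Proof. by move=> Eg; rewrite commE Eg omZl omxx scaler0. Qed.

Lemma Z_edefinable_NilG : Z_edefinable G.
Proof.
pose cA : gterm G := GCst (gen_a lam a : G); pose cB : gterm G := GCst (gen_a lam b : G).
pose X i : gterm G := GVar _ i; pose one : gterm G := GCst (gone G).
pose phi (x : int) (_ : nat) : G := (0, x *: w).
pose pa (x : int) : G := (x *: delta_mx 0 a, 0); pose pb (x : int) : G := (x *: delta_mx 0 b, 0).
have phi0 (c : nat -> G) x : (forall i, (i < 1)%N -> c i = phi x i) <-> c 0%N = phi x 0%N.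
  by split=> [->//|E [|]].
have phi3 (c : nat -> G) x y z : (forall i, (i < 1)%N ->
     [/\ c i = phi x i, c (1 + i)%N = phi y i & c (2 * 1 + i)%N = phi z i]) <->
   [/\ c 0%N = phi x 0%N, c 1%N = phi y 0%N & c 2%N = phi z 0%N].
  by split=> [/(_ 0%N isT)|H [|]].
have phiM x y : gmul (phi x 0%N) (phi y 0%N) = phi (x + y) 0%N.
  by rewrite /phi /= /Gmul /= beta0l !addr0 scalerDl.
exists 1%N, phi; split.
  by move=> x y /(_ 0%N isT)[]; apply: scalev_inj.
split.
- exists [:: (tcomm (X 1%N) cA, one); (X 0%N, tcomm (X 1%N) cB)] => c; split.
    move=> [x /phi0 Ex]; exists (fun _ => pa x).
    split; first exact: (@comm_self (pa x) a x).
    by split=> //; rewrite /= Ex; apply/esym/(@comm_pow_gen (pa x)).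
  move=> [y [/comm_gen_gone[t Et] [E _]]].
  by exists t; apply/phi0; rewrite /phi -(comm_pow_gen Et); apply: E.
- exists [:: (tcomm (X 3%N) cA, one); (X 0%N, tcomm (X 3%N) cB);
             (tcomm (X 4%N) cA, one); (X 1%N, tcomm (X 4%N) cB); (X 2%N, GMul (X 0%N) (X 1%N))] => c; split.
    move=> [x [y /phi3[E0 E1 E2]]]; exists (fun i => if i == 3%N then pa x else pa y).
    split; first exact: (@comm_self (pa x) a x).
    split; first by rewrite /= E0; apply/esym/(@comm_pow_gen (pa x)).
    split; first exact: (@comm_self (pa y) a y).
    split; first by rewrite /= E1; apply/esym/(@comm_pow_gen (pa y)).
    by split=> //; rewrite /= E0 E1 E2 -phiM.
  move=> [y] [/comm_gen_gone[s Es] [E0 [/comm_gen_gone[t Et] [E1 [E2 _]]]]].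
  have F0 : c 0%N = phi s 0%N by rewrite /phi -(comm_pow_gen Es); apply: E0.
  have F1 : c 1%N = phi t 0%N by rewrite /phi -(comm_pow_gen Et); apply: E1.
  by exists s, t; apply/phi3; split=> //; rewrite -phiM -F0 -F1; apply: E2.
- exists [:: (tcomm (X 3%N) cA, one); (X 0%N, tcomm (X 3%N) cB);
             (tcomm (X 4%N) cB, one); (X 1%N, tcomm cA (X 4%N)); (X 2%N, tcomm (X 3%N) (X 4%N))] => c; split.
    move=> [x [y /phi3[E0 E1 E2]]]; exists (fun i => if i == 3%N then pa x else pb y).
    split; first exact: (@comm_self (pa x) a x).
    split; first by rewrite /= E0; apply/esym/(@comm_pow_gen (pa x)).
    split; first exact: (@comm_self (pb y) b y).
    split; first by rewrite /= E1; apply/esym/(@comm_gen_pow (pb y)).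
    by split=> //; rewrite /= E2; apply/esym/(@comm_pow (pa x) (pb y)).
  move=> [y] [/comm_gen_gone[s Es] [E0 [/comm_gen_gone[t Et] [E1 [E2 _]]]]].
  exists s, t; apply/phi3; split; rewrite /phi.
  - by rewrite /phi -(comm_pow_gen Es); apply: E0.
  - by rewrite -(comm_gen_pow Et); apply: E1.
  by rewrite -(comm_pow Es Et); apply: E2.
- exists [:: (X 0%N, GCst (phi 0 0%N))] => c; rewrite phi0.
  by split=> [E|[y []]] //; exists (fun _ => gone G).
exists [:: (X 0%N, GCst (phi 1 0%N))] => c; rewrite phi0.
by split=> [E|[y []]] //; exists (fun _ => gone G).
Qed.

(* If [a = h k] with [h] and [k] in the two factors, both commute with [a], so they
   are powers of [a] modulo the center, and one of the exponents is nonzero; the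
   opposite factor then lies in the centralizer of [a], which is abelian. *)
Lemma not_nonabelian_direct_decomp : ~ nonabelian_direct_decomp G.
Proof.
move=> [H [K [sH [sK [HK [_ [gen [nH nK]]]]]]]].
have [h [k [Hh Kk E]]] := gen (gen_a lam a : G).
have ha : gmul (gen_a lam a : G) h = gmul h (gen_a lam a : G).
  apply/commuteE; have /commuteE Z := HK _ _ Hh Kk.
  by rewrite E fstM omDl omxx add0r omC Z oppr0.
have [t Et] : exists t, fst h = t *: delta_mx 0 a by exact: sc ((commuteE (gen_a lam a : G) h).1 ha).
have Ek : fst k = (1 - t) *: delta_mx 0 a.
  have Es : delta_mx 0 a = fst h + fst k := congr1 (fun g : Gel n m => g.1) E.
  by rewrite scalerBl scale1r {1}Es Et addrAC subrr add0r.
have abel (P : G -> Prop) (g : G) (s : int) : s != 0 -> fst g = s *: delta_mx 0 a ->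
    (forall x, P x -> gmul g x = gmul x g) -> abelian P.
  move=> s0 Eg cg; have cP x : P x -> exists u, fst x = u *: delta_mx 0 a.
    move=> Px; apply: sc; apply/eqP; have /commuteE := cg x Px.
    by rewrite Eg omZl => /eqP; rewrite scalemx_eq0 (negbTE s0).
  move=> x y /cP[u Eu] /cP[v Ev]; apply/commuteE.
  by rewrite Eu Ev omZl omZr omxx !scaler0.
have [t0|t0] := eqVneq t 0.
  apply: nH; apply: (abel H k (1 - t)) => // [|x Hx]; first by rewrite t0.
  by apply/esym/HK.
by apply: nK; apply: (abel K h t) => // x Kx; apply: HK.
Qed.

Lemma modZE (x y : G) : modZ x y <-> fst x = fst y.
Proof.
split=> [[z [/(centralE sc ab) z0 ->]]|E]; first by rewrite fstM z0 addr0.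
exists (gmul (ginv y) x); split; first by apply/(centralE sc ab); rewrite /= E addNr.
case: x y E => [x z] [y u] /= ->; apply: (@gel_eq _ _ lam) => /=; first by rewrite addNr addr0.
by rewrite !(betaDr, betaNl, betaNr); apply/rowP => i; rewrite !mxE; ring.
Qed.

Lemma derived_fst (g : G) : derived g -> fst g = 0.
Proof.
move=> Dg; apply: (Dg (fun g : G => fst g = 0)) => [|y [u [v ->]]]; last by rewrite commE.
by split=> // [x y x0 y0|x x0]; rewrite /= ?x0 ?y0 ?addr0 ?oppr0.
Qed.

Lemma derived_subgroup : subgroup (@derived G).
Proof.
split=> [H sH _|x y Dx Dy H sH HS|x Dx H sH HS]; have [H1 HM HV] := sH => //.
  by apply: HM; [apply: Dx | apply: Dy].
by apply: HV; apply: Dx.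
Qed.

Lemma derived_comm (g h : G) : derived (comm g h).
Proof. by move=> H _ HS; apply: HS; exists g, h. Qed.

Lemma gpow_derived (g : G) k : derived g -> gpow g k = (0, k *: snd g) :> Gel n m.
Proof. by move=> /derived_fst; case: g => [x z] /= ->; apply: gpow_ctr. Qed.

Lemma derived_eq (g : G) : derived g -> g = (0, snd g) :> Gel n m.
Proof. by move=> /derived_fst; case: g => [x z] /= ->. Qed.

Lemma Z_ring_of_scalars :
  @ring_of_scalars G int (fun k x => gpow x k) (fun k x => gpow x k).
Proof.
split; last first.
- by move=> k x y; rewrite (gpow_derived _ (derived_comm x y)) !commE !gpow_fst omZl omZr.
- split=> [k x|]; first exact: subgroup_gpow derived_subgroup.
  split=> [k x y Dx Dy|k l x Dx|k l x Dx|x Dx|k l E].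
  + have [_ HM _] := derived_subgroup; rewrite !gpow_derived //; last exact: HM.
    rewrite [x]derived_eq // [y]derived_eq // /= /Gmul /= beta0l !addr0.
    by rewrite scalerDr.
  + by rewrite !gpow_derived // /= /Gmul /= beta0l !addr0 scalerDl.
  + rewrite [gpow x l]gpow_derived // gpow_ctr gpow_derived //.
    by rewrite scalerA.
  + by rewrite gpow_derived // scale1r -derived_eq.
  have := E _ (derived_comm (gen_a lam a : G) (gen_a lam b : G)).
  rewrite !gpow_derived; try exact: derived_comm.
  by rewrite commE /= => -[]; apply: scalev_inj.
split=> [k x y|]; first by rewrite !modZE !gpow_fst => ->.
split=> [k x y|k l x|k l x|x|k l E].
- by rewrite modZE !fstM !gpow_fst !fstM scalerDr.
- by rewrite modZE !fstM !gpow_fst scalerDl.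
- by rewrite modZE !gpow_fst scalerA.
- by rewrite modZE gpow_fst scale1r.
have := E (gen_a lam a : G); rewrite modZE !gpow_fst /=.
exact: scale_delta_inj.
Qed.

(** A scalar acts on [Z^n] by an additive map [f] that is self-adjoint for the alternating form
    [om]. Hence [2 om (e_i, f e_i) = 0], so [f e_i = t_i e_i] by the smallness of centralizers;
    comparing [om (f e_i, e_j)] with [om (e_i, f e_j)] gives [t_i = t_j]. *)
Lemma ring_of_scalars_in_Z (R : comNzRingType) (rho nu : R -> G -> G) :
  ring_of_scalars rho nu -> forall r, exists k : int, forall x, modZ (rho r x) (gpow x k).
Proof.
move=> [[rmod [rM _ _ _ _]] _ rsym] r.
pose f (x : 'rV[int]_n) : 'rV[int]_n := fst (rho r ((x, 0) : G)).
have fE (g : G) : fst (rho r g) = f (fst g).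
  by apply/modZE/rmod/modZE.
have fD x y : f (x + y) = f x + f y.
  have /modZE := rM r ((x, 0) : G) ((y, 0) : G).
  by rewrite fstM !fE fstM.
have fom x y : om (f x) y = om x (f y).
  have [E1 E2] := rsym r ((x, 0) : G) ((y, 0) : G).
  by have := etrans E1 (esym E2); rewrite !commE !fE /= => -[].
have [t Ht] : exists t : 'I_n -> int, forall i, f (delta_mx 0 i) = t i *: delta_mx 0 i.
  have H i : exists t, f (delta_mx 0 i) == t *: delta_mx 0 i.
    suff /sc[t ->] : om (delta_mx 0 i) (f (delta_mx 0 i)) = 0 by exists t.
    have := fom (delta_mx 0 i) (delta_mx 0 i); rewrite omC => /eqP.
    rewrite eq_sym -addr_eq0 -mulr2n -scaler_nat scalemx_eq0 => /orP[//|/eqP->//].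
  by exists (fun i => xchoose (H i)) => i; apply/eqP/(xchooseP (H i)).
have tE i j : t i = t j.
  have [->//|ne] := eqVneq i j.
  apply: (scalev_inj (om_delta_neq0 sc ne)).
  by rewrite -omZl -omZr -!Ht fom.
exists (t a) => g; apply/modZE; rewrite fE gpow_fst.
have f0 : f 0 = 0 by apply: (addrI (f 0)); rewrite -fD !addr0.
have fN x : f (- x) = - f x by apply: (addrI (f x)); rewrite -fD !subrr.
have fZ k x : f (k *: x) = k *: f x.
  have fn (i : nat) : f (i%:Z *: x) = i%:Z *: f x.
    elim: i => [|i IH]; first by rewrite !scale0r.
    by rewrite intS !scalerDl !scale1r fD IH.
  by case: k => i; rewrite ?NegzE ?scaleNr ?fN fn.
rewrite {1}(row_sum_delta (fst g)) (big_morph f fD f0) [in RHS](row_sum_delta (fst g)).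
rewrite scaler_sumr; apply: eq_bigr => i _.
by rewrite fZ Ht (tE i a) !scalerA mulrC.
Qed.

Lemma max_ring_of_scalars_NilG : max_ring_of_scalars_is_Z G.
Proof. by split; [exact: Z_ring_of_scalars | exact: ring_of_scalars_in_Z]. Qed.

End NilGroupProperties.

(** * Reduction of integer equations to equations in [NilG] *)

Definition dec_int (r : nat) : int := if odd r then Negz r./2 else Posz r./2.

Lemma dec_intK r : code_int (dec_int r) = r.
Proof.
by rewrite /dec_int /code_int; have := odd_double_half r; case: (odd r) => /=; lia.
Qed.

Lemma code_intK c : dec_int (code_int c) = c.
Proof.
case: c => k; rewrite /dec_int /code_int /=; first by rewrite odd_double doubleK.
by rewrite odd_double /= uphalf_double.
Qed.

(* The recursion is well founded: the components of a code with tag 2 or 3 are smaller. *)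
Lemma zcode_rec (val : nat -> int) : exists v : nat -> int, forall u,
  v u = match unp1 u with
        | 0 => val (unp2 u) | 1 => dec_int (unp2 u)
        | 2 => (v (unp1 (unp2 u)) + v (unp2 (unp2 u)))%R
        | 3 => (v (unp1 (unp2 u)) * v (unp2 (unp2 u)))%R
        | _ => 0%R end.
Proof.
pose step (v : nat -> int) u := match unp1 u with
        | 0 => val (unp2 u) | 1 => dec_int (unp2 u)
        | 2 => (v (unp1 (unp2 u)) + v (unp2 (unp2 u)))%R
        | 3 => (v (unp1 (unp2 u)) * v (unp2 (unp2 u)))%R
        | _ => 0%R end.
(* Starting from the zero function, the [k]-th iterate already has its final values below [k]. *)
pose it k := iter k step (fun _ => 0%R).
have lt_arg u : 0 < unp1 u -> unp1 (unp2 u) < u /\ unp2 (unp2 u) < u.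
  move=> h; have lt : unp2 u < u by rewrite [X in _ < X]pairn_surj pairn_gt.
  have [h1 h2] := pairn_ge (unp1 (unp2 u)) (unp2 (unp2 u)); rewrite -pairn_surj in h1 h2.
  by split; apply: leq_ltn_trans lt.
have stab k u : u < k -> it k u = it u.+1 u.
  elim/ltn_ind: u k => u IH [//|k]; rewrite ltnS => lek.
  rewrite /it /= -/(it k) -/(it u) /step.
  case E : (unp1 u) => [|[|[|[|//]]]] //;
    by have [h1 h2] : _ /\ _ := lt_arg u ltac:(by rewrite E);
       rewrite !(IH _ _ k) ?(IH _ _ u) // (leq_trans _ lek).
exists (fun u => it u.+1 u) => u.
rewrite [LHS]/(step (it u) u) /step.
by case E : (unp1 u) => [|[|[|[|//]]]] //; have [h1 h2] := lt_arg u ltac:(by rewrite E);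
  rewrite !(stab u).
Qed.

Section Reduction.
Variables (n m : nat) (lam : 'I_m -> 'I_n.+2 -> 'I_n.+2 -> int).
Local Notation G := (NilG lam).
Local Notation fst g := ((g : Gel n.+2 m).1).
Hypothesis sc : small_centralizers lam.
Let a : 'I_n.+2 := ord0.
Let b : 'I_n.+2 := ord_max.
Let ab : a != b. Proof. by []. Qed.
Let w := om lam (delta_mx 0%R a) (delta_mx 0%R b).
Let w_neq0 : (w != 0)%R. Proof. exact: om_delta_neq0. Qed.

Definition powa (c : int) : G := (c *: delta_mx 0 a, 0)%R.
Definition powb (c : int) : G := (c *: delta_mx 0 b, 0)%R.
Let cA : gterm G := GCst (gen_a lam a : G).
Let cB : gterm G := GCst (gen_a lam b : G).

(* In a solution the variables [2 u] and [2 u + 1] hold, modulo the center, the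
   powers of [a] and of [b] whose exponent is the value of the term coded by [u].
   Defining equations are emitted for every number below the code of the system,
   so that no recursion on the structure of terms has to be programmed. *)
Definition vx (u : nat) : gterm G := GVar G u.*2.
Definition vy (u : nat) : gterm G := GVar G u.*2.+1.

(** Variables (tag [0]) are unconstrained and tags above [3] code no term: both get a trivial
    equation. A product is expressed by [[a^(x y), b] = [a^x, b^y]]. *)
Definition value_eq (u : nat) : gterm G * gterm G :=
  match unp1 u with
  | 1 => (vx u, GCst (powa (dec_int (unp2 u))))
  | 2 => (vx u, GMul (vx (unp1 (unp2 u))) (vx (unp2 (unp2 u))))
  | 3 => (tcomm (vx u) cB, tcomm (vx (unp1 (unp2 u))) (vy (unp2 (unp2 u))))
  | _ => (vx u, vx u)
  end.

(** The third equation makes the two exponents equal: [[a^x, b] = [a, b^y]] forces [x = y], as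
    [[a, b]] has infinite order. *)
Definition code_eqs (u : nat) : seq (gterm G * gterm G) :=
  [:: (tcomm (vx u) cA, GCst (gone G)); (tcomm (vy u) cB, GCst (gone G));
      (tcomm (vx u) cB, tcomm cA (vy u)); value_eq u].

Definition def_eqs (N : nat) : seq (gterm G * gterm G) :=
  iteri N (fun u acc => code_eqs u ++ acc) [::].

Definition main_eq (p : zterm * zterm) : gterm G * gterm G :=
  (vx (code_zterm p.1), vx (code_zterm p.2)).

(** The reversed concatenation is what a loop produces when it removes equations from one list and
    pushes their images onto another. *)
Definition red_sys (S : seq (zterm * zterm)) : seq (gterm G * gterm G) :=
  catrev [seq main_eq p | p <- S] (def_eqs (code_zsys S)).

Lemma gsat_cat e (S T : seq (gterm G * gterm G)) : gsat e (S ++ T) <-> gsat e S /\ gsat e T.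
Proof.
elim: S => [|p S IH] /=; first by split=> [|[]].
by rewrite IH; split=> [[? []]|[[]]].
Qed.

Lemma gsat_def_eqs e N : gsat e (def_eqs N) <-> forall u, u < N -> gsat e (code_eqs u).
Proof.
elim: N => [|N IH] //.
rewrite (_ : def_eqs N.+1 = code_eqs N ++ def_eqs N) // gsat_cat IH.
split=> [[H1 H2] u|H]; first by rewrite ltnS leq_eqVlt => /predU1P[->|/H2].
by split=> [|u lt]; apply: H => //; apply: ltnW.
Qed.

Lemma gsat_red_sys e S : gsat e (red_sys S) <->
  (forall u, u < code_zsys S -> gsat e (code_eqs u)) /\ gsat e [seq main_eq p | p <- S].
Proof.
rewrite /red_sys -gsat_def_eqs; move: (def_eqs _).
elim: S => [|p S IH] T /=; first by split=> [|[]].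
by rewrite IH /=; split=> [[[]]|[? []]].
Qed.

Lemma code_zsys_gt (p : zterm * zterm) S :
  [/\ code_zterm p.1 < code_zsys (p :: S), code_zterm p.2 < code_zsys (p :: S)
    & code_zsys S < code_zsys (p :: S)].
Proof.
rewrite /code_zsys /=; set c := code_list _.
have [h1 h2] := pairn_ge (pairn (code_zterm p.1) (code_zterm p.2)) c.
have [h3 h4] := pairn_ge (code_zterm p.1) (code_zterm p.2).
by rewrite !ltnS; split=> //; apply: leq_trans h1.
Qed.

Lemma zsolvable_of_red S : gsolvable (red_sys S) -> zsolvable S.
Proof.
move=> [e /gsat_red_sys[Hdef Hmain]].
pose val u : int := fst (e u.*2) ord0 a.
have geqs u : u < code_zsys S -> [/\ fst (e u.*2) = (val u *: delta_mx 0 a)%R,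
    fst (e u.*2.+1) = (val u *: delta_mx 0 b)%R
  & geval e (value_eq u).1 = geval e (value_eq u).2].
  move=> /Hdef[E1 [E2 [E3 [E4 _]]]].
  have [s Es] := comm_gen_gone sc E1; have [t Et] := comm_gen_gone sc E2.
  have Ev : val u = s by rewrite /val Es !mxE !eqxx mulr1.
  have st : s = t.
    apply: (scalev_inj w_neq0).
    have := etrans (esym (comm_pow_gen b Es)) (etrans E3 (comm_gen_pow a Et)).
    by case.
  by rewrite Ev Es Et st.
exists (fun i => val (pairn 0 i)).
have Hval t : code_zterm t < code_zsys S -> zeval (fun i => val (pairn 0 i)) t = val (code_zterm t).
  elim: t => [i|c|s IHs t IHt|s IHs t IHt] lt //=.
  - have [_ _] := geqs _ lt; rewrite /value_eq /= unp1K unp2K code_intK => E.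
    by rewrite /val; move: E => /= ->; rewrite !mxE !eqxx mulr1.
  - have [lts ltt] : code_zterm s < code_zsys S /\ code_zterm t < code_zsys S.
      have [h1 h2] := pairn_ge (code_zterm s) (code_zterm t).
      have h3 := @pairn_gt 2 (pairn (code_zterm s) (code_zterm t)) isT.
      by split; apply: leq_ltn_trans (ltn_trans h3 lt).
    have [_ _] := geqs _ lt; rewrite /value_eq /= unp1K unp2K unp1K unp2K => E.
    rewrite IHs // IHt // /val; move: E => /= ->.
    by rewrite fstM mxE.
  have [lts ltt] : code_zterm s < code_zsys S /\ code_zterm t < code_zsys S.
    have [h1 h2] := pairn_ge (code_zterm s) (code_zterm t).
    have h3 := @pairn_gt 3 (pairn (code_zterm s) (code_zterm t)) isT.
    by split; apply: leq_ltn_trans (ltn_trans h3 lt).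
  have [E1 _] := geqs _ lt; rewrite /value_eq /= unp1K unp2K unp1K unp2K => E.
  have [Es _ _] := geqs _ lts; have [_ Et _] := geqs _ ltt.
  rewrite IHs // IHt //; apply: (scalev_inj w_neq0).
  by have := etrans (esym (comm_pow Es Et)) (etrans (esym E) (comm_pow_gen b E1)); case.
clear Hdef geqs; elim: S Hmain Hval => [|p S IH] //= [Ep Hmain] Hval.
have [h1 h2 h3] := code_zsys_gt p S; split; first by rewrite !Hval // /val Ep.
by apply: IH => // t lt; apply: Hval; apply: ltn_trans h3.
Qed.

(** Equations exist for all numbers below the code, so values are also needed at numbers that code
    no term; [zcode_rec] supplies them by reading every number as a tagged pair. *)
Lemma red_of_zsolvable S : zsolvable S -> gsolvable (red_sys S).
Proof.
move=> [z Hz]; have [v Hv] := zcode_rec z.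
pose e i : G := if odd i then powb (v i./2) else powa (v i./2).
have ex u : e u.*2 = powa (v u) by rewrite /e odd_double doubleK.
have ey u : e u.*2.+1 = powb (v u) by rewrite /e /= odd_double /= uphalf_double.
have Hval t : v (code_zterm t) = zeval z t.
  elim: t => [i|c|s IHs t IHt|s IHs t IHt] /=; rewrite Hv unp1K unp2K ?code_intK //.
    by rewrite unp1K unp2K IHs IHt.
  by rewrite unp1K unp2K IHs IHt.
exists e; apply/gsat_red_sys; split; last first.
  elim: S Hz => [|p S IH] //= [Ep Hz]; split; last exact: IH.
  by rewrite !ex !Hval Ep.
move=> u _; split; first by rewrite /= ex; apply: (comm_self (s := v u)).
split; first by rewrite /= ey; apply: (comm_self (s := v u)).
split; first by rewrite /= ex ey; apply: etrans (esym _); [apply: (@comm_pow_gen _ _ _ a b _ (v u)) | apply: (@comm_gen_pow _ _ _ a b _ (v u))].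
split=> //; rewrite /value_eq.
case E : (unp1 u) => [|[|[|[|k]]]] //=; rewrite !ex ?ey Hv E //.
  rewrite /powa /= /Gmul /= betaZl betaZr beta_delta_same !scaler0 !addr0.
  by rewrite scalerDl.
apply: etrans (esym _); first by apply: (@comm_pow_gen _ _ _ a b _ _).
by apply: (@comm_pow _ _ _ a b _ _).
Qed.

Local Notation enc := (@enc_G n.+2 m lam).

(** Taking [a] to be the generator of index [0] puts its exponent at the head of the encoded list,
    and the rest of the code is a constant. *)
Lemma enc_powa_rest : exists K, forall r, enc (powa (dec_int r)) = (pairn r K).+1.
Proof.
exists (code_list ([seq 0 | i <- enum 'I_n.+1] ++ [seq 0 | t <- enum 'I_m])) => r.
rewrite /enc_G enum_ordSl /= !mxE !eqxx mulr1 dec_intK -map_comp.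
congr (pairn _ (code_list (_ ++ _))).+1; apply: eq_map => i /=; rewrite !mxE //.
by rewrite eqxx /= mulr0.
Qed.

Lemma cf_double k f : cf k f -> cf k (fun e => (f e).*2).
Proof. by move=> Hf; apply: (cf_ext (g := fun e => f e + f e)) => [e|]; [rewrite addnn | cft]. Qed.
Hint Resolve cf_double : cf.

Definition value_code (K u : nat) : nat :=
  let x := pairn 0 u.*2 in
  if unp1 u == 1 then pairn x (pairn 1 (pairn (unp2 u) K).+1) else
  let p := unp1 (unp2 u) in let q := unp2 (unp2 u) in
  if unp1 u == 2 then pairn x (pairn 2 (pairn (pairn 0 p.*2) (pairn 0 q.*2))) else
  if unp1 u == 3 then pairn (code_gterm enc (tcomm (vx u) cB)) (code_gterm enc (tcomm (vx p) (vy q)))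
  else pairn x x.

Lemma cf_code_def : cf 1 (fun e => code_gsys enc (def_eqs (e 0))).
Proof.
have [K HK] := enc_powa_rest.
have HV k f : cf k f -> cf k (fun e => value_code K (f e)).
  apply: cf1; rewrite /value_code; apply: cf_ifeq; [by cft | by cft | by cft |].
  apply: cf_ifeq; [by cft | by cft | by cft |].
  apply: cf_ifeq; [by cft | by cft | | by cft].
  by apply: cf_pairn; rewrite /=; cft.
have EV u : pairn (code_gterm enc (value_eq u).1) (code_gterm enc (value_eq u).2) = value_code K u.
  by rewrite /value_eq /value_code; case: (unp1 u) => [|[|[|[|k]]]] //=; rewrite HK.
pose row l r acc := (pairn (pairn (code_gterm enc l) (code_gterm enc r)) acc).+1.
pose step u acc := row (tcomm (vx u) cA) (GCst (gone G)) (row (tcomm (vy u) cB) (GCst (gone G))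
  (row (tcomm (vx u) cB) (tcomm cA (vy u)) (pairn (value_code K u) acc).+1)).
apply: (cf_ext (g := fun e => iteri (e 0) step 0)) => [e|].
  elim: (e 0) => [|N IH] //.
  rewrite (_ : def_eqs N.+1 = code_eqs N ++ def_eqs N) //.
  rewrite (_ : iteri N.+1 step 0 = step N (iteri N step 0)) // -IH /step.
  by rewrite -EV.
apply: (cf_iteri (g := fun u acc _ => step u acc)); [by cft | | by cft].
by rewrite /step /row /=; cft.
Qed.

(** A state pairs the code of the equations still to be translated with the code of the output. The
    state is fixed once the first component is [0], so the number of rounds may be any bound on the
    length, such as the code of the system. *)
Definition main_step (st : nat) : nat :=
  if unp1 st == 0 then st else
  let p := unp1 (unp1 st).-1 in
  pairn (unp2 (unp1 st).-1)
        (pairn (pairn (pairn 0 (unp1 p).*2) (pairn 0 (unp2 p).*2)) (unp2 st)).+1.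

Lemma main_stepP S T N : size S <= N ->
  iter N main_step (pairn (code_zsys S) (code_gsys enc T)) =
  pairn 0 (code_gsys enc (catrev [seq main_eq p | p <- S] T)).
Proof.
elim: S T N => [|p S IH] T N.
  by move=> _; elim: N => //= N ->; rewrite /main_step unp1K.
case: N => // N leN; rewrite iterSr.
have -> : main_step (pairn (code_zsys (p :: S)) (code_gsys enc T)) =
    pairn (code_zsys S) (code_gsys enc (main_eq p :: T)); last exact: IH.
by rewrite /main_step unp1K /= !unp1K !unp2K.
Qed.

Lemma size_le_code_zsys S : size S <= code_zsys S.
Proof. by elim: S => //= p S /leq_ltn_trans; apply; have [] := code_zsys_gt p S. Qed.

Lemma DZ_reducible_NilG : DZ_reducible_to enc.
Proof.
have Hstep : cf 1 (fun e => main_step (e 0)).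
  by rewrite /main_step; cft.
have [c Hc] : cf 1 (fun e => unp2 (iteri (e 0) (fun _ r => main_step r)
    (pairn (e 0) (code_gsys enc (def_eqs (e 0)))))).
  apply: cf_unp2; apply: (cf_iteri (g := fun _ r _ => main_step r)); [| | by cft].
    by apply: cf_pairn; [cft | exact: cf_code_def].
  by apply: (cf1 Hstep); cft.
exists c => S; exists (red_sys S); split; last first.
  by split; [exact: red_of_zsolvable | exact: zsolvable_of_red].
have := Hc (fun _ => code_zsys S); congr (reval _ _ _).
have iterE N x : iteri N (fun _ r => main_step r) x = iter N main_step x by elim: N => //= N ->.
by rewrite iterE main_stepP ?size_le_code_zsys // unp2K.
Qed.

Lemma D_undecidable_NilG : ~ D_decidable enc.
Proof.
move=> [d Hd]; have [c Hc] := DZ_reducible_NilG.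
apply: H10_undecidable; exists (RComp d [:: c]) => S.
have [S' [HS' ES]] := Hc S; have [H1 H0] := Hd S'.
have step y : reval d [:: code_gsys enc S'] y -> reval (RComp d [:: c]) [:: code_zsys S] y.
  by move=> H; apply/reval_comp; exists (fun _ => code_gsys enc S'); split=> // -[|].
by split=> [/ES/H1/step|nS] //; apply/step/H0 => /ES.
Qed.

End Reduction.

(** * Random centralizers *)

(** Overwriting the coordinate [x0] by an arbitrary value is injective on pairs of an element of [B]
    and a value. *)
Lemma card_fiber_le1 (T : finType) (q : nat) (B : {set {ffun T -> 'I_q}}) (x0 : T) :
  (forall s s', s \in B -> s' \in B -> (forall x, x != x0 -> s x = s' x) -> s x0 = s' x0) ->
  #|B| * q <= #|{ffun T -> 'I_q}|.
Proof.
move=> H; pose f (u : {ffun T -> 'I_q} * 'I_q) : {ffun T -> 'I_q} :=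
  [ffun x => if x == x0 then u.2 else u.1 x].
have f_inj : {in setX B [set: 'I_q] &, injective f}.
  move=> [s v] [s' v'] /setXP[/= sB _] /setXP[/= sB' _] /ffunP E.
  have Es x : x != x0 -> s x = s' x by move=> ne; have := E x; rewrite !ffunE (negbTE ne).
  have -> : s = s'.
    by apply/ffunP => x; have [->|/Es//] := eqVneq x x0; apply: H.
  by have := E x0; rewrite !ffunE eqxx /= => ->.
have := max_card [in f @: setX B [set: 'I_q]].
by rewrite card_in_imset // cardsX cardsT card_ord.
Qed.

Section RandomMinors.
Local Open Scope ring_scope.
Variables (n m l : nat).
Implicit Types (s : Sample n.+2 m.+1 l) (k : 'I_n.+2) (j : 'I_n.+1).

Lemma pair_index_ex k j : exists p : Idx n.+2,
  (val p == (k, lift k j)) || (val p == (lift k j, k)).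
Proof.
have [lt|] := ltnP k (lift k j).
  by exists (Sub (k, lift k j) lt); rewrite SubK eqxx.
rewrite leq_eqVlt => /predU1P[/val_inj E|lt]; first by have := neq_lift k j; rewrite E eqxx.
by exists (Sub (lift k j, k) lt); rewrite SubK eqxx orbT.
Qed.

Definition pair_index k j : Idx n.+2 := xchoose (pair_index_ex k j).

Lemma pair_indexP k j :
  val (pair_index k j) = (k, lift k j) \/ val (pair_index k j) = (lift k j, k).
Proof. by have /orP[/eqP|/eqP] := xchooseP (pair_index_ex k j); [left | right]. Qed.

(** Injectivity for fixed [k] is what gives each entry of the matrix attached to [k] a random
    integer of its own. *)
Lemma pair_index_inj k : injective (pair_index k).
Proof.
move=> i j E; have ni := neq_lift k i; have nj := neq_lift k j; move: (pair_indexP k i); rewrite E.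
case: (pair_indexP k j) => -> [] Ek.
- by have /lift_inj-> := congr1 snd Ek.
- by have /= Ek' := congr1 fst Ek; rewrite -Ek' eqxx in ni.
- by have /= Ek' := congr1 fst Ek; rewrite Ek' eqxx in nj.
by have /lift_inj-> := congr1 fst Ek.
Qed.

Definition pair_sign k j : int := if (k < lift k j)%N then 1 else -1.

Lemma om_sample s k j t : om (lamOf s) (delta_mx 0 k) (delta_mx 0 (lift k j)) 0 t =
  pair_sign k j * (Posz (s (t, pair_index k j)) - Posz l).
Proof.
have lamE (p : Idx n.+2) : lamOf s t (val p).1 (val p).2 = Posz (s (t, p)) - Posz l.
  by rewrite /lamOf -surjective_pairing valK.
have ltp : ((val (pair_index k j)).1 < (val (pair_index k j)).2)%N := valP (pair_index k j).
rewrite /om mxE [X in _ + X]mxE !beta_delta /pair_sign -lamE.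
case: (pair_indexP k j) ltp => -> /= lt.
  by rewrite lt ltnNge ltnW // subr0 mul1r.
by rewrite lt ltnNge ltnW //= sub0r mulN1r.
Qed.

Definition entry s k (i j : nat) : int :=
  om (lamOf s) (delta_mx 0 k) (delta_mx 0 (lift k (inord j))) 0 (inord i).
Definition minor_mx s k r : 'M[int]_r := \matrix_(i < r, j < r) entry s k i j.

Definition first_zero_minor k r : {set Sample n.+2 m.+1 l} :=
  [set s | (\det (minor_mx s k r) != 0) && (\det (minor_mx s k r.+1) == 0)].

Lemma det_minorS s k r : \det (minor_mx s k r.+1) =
  \sum_(j < r) entry s k r j * cofactor (minor_mx s k r.+1) ord_max (widen_ord (leqnSn r) j)
  + entry s k r r * \det (minor_mx s k r).
Proof.
rewrite (expand_det_row _ ord_max) big_ord_recr /=; congr (_ + _).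
  by apply: eq_bigr => j _; rewrite mxE.
rewrite mxE; congr (_ * _); rewrite /cofactor /= addnn -signr_odd odd_double mul1r.
congr (\det _); apply/matrixP => i j; rewrite !mxE.
by rewrite !lift_max.
Qed.

(* The minor of order [r + 1] is affine in its last diagonal entry, with slope the
   minor of order [r]; and each entry of the matrix is, up to sign, a random
   integer of its own. *)
Lemma card_first_zero_minor k r : (r <= n)%N -> (r <= m)%N ->
  (#|first_zero_minor k r| * (2 * l + 1) <= #|[set: Sample n.+2 m.+1 l]|)%N.
Proof.
move=> ler lem; rewrite cardsT; apply: (card_fiber_le1 (x0 := (inord r, pair_index k (inord r)))).
move=> s s'; rewrite !inE => /andP[nz /eqP z] /andP[nz' /eqP z'] E.
have entE (i j : nat) : (i <= r)%N -> (j <= r)%N -> (i != r) || (j != r) -> entry s k i j = entry s' k i j.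
  move=> lei lej ne; rewrite /entry !om_sample E //; apply: contraTneq ne => -[Ei /pair_index_inj Ej].
  have /(congr1 val) := Ei; have /(congr1 val) := Ej.
  rewrite /= !inordK ?ltnS //; try exact: leq_trans ler; try exact: leq_trans lem.
  by move=> -> ->; rewrite eqxx.
have Er : minor_mx s k r = minor_mx s' k r.
  apply/matrixP => i j; rewrite !mxE; have li := ltn_ord i; have lj := ltn_ord j.
  by rewrite entE ?(ltnW li) ?(ltnW lj) // neq_ltn li.
have Ec (j : 'I_r) : cofactor (minor_mx s k r.+1) ord_max (widen_ord (leqnSn r) j) =
    cofactor (minor_mx s' k r.+1) ord_max (widen_ord (leqnSn r) j).
  congr (_ * \det _); apply/matrixP => i i'; rewrite !mxE lift_max.
  have li := ltn_ord i; have := ltn_ord (lift (widen_ord (leqnSn r) j) i') => li'.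
  by rewrite entE ?(ltnW li) // neq_ltn li.
have : entry s k r r = entry s' k r r.
  apply: (mulIf nz); move: z z'; rewrite !det_minorS -Er => z z'.
  apply: (addrI (\sum_(j < r) entry s k r j *
    cofactor (minor_mx s k r.+1) ord_max (widen_ord (leqnSn r) j))).
  rewrite z -[LHS]z'; congr (_ + _); apply: eq_bigr => j _; rewrite Ec entE ?(ltnW (ltn_ord j)) //.
  by rewrite (ltn_eqF (ltn_ord j)) orbT.
rewrite /entry !om_sample => /mulfI; have -> : pair_sign k (inord r) != 0 by rewrite /pair_sign; case: ifP.
by move=> /(_ isT) /addIr[] /val_inj.
Qed.

Lemma small_centralizers_of_minors s : (n <= m)%N ->
  (forall k, \det (minor_mx s k n.+1) != 0) -> small_centralizers (lamOf s).
Proof.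
move=> lenm nz k x omx; exists (x 0 k).
pose v : 'cV[int]_n.+1 := \col_j x 0 (lift k j).
have Eom : om (lamOf s) (delta_mx 0 k) x =
    \sum_j x 0 (lift k j) *: om (lamOf s) (delta_mx 0 k) (delta_mx 0 (lift k j)).
  have omD : {morph om (lamOf s) (delta_mx 0 k) : y z / y + z} by move=> y z; apply: omDr.
  rewrite {1}(row_sum_delta x) (big_morph _ omD (om0r _ _)) (bigD1 k) //= omZr omxx scaler0 add0r.
  rewrite (reindex_onto (lift k) (fun i => odflt ord0 (unlift k i))) /=; last first.
    by move=> j; rewrite eq_sym => /unlift_some[j' -> ->].
  apply: eq_big => [j|j _]; last exact: omZr.
  by rewrite eq_sym neq_lift liftK eqxx.
have Av : minor_mx s k n.+1 *m v = 0.
  apply/colP => i; rewrite [RHS]mxE.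
  transitivity (om (lamOf s) (delta_mx 0 k) x 0 (inord i)); last by rewrite omx mxE.
  rewrite Eom summxE mxE; apply: eq_bigr => j _.
  by rewrite [minor_mx _ _ _ _ _]mxE [v _ _]mxE [RHS]mxE /entry inord_val mulrC.
have v0 : v = 0.
  have : \adj (minor_mx s k n.+1) *m (minor_mx s k n.+1 *m v) = 0 by rewrite Av mulmx0.
  (* Over the integers the matrix need not be invertible; the adjugate leaves a nonzero scalar times
     [v]. *)
  rewrite mulmxA mul_adj_mx mul_scalar_mx => /eqP.
  by rewrite scalemx_eq0 (negbTE (nz k)) => /eqP.
apply/rowP => i; rewrite !mxE eqxx /=; have [j ->|->] := unliftP k i; last by rewrite eqxx mulr1.
have /colP/(_ j) := v0; rewrite !mxE => ->.
by rewrite eq_sym (negbTE (neq_lift _ _)) mulr0.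
Qed.

End RandomMinors.

Lemma aas_small_centralizers (n m : nat) : (n <= m)%N ->
  @aas n.+2 m.+1 (fun l s => small_centralizers (lamOf s)).
Proof.
move=> lenm eps eps0; pose C := (n.+2 * n.+1)%N.
(* For [l > C / eps], the proportion of bad samples, at most [C / (2 l + 1)], is below [eps]. *)
exists (Num.bound (C%:R / eps)%R) => l leL.
pose bad : {set Sample n.+2 m.+1 l} := \bigcup_(u : 'I_n.+2 * 'I_n.+1) @first_zero_minor n m l u.1 u.2.
exists (~: bad); split.
  move=> s; rewrite in_setC => /bigcupP sgood; apply: small_centralizers_of_minors => // k.
  (* The empty minor is [1], and a good sample has no first zero minor, so nonvanishing passes from
     each order to the next. *)
  have: forall r, (r <= n.+1)%N -> (\det (minor_mx s k r) != 0)%R; last by apply.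
  elim=> [|r IH] ler; first by rewrite det_mx00 oner_eq0.
  apply/negP => z; apply: sgood; exists (k, Ordinal ler) => //.
  by rewrite inE z IH // ltnW.
have leB : (#|bad| * (2 * l + 1) <= C * #|[set: Sample n.+2 m.+1 l]|)%N.
  have le_sum : (#|bad| <= \sum_(u : 'I_n.+2 * 'I_n.+1) #|@first_zero_minor n m l u.1 u.2|)%N.
    rewrite /bad; elim/big_rec2: _ => [|u x y _ le]; first by rewrite cards0.
    by apply: leq_trans (leq_card_setU _ _) _; rewrite leq_add2l.
  apply: leq_trans (leq_mul le_sum (leqnn _)) _.
  have -> : C = #|{: 'I_n.+2 * 'I_n.+1}| by rewrite card_prod !card_ord.
  rewrite big_distrl -sum_nat_const; apply: leq_sum => u _.
  by apply: card_first_zero_minor; [|apply: leq_trans lenm]; rewrite -ltnS.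
have tot0 : (0 < #|[set: Sample n.+2 m.+1 l]|)%N.
  by apply/card_gt0P; exists [ffun=> Ordinal (ltn_addl (2 * l) (ltn0Sn 0))]; rewrite inE.
have Ctot : (C%:R < eps * (2 * l + 1)%:R :> rat)%R.
  rewrite mulrC -ltr_pdivrMr //; apply: lt_le_trans (archi_boundP _) _.
    by rewrite divr_ge0 ?ler0n // ltW.
  by rewrite ler_nat; apply: leq_trans leL _; lia.
have -> : (#|~: bad|%:R = #|[set: Sample n.+2 m.+1 l]|%:R - #|bad|%:R :> rat)%R.
  by rewrite cardsT -(cardsC bad) natrD addrAC subrr add0r.
rewrite mulrBl mul1r ltrD2l ltrN2.
have q0 : (0 < (2 * l + 1)%:R :> rat)%R by rewrite ltr0n addn1.
rewrite -(ltr_pM2r q0) mulrAC; apply: (@le_lt_trans _ _ (C%:R * #|[set: Sample n.+2 m.+1 l]|%:R)%R).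
  by rewrite -!natrM ler_nat.
by rewrite ltr_pM2r // ltr0n.
Qed.

Theorem theorem4p8 (n m : nat) :
  (1 <= n.-1)%N -> (n.-1 <= m)%N ->
  aas (fun l (s : Sample n m l) =>
    let G := NilG (lamOf s) in
    [/\ (forall x : G, central x <-> gen (fun y => exists t, y = gen_c (lamOf s) t) x),
        (forall k : 'I_n, c_small (gen_a (lamOf s) k))
      & (forall i j : 'I_n, (i < j)%N -> comm (gen_a (lamOf s) i) (gen_a (lamOf s) j) <> gone G)] /\
    [/\ Z_edefinable G,
        DZ_reducible_to (@enc_G n m (lamOf s)),
        ~ D_decidable (@enc_G n m (lamOf s)),
        max_ring_of_scalars_is_Z G
      & ~ nonabelian_direct_decomp G]).
Proof.
(* The hypotheses exclude [n < 2] and [m = 0]; in the shifted variables [n - 1 <= m] reads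
   [n <= m]. *)
case: n => [|[|n]] // _; case: m => [|m] // le_nm eps eps0.
have [L HL] := @aas_small_centralizers n m le_nm eps eps0.
exists L => l /HL[A [HA lt_A]]; exists A; split=> // s /HA sc {HA lt_A HL} G.
have ab : (ord0 : 'I_n.+2) != ord_max by [].
split; split.
- by move=> x; rewrite (centralE sc ab) gen_cP.
- exact: (c_small_gen sc ab).
- move=> i j lt_ij; rewrite commE => -[] /eqP; apply/negP; apply: (om_delta_neq0 sc).
  by rewrite neq_ltn lt_ij.
- exact: (Z_edefinable_NilG sc ab).
- exact: (DZ_reducible_NilG sc).
- exact: (D_undecidable_NilG sc).
- exact: (max_ring_of_scalars_NilG sc ab).
exact: (not_nonabelian_direct_decomp sc ord0).
Qed.
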